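(* Let $1 \leq p,q \leq \infty$, $0 \leq r < \frac{1}{p}$, and let $c_0>0$ be a constant. Then for any integer $b\geq 2$ there is a constant $c > 0$ (independent of $n$ and of the point set) such that for any $n \in \mathbb{N}$ and any generalized Hammersley type point set $\mathcal{R}_n$ in base $b$ with $|2a_n - n| \leq c_0$, we have \[ \left\| D_{\mathcal{R}_n} \,|\, S_{pq}^r B([0,1)^2) \right\| \leq c \, b^{n(r-1)} \, n^{\frac{1}{q}}. \]
   Context: Generalized Hammersley type point sets: let $b\ge 2$ be an integer and $n\in\mathbb{N}=\{1,2,\dots\}$. For each $1\le i\le n$ let $s_i:\{0,\ldots,b-1\}\to\{0,\ldots,b-1\}$ be either the map $s_i(t)=t$ for all $t$, or the map $s_i(t)=b-1-t$ for all $t$. The associated point set in $[0,1)^2$ is \[ \mathcal{R}_n=\Big\{\Big(\frac{t_n}{b}+\frac{t_{n-1}}{b^2}+\ldots+\frac{t_1}{b^n},\ \frac{s_1(t_1)}{b}+\frac{s_2(t_2)}{b^2}+\ldots+\frac{s_n(t_n)}{b^n}\Big): t_1,\ldots,t_n\in\{0,\ldots,b-1\}\Big\}, \] which has exactly $b^n$ points. Put $a_n=\#\{i\in\{1,\ldots,n\}: s_i \text{ is the map } t\mapsto t\}$. Discrepancy function: for an $N$-point set $\mathcal{P}\subset[0,1)^d$, \[ D_{\mathcal{P}}(x)=\frac1N\sum_{z\in\mathcal{P}}\mathbf{1}_{C_z}(x)-x_1\cdots x_d,\qquad x\in[0,1)^d, \] where $C_z=(z_1,1)\times\ldots\times(z_d,1)$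 and $\mathbf 1_{C_z}$ is its characteristic function. Besov spaces with dominating mixed smoothness: let $\varphi_0\in\mathcal{S}(\mathbb{R})$ satisfy $\varphi_0(t)=1$ for $|t|\le1$ and $\varphi_0(t)=0$ for $|t|>\frac32$; for $k\in\mathbb{N}$ put $\varphi_k(t)=\varphi_0(2^{-k}t)-\varphi_0(2^{-k+1}t)$, and for $k\in\mathbb{N}_0^d$, $t\in\mathbb{R}^d$ put $\varphi_k(t)=\varphi_{k_1}(t_1)\cdots\varphi_{k_d}(t_d)$. Let $\mathcal{F}$ be the Fourier transform. For $0<p,q\le\infty$, $r\in\mathbb{R}$, $S_{pq}^rB(\mathbb{R}^d)$ consists of all tempered distributions $f\in\mathcal{S}'(\mathbb{R}^d)$ with finite quasi-norm \[ \|f|S_{pq}^rB(\mathbb{R}^d)\|=\Big(\sum_{k\in\mathbb{N}_0^d}2^{r(k_1+\ldots+k_d)q}\|\mathcal{F}^{-1}(\varphi_k\mathcal{F}f)|L_p(\mathbb{R}^d)\|^q\Big)^{1/q} \] (usual modification if $q=\infty$). Let $\mathcal D([0,1)^d)$ be the complex-valued $C^\infty$ functions on $\mathbb R^d$ with compact support in the interior of $[0,1)^d$ and $\mathcal{D}'([0,1)^d)$ the dual space of distributions. $S_{pq}^rB([0,1)^d)$ consists of all $f\in\mathcal{D}'([0,1)^d)$ with finite quasi-norm $\|f|S_{pq}^rB([0,1)^d)\|=\inf\{\|g|S_{pq}^rB(\mathbb{R}^d)\|: g\in S_{pq}^rB(\mathbb{R}^d),\ g|_{[0,1)^d}=f\}$.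 Convention: $1/\infty=0$. *)

(* Defs.v *)
From HB Require Import structures.
From mathcomp Require Import all_boot all_order all_algebra finmap.
From mathcomp Require Import all_classical all_reals all_analysis.
From mathcomp Require Import complex.
Import Order.TTheory GRing.Theory Num.Theory.
Import numFieldNormedType.Exports.

Set Implicit Arguments.
Unset Strict Implicit.
Unset Printing Implicit Defensive.

Local Open Scope classical_set_scope.
Local Open Scope complex_scope.
Local Open Scope ring_scope.

Local Notation Re := (@complex.Re _).
Local Notation Im := (@complex.Im _).
Local Notation normc := (@Normc.normc _).

(* R * R is the plane and R[i] the complex numbers over R. *)

Section ComplexValued.
Context {R : realType}.

Definition expi (t : R) : R[i] := cos t +i* sin t.

Definition cdifferentiable {V : normedModType R} (f : V -> R[i]) (x : V) : Prop :=
  differentiable (Re \o f : V -> R^o) x /\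
  differentiable (Im \o f : V -> R^o) x.

Definition cderive {V : normedModType R} (v : V) (f : V -> R[i]) : V -> R[i] :=
  fun x => 'D_v (Re \o f : V -> R^o) x +i* 'D_v (Im \o f : V -> R^o) x.

Definition plane_measure :
    {measure set (measurableTypeR R * measurableTypeR R) -> \bar R} :=
  (lebesgue_measure \x lebesgue_measure)%E.

Definition cintegrable (f : R * R -> R[i]) : Prop :=
  plane_measure.-integrable setT (EFin \o (Re \o f)) /\
  plane_measure.-integrable setT (EFin \o (Im \o f)).

Definition cintegral (D : set (R * R)) (f : R * R -> R[i]) : R[i] :=
  (\int[plane_measure]_(x in D) Re (f x)) +i*
  (\int[plane_measure]_(x in D) Im (f x)).

End ComplexValued.

Section TemperedDistributions.
Context {R : realType}.
Implicit Types (psi : R * R -> R[i]) (u : (R * R -> R[i]) -> R[i]).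

Definition cderive1n (m : nat) (f : R -> R[i]) : R -> R[i] :=
  iter m (cderive (1 : R^o)) f.

(* The condition at all orders is equivalent to f being C^oo. *)
Definition smooth1 (f : R -> R[i]) : Prop :=
  forall m (x : R^o), cdifferentiable (cderive1n m f : R^o -> R[i]) x.

Definition schwartz1 (f : R -> R[i]) : Prop :=
  smooth1 f /\
  forall k m : nat, exists M : R, forall x : R,
    (1 + `|x|) ^+ k * normc (cderive1n m f x) <= M.

Definition partial (i j : nat) psi : R * R -> R[i] :=
  iter i (cderive ((1, 0) : R^o * R^o)) (iter j (cderive ((0, 1) : R^o * R^o)) psi).

(* Since every partial derivative is required to be totally differentiable,
   mixed derivatives commute, and this is equivalent to psi being C^oo. *)
Definition smooth psi : Prop :=
  forall (i j : nat) (x : R^o * R^o), cdifferentiable (partial i j psi) x.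

(* The N-th seminorm defining the topology of the Schwartz space S(R^2). *)
Definition schwartz_seminorm (N : nat) psi : \bar R :=
  ereal_sup (range (fun x : R^o * R^o =>
    ((1 + `|x|) ^+ N *
      \sum_(a : 'I_N.+1 * 'I_N.+1 | (a.1 + a.2 <= N)%N)
        normc (partial a.1 a.2 psi x))%:E)).

Definition schwartz psi : Prop :=
  smooth psi /\ forall N, (schwartz_seminorm N psi < +oo)%E.

(* An element of S'(R^2) is encoded as a functional on all functions, of which
   only the values on Schwartz functions are meaningful: everything below
   evaluates it on Schwartz functions only. *)
Definition tempered u : Prop :=
  (forall (a : R[i]) psi chi, schwartz psi -> schwartz chi ->
     u (fun x => a * psi x + chi x) = a * u psi + u chi) /\
  (exists (N : nat) (C : R), forall psi, schwartz psi ->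
     ((normc (u psi))%:E <= C%:E * schwartz_seminorm N psi)%E).

Definition dotp (x y : R * R) : R := x.1 * y.1 + x.2 * y.2.

Definition fourier psi : R * R -> R[i] := fun xi =>
  ((2 * pi)^-1)%:C * cintegral setT (fun x => expi (- dotp x xi) * psi x).

Definition ifourier psi : R * R -> R[i] := fun x =>
  ((2 * pi)^-1)%:C * cintegral setT (fun xi => expi (dotp x xi) * psi xi).

Definition dfourier u : (R * R -> R[i]) -> R[i] := fun psi => u (fourier psi).

Definition difourier u : (R * R -> R[i]) -> R[i] := fun psi => u (ifourier psi).

Definition dmul (phi : R * R -> R[i]) u : (R * R -> R[i]) -> R[i] :=
  fun psi => u (fun x => phi x * psi x).

Definition represented_by u (h : R * R -> R[i]) : Prop :=
  forall psi, schwartz psi ->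
    cintegrable (fun x => h x * psi x) /\
    u psi = cintegral setT (fun x => h x * psi x).

(* || u | L_p(R^2) || of a tempered distribution u; it is +oo when u is not a
   regular distribution, and otherwise the representing h is unique almost
   everywhere, so that the infimum is over a single value. *)
Definition dLnorm (p : \bar R) u : \bar R :=
  ereal_inf [set ('N[plane_measure]_p[EFin \o (normc \o h)])%E
            | h in represented_by u].

End TemperedDistributions.

Section Besov.
Context {R : realType}.
Implicit Types (u : (R * R -> R[i]) -> R[i]) (phi : R -> R[i]).

Definition resolution_generator phi : Prop :=
  [/\ schwartz1 phi,
      forall t : R, `|t| <= 1 -> phi t = 1 &
      forall t : R, 3 / 2 < `|t| -> phi t = 0].

Definition dyadic phi (k : nat) : R -> R[i] := fun t =>
  if k is k'.+1 then phi (t / 2 ^+ k) - phi (t / 2 ^+ k') else phi t.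

Definition dyadic2 phi (k : nat * nat) : R * R -> R[i] := fun t =>
  dyadic phi k.1 t.1 * dyadic phi k.2 t.2.

Definition besov_term phi (p : \bar R) (r : R) u (k : nat * nat) : \bar R :=
  ((2 `^ (r * (k.1 + k.2)%:R))%:E *
   dLnorm p (difourier (dmul (dyadic2 phi k) (dfourier u))))%E.

(* || u | S^r_{pq}B(R^2) ||, for 0 < p, q <= +oo. *)
Definition besov_norm phi (p q : \bar R) (r : R) u : \bar R :=
  match q with
  | q'%:E =>
      ((\esum_(k in [set: nat * nat]) besov_term phi p r u k `^ q') `^ q'^-1)%E
  | _ => ereal_sup (range (besov_term phi p r u))
  end.

Definition besov phi (p q : \bar R) (r : R) u : Prop :=
  tempered u /\ (besov_norm phi p q r u < +oo)%E.

Definition unit_square : set (R * R) := [set` `[0, 1[] `*` [set` `[0, 1[].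

(* The test functions D([0,1)^2). *)
Definition test_function (psi : R * R -> R[i]) : Prop :=
  smooth psi /\
  exists K : set (R * R), [/\ compact K, K `<=` unit_square^° &
    forall x, ~ K x -> psi x = 0].

(* || f | S^r_{pq}B([0,1)^2) || for f in D'([0,1)^2), a functional on test
   functions; it is +oo when f is not in S^r_{pq}B([0,1)^2). *)
Definition besov_norm_square phi (p q : \bar R) (r : R)
    (f : (R * R -> R[i]) -> R[i]) : \bar R :=
  ereal_inf [set besov_norm phi p q r g
            | g in [set g | besov phi p q r g /\
                            forall psi, test_function psi -> g psi = f psi]].

Definition square_distribution (f : R * R -> R) : (R * R -> R[i]) -> R[i] :=
  fun psi => cintegral unit_square (fun x => (f x)%:C * psi x).

End Besov.

Section Hammersley.
Context {R : realType}.

Definition discrepancy (P : {fset R * R}) (x : R * R) : R :=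
  (#|` P|%:R)^-1 * (\sum_(z <- P) \1_([set` `]z.1, 1[] `*` [set` `]z.2, 1[]) x)
  - x.1 * x.2.

Definition digit_maps (b n : nat) (s : 'I_n -> 'I_b -> 'I_b) : Prop :=
  forall i, (forall t, s i t = t) \/ (forall t, (s i t : nat) = (b - 1 - t)%N).

(* Indices are shifted: i : 'I_n stands for the index i.+1 of the text. *)
Definition hammersley_point (b n : nat) (s : 'I_n -> 'I_b -> 'I_b)
    (t : {ffun 'I_n -> 'I_b}) : R * R :=
  (\sum_(i < n) (t i)%:R / b%:R ^+ (n - i),
   \sum_(i < n) (s i (t i))%:R / b%:R ^+ i.+1).

Definition hammersley (b n : nat) (s : 'I_n -> 'I_b -> 'I_b) : {fset R * R} :=
  [fset hammersley_point s t | t in {ffun 'I_n -> 'I_b}]%fset.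

Definition num_id (b n : nat) (s : 'I_n -> 'I_b -> 'I_b) : nat :=
  #|[pred i | [forall t, s i t == t]]|.

End Hammersley.

(* Main.v *)
Require Import Defs.
From HB Require Import structures.
From mathcomp Require Import all_boot all_order all_algebra finmap.
From mathcomp Require Import all_classical all_reals all_analysis.
From mathcomp Require Import complex measurable_realfun ring lra zify.
Import Order.TTheory GRing.Theory Num.Theory.
Import numFieldNormedType.Exports.

Set Implicit Arguments.
Unset Strict Implicit.
Unset Printing Implicit Defensive.
Local Open Scope classical_set_scope.
Local Open Scope ring_scope.

(** The distribution attached to the discrepancy acts by integration against
    the discrepancy function, extended by zero outside the unit square. This
    extension already has a Besov norm of the right size, so that it serves as
    the competitor in the infimum that defines the norm on the square. Its
    dyadic piece of index k is its convolution with a tensor product of two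
    one-dimensional dyadic kernels (fourier_dyadic_ifourier and
    convolution_represents, both instances of Fubini's theorem). The kernels
    are Fourier integrals of smooth functions of compact support, hence decay
    fast and are Lipschitz with a decaying constant (good_kernel,
    transform_decay). After separation of real and imaginary parts each piece
    is a combination of four real functions smoothed_discrepancy, and it
    remains to bound their L_p norms, weighted by 2^(r (k1 + k2)).

    The tool is a b-adic Haar expansion. Averages over the b-adic intervals of
    level j (ecell), and differences of averages of consecutive levels (ucell),
    produce the Haar coefficients coef of the discrepancy; smoothing turns the
    indicator of a b-adic interval into cell, an increment of a primitive of
    the kernel; and the levels telescope back to the smoothed discrepancy
    (sum_levels). The coefficients satisfy the following bounds.
    - If j1, j2 >= 1 and j1 + j2 <= n, all but two digits average out and the
      coefficients are O(b^(j1 + j2 - 2n)) (coef_below).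
    - If j1 + j2 <= n and one of the levels is 0, they are O(b^-n)
      (coef_left_edge, coef_right_edge). Of these, the coefficient of the pair
      of levels (0, 0) is the mean of the discrepancy, which up to O(b^-n) is
      the covariance of the two coordinates of a point. Every digit adds the
      same multiple of b^-n to this covariance, with sign plus if its map is
      the identity and minus if it is the reflection, whence a multiple of
      (2 a_n - n) b^-n (coef_corner). The balance hypothesis enters here, and
      only here.
    - If j1 + j2 > n, they are O(b^-n) because an elementary rectangle of area
      about b^-n contains boundedly many points, and their sum over one pair of
      levels is O(1) (coef_above, sum_coef_norm).

    The contribution of the cells of level j at frequency k is governed by
    u = 2^k / b^j (dominated_cells_ex): decay of the primitive of the kernel
    makes it small for large u, and for small u the vanishing of Haar sums over
    the b parts of an interval gains a factor u. Bounds in L_1 and in L_oo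
    interpolate to L_p (haar_term_Lnorm), and the hypothesis 0 <= r < 1/p turns
    the result into a weight min(u, 1/u)^(1/p - r) for each coordinate
    (powR_ratio_weight), summable over k and over j. What is left is, up to the
    factor X = b^(n (r - 1)), a weight on pairs of levels that decays
    geometrically away from j1 + j2 = n, plus the edges j1 = 0 and j2 = 0; it
    is bounded, with total mass O(n). Hence the weighted L_p norms of the pieces
    are O(X) uniformly in k, with sum O(n X) (smoothed_besov_sums), and
    interpolation between these two bounds gives O(n^(1/q) X) for their l_q norm
    (esum_power_le). *)

(** * Derivatives and primitives on the line *)

Section Calculus.
Context {R : realType}.
Implicit Types f g h : R -> R.

Definition has_deriv f f' := forall x : R, is_derive x 1 f (f' x).

Lemma has_deriv_ext f f' g' : f' =1 g' -> has_deriv f f' -> has_deriv f g'.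
Proof. by move=> e h x; rewrite -e. Qed.

Lemma has_deriv_cont f f' : has_deriv f f' -> continuous f.
Proof.
move=> h x; apply/differentiable_continuous/derivable1_diffP.
by have [] := h x.
Qed.

Lemma has_deriv_cst (c : R) : has_deriv (fun=> c) (fun=> 0).
Proof. by move=> x; exact: is_derive_cst. Qed.

Lemma has_deriv_id : has_deriv id (fun=> 1).
Proof. by move=> x; exact: is_derive_id. Qed.

Lemma has_derivD f f' g g' : has_deriv f f' -> has_deriv g g' ->
  has_deriv (fun x => f x + g x) (fun x => f' x + g' x).
Proof. by move=> hf hg x; apply: is_deriveD. Qed.

Lemma has_derivN f f' : has_deriv f f' ->
  has_deriv (fun x => - f x) (fun x => - f' x).
Proof. by move=> hf x; apply: is_deriveN. Qed.

Lemma has_derivB f f' g g' : has_deriv f f' -> has_deriv g g' ->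
  has_deriv (fun x => f x - g x) (fun x => f' x - g' x).
Proof. by move=> hf hg x; apply: is_deriveB. Qed.

Lemma has_derivM f f' g g' : has_deriv f f' -> has_deriv g g' ->
  has_deriv (fun x => f x * g x) (fun x => f' x * g x + f x * g' x).
Proof.
move=> hf hg x; have := @is_deriveM _ _ f g x 1 _ _ (hf x) (hg x).
by rewrite addrC /GRing.scale/= (mulrC (g x)).
Qed.

Lemma has_derivZ f f' (c : R) : has_deriv f f' ->
  has_deriv (fun x => c * f x) (fun x => c * f' x).
Proof. by move=> hf x; apply: (@is_deriveZ _ _ _ f c x 1 _ (hf x)). Qed.

Lemma has_deriv_comp f f' g g' : has_deriv f f' -> has_deriv g g' ->
  has_deriv (fun x => f (g x)) (fun x => f' (g x) * g' x).
Proof. by move=> hf hg x; apply: is_derive1_comp. Qed.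

Lemma has_deriv_lin f f' (c d : R) : has_deriv f f' ->
  has_deriv (fun x => f (c * x + d)) (fun x => c * f' (c * x + d)).
Proof.
move=> hf; have hl : has_deriv (fun x => c * x + d) (fun=> c).
  apply: has_deriv_ext (has_derivD (has_derivZ c has_deriv_id) (has_deriv_cst d)).
  by move=> x /=; rewrite mulr1 addr0.
by apply: has_deriv_ext (has_deriv_comp hf hl) => x /=; rewrite mulrC.
Qed.

(** Both g - f and g + f are nondecreasing on the interval. *)
Lemma le_increment f f' g g' (a b : R) :
    has_deriv f f' -> has_deriv g g' ->
    (forall x, a <= x <= b -> `|f' x| <= g' x) -> a <= b ->
  `|f b - f a| <= g b - g a.
Proof.
move=> hf hg fg ab.
have mono h h' : has_deriv h h' -> (forall x, a <= x <= b -> 0 <= h' x) ->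
    h a <= h b.
  move=> hh h0.
  have [||c cab hE] := @MVT_segment R h h' a b ab.
  - by move=> x _; exact: hh.
  - exact/continuous_subspaceT/(has_deriv_cont hh).
  by rewrite -subr_ge0 hE mulr_ge0 ?subr_ge0// h0//; move: cab; rewrite in_itv.
have h1 := mono _ _ (has_derivB hg hf).
have h2 := mono _ _ (has_derivD hg hf).
have {}h1 : g a - f a <= g b - f b.
  apply: h1 => x /fg; rewrite ler_norml => /andP[_].
  by rewrite -subr_ge0.
have {}h2 : g a + f a <= g b + f b.
  by apply: h2 => x /fg; rewrite ler_norml => /andP[+ _]; lra.
by rewrite ler_norml; apply/andP; split; lra.
Qed.

Lemma Rintegral_deriv f f' (a b : R) : a <= b -> has_deriv f f' ->
  continuous f' -> \int[lebesgue_measure]_(x in `[a, b]) f' x = f b - f a.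
Proof.
move=> ab hf cf; move: ab; rewrite le_eqVlt => /predU1P[<-|ab].
  by rewrite set_itv1 Rintegral_set1 subrr.
rewrite /Rintegral (@continuous_FTC2 _ f' f)//.
- exact/continuous_subspaceT.
- have cF := has_deriv_cont hf; split.
  + by move=> x _; have [] := hf x.
  + exact/cvg_at_right_filter/cF.
  + exact/cvg_at_left_filter/cF.
- by move=> x _; rewrite derive1E; have [] := hf x.
Qed.

(** F is the integral from 0 to x minus the integral from x to 0, one of which
    is over an empty interval. Near x it differs by a constant from the
    integral from a point a to the left of 0 and of x, where the fundamental
    theorem of calculus applies. *)
Lemma continuous_has_primitive f : continuous f -> exists F, has_deriv F f.
Proof.
move=> cf.
have intf (a b : R) : lebesgue_measure.-integrable `[a, b] (EFin \o f).
  apply: continuous_compact_integrable; first exact: segment_compact.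
  exact/continuous_subspaceT.
pose F (x : R) : R := parameterized_integral lebesgue_measure 0 x f
           - parameterized_integral lebesgue_measure x 0 f.
have FB (a x : R) : a <= 0 -> a <= x -> F x = parameterized_integral lebesgue_measure a x f
    - parameterized_integral lebesgue_measure a 0 f.
  move=> a0 ax; rewrite /F /parameterized_integral.
  have itvB (u v : R) : a <= u -> u <= v ->
     \int[lebesgue_measure]_(t in `[a, v]) f t - \int[lebesgue_measure]_(t in `[a, u]) f t =
     \int[lebesgue_measure]_(t in `[u, v]) f t.
    move=> au uv; rewrite Rintegral_itvB ?bnd_simp//.
    rewrite Rintegral_itv_obnd_cbnd//.
    by apply: integrableS (intf u v) => //; exact: subset_itv_oc_cc.
  have [x0|x0] := leP x 0.
    rewrite -(itvB _ _ ax x0); move: x0; rewrite le_eqVlt => /predU1P[->|x0].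
      by rewrite set_itv1 Rintegral_set1; lra.
    rewrite (_ : \int[lebesgue_measure]_(t in `[0, x]) f t = 0); last first.
      by rewrite set_itv_ge ?Rintegral_set0// bnd_simp -ltNge.
    by lra.
  have z0 : \int[lebesgue_measure]_(t in `[x, 0]) f t = 0.
    by rewrite set_itv_ge ?Rintegral_set0// bnd_simp -ltNge.
  by rewrite z0 subr0; apply/esym/(itvB _ _ a0 (ltW x0)).
exists F => x.
pose a := Num.min 0 x - 1.
have a0 : a < 0 by rewrite /a ltrBlDr (le_lt_trans (_ : _ <= 0)) ?ge_min ?lexx// add0r ltr01.
have ax : a < x by rewrite /a ltrBlDr (le_lt_trans (_ : _ <= x)) ?ge_min ?lexx ?orbT// ltrDl ltr01.
have [dx xE] := @continuous_FTC1_closed R f a x (x + 1) (ltr_pwDr ltr01 (lexx _))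
  (intf _ _) ax (cf x).
set G := fun y => _ in dx xE.
have GD : is_derive x 1 (fun y => G y - parameterized_integral lebesgue_measure a 0 f) (f x).
  have dG : is_derive x 1 G (f x).
    by apply: (DeriveDef dx); rewrite -xE derive1E.
  have := is_deriveB dG (@is_derive_cst _ _ _ (parameterized_integral lebesgue_measure a 0 f) x 1).
  by rewrite subr0.
apply: near_eq_is_derive GD.
by apply: filterS (lt_nbhsr ax) => y /ltW ay; rewrite (FB a y (ltW a0)).
Qed.

End Calculus.

(** * Fourier integrals of smooth functions of compact support *)

Section Transforms.
Context {R : realType}.
Local Notation mu := (@lebesgue_measure R).
Implicit Types (f w : R -> R) (x M C : R).

Lemma continuous_integrable_itv f (a b : R) : continuous f ->
  mu.-integrable `[a, b] (EFin \o f).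
Proof.
move=> cf; apply: continuous_compact_integrable; first exact: segment_compact.
exact/continuous_subspaceT.
Qed.

(** Cosine and sine with their derivatives: the class is closed under
    differentiation, so that estimates for Fourier integrals need only one
    proof. *)
Definition oscillator w w' :=
  [/\ has_deriv w w', has_deriv w' (fun x => - w x),
      forall x, `|w x| <= 1 & forall x, `|w' x| <= 1].

Lemma oscillator_cos : oscillator cos (fun x => - sin x).
Proof.
split; first by move=> x; exact: is_derive_cos.
- by apply: has_derivN => x; exact: is_derive_sin.
- by move=> x; rewrite ler_norml cos_geN1 cos_le1.
- by move=> x; rewrite normrN ler_norml sin_geN1 sin_le1.
Qed.

Lemma oscillator_sin : oscillator (@sin R) cos.
Proof.
split; first by move=> x; exact: is_derive_sin.
- by move=> x; exact: is_derive_cos.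
- by move=> x; rewrite ler_norml sin_geN1 sin_le1.
- by move=> x; rewrite ler_norml cos_geN1 cos_le1.
Qed.

Lemma oscillator_deriv w w' : oscillator w w' -> oscillator w' (fun x => - w x).
Proof.
move=> [h1 h2 b1 b2]; split => //; last by move=> x; rewrite normrN.
exact: has_derivN.
Qed.

(** A smooth function F 0 with support in [-3/2, 3/2], together with all its
    derivatives. *)
Definition bump_chain (F : nat -> R -> R) :=
  (forall m, has_deriv (F m) (F m.+1)) /\
  (forall m x, 3 / 2 < `|x| -> F m x = 0).

Lemma bump_chain_cont F m : bump_chain F -> continuous (F m).
Proof. by move=> [dF _]; exact: has_deriv_cont (dF m). Qed.

Lemma bump_chain_edge F m : bump_chain F -> F m 2 = 0 /\ F m (-2) = 0.
Proof.
move=> [_ sF]; split; apply: sF; rewrite ?normrN ger0_norm//; lra.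
Qed.

Lemma bump_chain_bounded F m : bump_chain F ->
  exists2 M : R, 0 <= M & forall x, `|F m x| <= M.
Proof.
move=> cF; have cm := bump_chain_cont (m := m) cF.
have cn : continuous (fun x => `|F m x|).
  by move=> x; apply: (continuous_comp (cm x)); exact: norm_continuous.
have [|c _ cP] := @EVT_max R (fun x => `|F m x|) (-2) 2 ltac:(lra).
  exact/continuous_subspaceT.
exists `|F m c| => // x.
have [x2|x2] := leP `|x| (3/2).
  by apply: cP; rewrite in_itv/=; move: x2; rewrite ler_norml; lra.
by rewrite (proj2 cF) ?normr0.
Qed.

(** The derivatives of x F x, by the Leibniz rule. *)
Lemma bump_chain_mulX F : bump_chain F ->
  bump_chain (fun m x => x * F m x + m%:R * F m.-1 x).
Proof.
move=> [dF sF]; split => [m|m x x2]; last by rewrite !sF ?mulr0 ?addr0.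
have h := has_derivD (has_derivM has_deriv_id (dF m)) (has_derivZ m%:R (dF m.-1)).
apply: has_deriv_ext h => x /=.
case: m => [|m] /=; first by rewrite !mul0r addr0 mul1r addrC.
by rewrite -natr1; ring.
Qed.

(** The cut-off 2 lies outside the support [-3/2, 3/2] of the functions to
    which this is applied, so that integration by parts has no boundary terms.
    *)
Definition transform w f (x : R) : R :=
  \int[mu]_(t in `[-2, 2]) (w (x * t) * f t).

Lemma continuous_mulfun f g : continuous f -> continuous g ->
  continuous (fun x : R => f x * g x : R).
Proof. by move=> cf cg x; apply: cvgM; [exact: cf|exact: cg]. Qed.

Lemma transform_integrand_cont w w' f (x : R) : oscillator w w' ->
  continuous f -> continuous (fun t : R => w (x * t) * f t).
Proof.
move=> [dw _ _ _] cf; apply: continuous_mulfun => //.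
have := has_deriv_cont (has_deriv_lin x 0 dw).
by under eq_fun do rewrite addr0.
Qed.

Lemma transform_le w w' f M x : oscillator w w' -> continuous f ->
  (forall t, `|f t| <= M) -> `|transform w f x| <= 4 * M.
Proof.
move=> hw cf fM.
have ci := transform_integrand_cont (x := x) hw cf.
apply: le_trans (le_normr_Rintegral _ _) _ => //.
  exact: continuous_integrable_itv.
apply: (@le_trans _ _ (\int[mu]_(t in `[(-2), 2]) M)); last first.
  rewrite Rintegral_cst//= lebesgue_measure_itv/= lte_fin ifT; last by lra.
  by rewrite -EFinD /=; lra.
apply: le_Rintegral => //.
- apply: (@continuous_integrable_itv (fun t => `|w (x * t) * f t|)) => t.
  by apply: (continuous_comp (ci t)); exact: norm_continuous.
- by apply: continuous_integrable_itv => t; exact: cvg_cst.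
- move=> t _; rewrite normrM; have [_ _ w1 _] := hw.
  by rewrite (le_trans (ler_wpM2r _ (w1 _)))// mul1r.
Qed.

(** The function F m.+1 w - x F m w' of t, with w and w' taken at x t, has
    derivative F m.+2 w + x^2 F m w and vanishes at both ends. *)
Lemma transform_green w w' F x m : oscillator w w' -> bump_chain F ->
  x ^+ 2 * transform w (F m) x = - transform w (F m.+2) x.
Proof.
move=> hw cF; have [dw dw' _ _] := hw; have [dF _] := cF.
have dwx := has_deriv_lin x 0 dw; have dwx' := has_deriv_lin x 0 dw'.
have ci k := continuous_integrable_itv (-2) 2
  (transform_integrand_cont (x := x) hw (bump_chain_cont (m := k) cF)).
have ci2 : mu.-integrable `[-2, 2] (EFin \o (fun t => x ^+ 2 * (w (x * t) * F m t))).
  apply: (@continuous_integrable_itv (fun t => x ^+ 2 * (w (x * t) * F m t))) => t.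
  apply: cvgM; first exact: cvg_cst.
  exact: (transform_integrand_cont (x := x) hw (bump_chain_cont (m := m) cF)).
have D := has_derivB (has_derivM (dF m.+1) dwx)
  (has_derivM (dF m) (has_derivZ x dwx')).
have {}D := has_deriv_ext (g' := fun t => w (x * t) * F m.+2 t + x ^+ 2 * (w (x * t) * F m t)) _ D.
have {}D := D (fun t => ltac:(rewrite /= !addr0; ring)).
have cc : continuous (fun t : R => w (x * t) * F m.+2 t + x ^+ 2 * (w (x * t) * F m t)).
  move=> t; apply: cvgD; first exact: (transform_integrand_cont (x := x) hw (bump_chain_cont (m := m.+2) cF)).
  apply: cvgM; first exact: cvg_cst.
  exact: (transform_integrand_cont (x := x) hw (bump_chain_cont (m := m) cF)).
have := @Rintegral_deriv _ _ _ (-2) 2 ltac:(lra) D cc.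
have [e1 e2] := bump_chain_edge m cF; have [e3 e4] := bump_chain_edge m.+1 cF.
rewrite e1 e2 e3 e4 !mul0r subrr (RintegralD _ (ci m.+2) ci2)//.
rewrite (RintegralZl _ _ (ci m))// => E.
by rewrite /transform; apply/eqP; rewrite -addr_eq0 addrC; apply/eqP/E.
Qed.

(** Two applications of transform_green: (1 + x^2)^2 times the transform of F
    is a combination of the transforms of F, F 2 and F 4. *)
Lemma transform_decay w w' F : oscillator w w' -> bump_chain F ->
  exists2 C : R, 0 <= C & forall x, `|transform w (F 0%N) x| <= C / (1 + x ^+ 2) ^+ 2.
Proof.
move=> hw cF.
have [M0 M00 b0] := bump_chain_bounded 0 cF.
have [M2 M20 b2] := bump_chain_bounded 2 cF.
have [M4 M40 b4] := bump_chain_bounded 4 cF.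
exists (4 * M0 + 2 * (4 * M2) + 4 * M4) => [|x]; first by lra.
have x2 : 0 < 1 + x ^+ 2 by rewrite ltr_pwDl// sqr_ge0.
rewrite ler_pdivlMr ?exprn_gt0//.
have t0 := transform_le x hw (bump_chain_cont (m := 0%N) cF) b0.
have t2 := transform_le x hw (bump_chain_cont (m := 2%N) cF) b2.
have t4 := transform_le x hw (bump_chain_cont (m := 4%N) cF) b4.
rewrite -[X in _ * X]ger0_norm ?exprn_ge0 ?(ltW x2)// -normrM.
have g0 := transform_green x 0 hw cF; have g2 := transform_green x 2 hw cF.
have -> : transform w (F 0%N) x * (1 + x ^+ 2) ^+ 2 =
  transform w (F 0%N) x - 2 * transform w (F 2%N) x + transform w (F 4%N) x.
  rewrite -[transform w (F 2%N) x]opprK -g0 -[transform w (F 4%N) x]opprK -g2.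
  by rewrite -[transform w (F 2%N) x]opprK -g0; ring.
rewrite (le_trans (ler_normD _ _))// lerD// (le_trans (ler_normB _ _))// lerD//.
by rewrite normrM ger0_norm// ler_wpM2l.
Qed.

(** Differentiation under the integral, with majorant |t f t|. *)
Lemma transform_deriv w w' f : oscillator w w' -> continuous f ->
  has_deriv (transform w f) (transform w' (fun t => t * f t)).
Proof.
move=> hw cf a; have [dw dw' b1 b1'] := hw.
have hw' := oscillator_deriv hw.
have cG : continuous (fun t : R => t * f t : R).
  by apply: continuous_mulfun => // t; exact: cvg_id.
have dE x y : is_derive x 1 (fun x : R => w (x * y) * f y) (w' (x * y) * (y * f y)).
  have /(_ x)/= := has_derivM (has_deriv_lin y 0 dw) (has_deriv_cst (f y)).
  have -> : y * w' (y * x + 0) * f y + w (y * x + 0) * 0 = w' (x * y) * (y * f y).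
    by rewrite !addr0 (mulrC y x); ring.
  have -> // : (fun x : R => w (y * x + 0) * f y) = (fun x : R => w (x * y) * f y).
  by apply/funext => t; rewrite addr0 mulrC (mulrC y) mulrC.
pose G (y : R) : R := `|y * f y|.
have cnG : continuous G.
  by move=> t; apply: (continuous_comp (cG t)); exact: norm_continuous.
have h1 : forall x, `](a - 1), (a + 1)[%classic x -> mu.-integrable `[(-2), 2] (EFin \o (fun y : R => w (x * y) * f y)).
  by move=> x _; exact: (continuous_integrable_itv _ _ (transform_integrand_cont hw cf)).
have h2 : forall x y, `](a - 1), (a + 1)[%classic x -> `[(-2), 2]%classic y -> derivable (fun x : R => w (x * y) * f y) x 1.
  by move=> x y _ _; have [] := dE x y.
have h3 : forall x y, `](a - 1), (a + 1)[%classic x -> `[(-2), 2]%classic y -> `|partial1of2 (fun x y : R => w (x * y) * f y) x y| <= G y.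
  move=> x y _ _; rewrite partial1of2E; have [_ ->] := dE x y.
  by rewrite normrM ler_piMl.
have Ia : `](a - 1), (a + 1)[%classic a by rewrite /= in_itv/=; lra.
have iG := continuous_integrable_itv (-2) 2 cnG.
have G0 y : 0 <= G y by exact: normr_ge0.
apply: DeriveDef.
  exact: (@derivable_under_integral _ _ _ _ _ _ _ _ _ _ Ia h1 h2 _ G0 iG h3).
rewrite -derive1E.
rewrite (@differentiation_under_integral _ _ _ _ _ _ _ _ _ _ Ia h1 h2 _ G0 iG h3)//.
by apply: eq_Rintegral => y _; rewrite partial1of2E; have [_ ->] := dE a y.
Qed.

(** The first bound yields the decay of primitives, the second a Lipschitz
    estimate whose constant still has an integrable decay. *)
Definition good_kernel (C : R) (k : R -> R) :=
  [/\ 0 <= C, continuous k, (forall x, `|k x| <= C / (1 + x ^+ 2) ^+ 2) &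
   (forall x h, `|h| <= 1 -> `|k (x - h) - k x| <= C * `|h| / (1 + x ^+ 2))].

(** The derivative of the transform is the transform of t F t with the derived
    oscillator, which decays for the same reason. *)
Lemma good_kernel_transform w w' F : oscillator w w' -> bump_chain F ->
  exists C, good_kernel C (transform w (F 0%N)).
Proof.
move=> hw cF.
have [C0 C00 b0] := transform_decay hw cF.
have [C1 C10 b1] := transform_decay (oscillator_deriv hw) (bump_chain_mulX cF).
have dT := transform_deriv hw (bump_chain_cont (m := 0%N) cF).
have b1' x : `|transform w' (fun t => t * F 0%N t) x| <= C1 / (1 + x ^+ 2) ^+ 2.
  apply: le_trans (b1 x); rewrite le_eqVlt; apply/orP; left; apply/eqP.
  congr (`| _ |); apply: eq_Rintegral => t _.
  by rewrite mul0r addr0.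
exists (C0 + 3 * C1); split.
- by rewrite addr_ge0// mulr_ge0.
- exact: has_deriv_cont dT.
- move=> x; apply: le_trans (b0 x) _; rewrite ler_wpM2r ?invr_ge0 ?exprn_ge0 ?addr_ge0 ?sqr_ge0//.
  by rewrite lerDl mulr_ge0.
- move=> x h h1.
  have x2 : 0 < 1 + x ^+ 2 by rewrite ltr_pwDl// sqr_ge0.
  have key (u v : R) : u <= v -> `|u - x| <= 1 -> `|v - x| <= 1 ->
     `|transform w (F 0%N) v - transform w (F 0%N) u| <= 3 * C1 / (1 + x ^+ 2) * (v - u).
    move=> uv ux vx; rewrite mulrBr.
    apply: (le_increment dT (has_derivZ _ (@has_deriv_id R))) => // t /andP[ut tv].
    rewrite mulr1; apply: le_trans (b1' t) _.
    have t2 : 0 < 1 + t ^+ 2 by rewrite ltr_pwDl// sqr_ge0.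
    have t21 : 1 <= 1 + t ^+ 2 by rewrite lerDl sqr_ge0.
    have tx : `|t - x| <= 1 by move: ux vx; rewrite !ler_norml; lra.
    have xt : 1 + x ^+ 2 <= 3 * (1 + t ^+ 2).
      have : 0 <= (2 * t - x) ^+ 2 by rewrite sqr_ge0.
      have : 0 <= (1 - (t - x)) * (1 + (t - x)).
        by move: tx; rewrite ler_norml => tx; rewrite mulr_ge0//; lra.
      by nra.
    rewrite ler_pdivlMr// mulrAC ler_pdivrMr ?exprn_gt0//.
    rewrite (mulrC 3) -mulrA ler_wpM2l// (le_trans xt)// ler_wpM2l// expr2.
    by rewrite ler_peMl// ltW.
  have c3 : 3 * C1 <= C0 + 3 * C1 by rewrite lerDr.
  apply: (@le_trans _ _ (3 * C1 / (1 + x ^+ 2) * `|h|)); last first.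
    by rewrite mulrAC ler_wpM2r ?invr_ge0 ?(ltW x2)// ler_wpM2r.
  have [h0|h0] := leP 0 h.
  + rewrite distrC; apply: le_trans (key (x - h) x _ _ _) _.
    * lra.
    * by rewrite addrAC subrr add0r normrN.
    * by rewrite subrr normr0.
    * by rewrite subKr (ger0_norm h0).
  + apply: le_trans (key x (x - h) _ _ _) _.
    * lra.
    * by rewrite subrr normr0.
    * by rewrite addrAC subrr add0r normrN.
    * by rewrite addrAC subrr add0r (ltr0_norm h0).
Qed.

Lemma good_kernel_lin C D k l (a b : R) : good_kernel C k -> good_kernel D l ->
  good_kernel (`|a| * C + `|b| * D) (fun x => a * k x + b * l x).
Proof.
move=> [C0 ck bk Lk] [D0 cl bl Ll]; split.
- by rewrite addr_ge0// mulr_ge0.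
- by move=> x; apply: cvgD; apply: cvgM; [exact: cvg_cst|exact: ck|exact: cvg_cst|exact: cl].
- move=> x; rewrite (le_trans (ler_normD _ _))// !normrM mulrDl -!mulrA.
  by rewrite lerD// ler_wpM2l.
- move=> x h h1; have -> : a * k (x - h) + b * l (x - h) - (a * k x + b * l x) =
    a * (k (x - h) - k x) + b * (l (x - h) - l x) by ring.
  rewrite (le_trans (ler_normD _ _))// !normrM !mulrDl.
  by rewrite lerD// -2!mulrA ler_wpM2l// mulrA ?Lk ?Ll.
Qed.

End Transforms.

(** * Dyadic kernels and their primitives *)

Section DyadicKernels.
Context {R : realType}.
Implicit Types (kap P F : R -> R) (C M s x y t u v h : R).

Lemma gt0_1Dsqr x : 0 < 1 + x ^+ 2.
Proof. by rewrite ltr_pwDl// sqr_ge0. Qed.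

Lemma ge1_1Dsqr x : 1 <= 1 + x ^+ 2.
Proof. by rewrite lerDl sqr_ge0. Qed.

Lemma le_1Dsqr_near t u : `|u - t| <= 1 -> 1 + u ^+ 2 <= 3 * (1 + t ^+ 2).
Proof.
rewrite ler_norml => tu.
have : 0 <= (1 - (t - u)) * (1 + (t - u)) by rewrite mulr_ge0//; lra.
have : 0 <= (2 * t - u) ^+ 2 by rewrite sqr_ge0.
by nra.
Qed.

Lemma has_deriv_atan s : has_deriv (fun t => atan (s * t)) (fun t => s / (1 + (s * t) ^+ 2)).
Proof.
have h := has_deriv_lin s 0 (fun x => is_derive1_atan x).
move=> x; have := h x; rewrite !addr0; under eq_fun do rewrite addr0.
by [].
Qed.

(** The bound on the derivative of F is the derivative of M atan (s t). The
    benefit of this form is that sums over adjacent intervals telescope to at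
    most M pi. *)
Lemma increment_le_atan F F' M s u v : has_deriv F F' ->
    (forall t, `|F' t| <= M * (s / (1 + (s * t) ^+ 2))) -> v <= u ->
  `|F u - F v| <= M * (atan (s * u) - atan (s * v)).
Proof.
move=> dF bF vu; rewrite mulrBr.
by apply: (le_increment dF (has_derivZ M (has_deriv_atan s))).
Qed.

(** On intervals of length at most 1/s the weight 1 + (s t)^2 varies by a
    factor of at most 3. *)
Lemma increment_le_local F F' M s u v : has_deriv F F' -> 0 <= M -> 0 <= s ->
    (forall t, `|F' t| <= M * (s / (1 + (s * t) ^+ 2))) -> v <= u -> s * (u - v) <= 1 ->
  `|F u - F v| <= 3 * M * (s * (u - v)) / (1 + (s * u) ^+ 2).
Proof.
move=> dF M0 s0 bF vu su.
have -> : 3 * M * (s * (u - v)) / (1 + (s * u) ^+ 2) =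
   (3 * M * s / (1 + (s * u) ^+ 2)) * u - (3 * M * s / (1 + (s * u) ^+ 2)) * v by ring.
apply: (le_increment dF (has_derivZ _ (@has_deriv_id R))) => // t /andP[vt tu].
rewrite mulr1; apply: le_trans (bF t) _.
have st : `|s * u - s * t| <= 1.
  by rewrite -mulrBr ger0_norm ?mulr_ge0 ?subr_ge0//; apply: le_trans su; rewrite ler_wpM2l// lerB.
rewrite mulrA ler_pdivlMr ?gt0_1Dsqr// mulrAC ler_pdivrMr ?gt0_1Dsqr//.
have -> : 3 * M * s * (1 + (s * t) ^+ 2) = (M * s) * (3 * (1 + (s * t) ^+ 2)) by ring.
by rewrite ler_wpM2l ?mulr_ge0// le_1Dsqr_near.
Qed.

(** If kap is the inverse Fourier transform of phi, this is that of the k-th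
    dyadic function built from phi. *)
Definition dyadic_kernel kap (k : nat) x : R :=
  if k is k'.+1 then 2 ^+ k * kap (2 ^+ k * x) - 2 ^+ k' * kap (2 ^+ k' * x)
  else kap x.

Definition dyadic_primitive P (k : nat) u : R :=
  if k is k'.+1 then P (2 ^+ k * u) - P (2 ^+ k' * u) else P u.

Lemma dyadic_primitive_deriv P kap k : has_deriv P kap ->
  has_deriv (dyadic_primitive P k) (dyadic_kernel kap k).
Proof.
case: k => [//|k] dP x /=.
have /(_ x) := has_derivB (has_deriv_lin (2 ^+ k.+1) 0 dP) (has_deriv_lin (2 ^+ k) 0 dP).
rewrite /= !addr0; have -> // : (fun x0 => P (2 ^+ k.+1 * x0 + 0) - P (2 ^+ k * x0 + 0)) =
  (fun u => P (2 ^+ k.+1 * u) - P (2 ^+ k * u)).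
by apply/funext => t; rewrite !addr0.
Qed.

Lemma good_kernel_le1 C kap x : good_kernel C kap -> `|kap x| <= C / (1 + x ^+ 2).
Proof.
move=> [C0 _ b _]; apply: le_trans (b x) _.
rewrite ler_wpM2l// lef_pV2 ?posrE ?exprn_gt0 ?gt0_1Dsqr//.
by rewrite expr2 ler_peMl ?ge1_1Dsqr// ltW// gt0_1Dsqr.
Qed.

Lemma inv_1Dsqr_half x : (1 + (x / 2) ^+ 2)^-1 <= 4 / (1 + x ^+ 2).
Proof.
rewrite ler_pdivlMr ?gt0_1Dsqr// mulrC ler_pdivrMr ?gt0_1Dsqr//.
by have := sqr_ge0 x; lra.
Qed.

Lemma dyadic_kernel_le C kap k x : good_kernel C kap ->
  `|dyadic_kernel kap k x| <= 3 * C * (2 ^+ k / (1 + (2 ^+ k * x) ^+ 2)).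
Proof.
move=> gk; have [C0 _ _ _] := gk.
case: k => [|k] /=.
  rewrite expr0 mul1r mul1r; apply: le_trans (good_kernel_le1 x gk) _.
  by rewrite ler_wpM2r ?invr_ge0 ?(ltW (gt0_1Dsqr _))//; lra.
have s0 n : 0 <= 2 ^+ n :> R by rewrite exprn_ge0.
rewrite (le_trans (ler_normB _ _))// !normrM !(ger0_norm (s0 _)).
have e : 2 ^+ k * x = (2 ^+ k.+1 * x) / 2 by rewrite exprS; field.
have b1 := good_kernel_le1 (2 ^+ k.+1 * x) gk.
have b2 := good_kernel_le1 (2 ^+ k * x) gk.
have {b2} b2 : `|kap (2 ^+ k * x)| <= C * (4 / (1 + (2 ^+ k.+1 * x) ^+ 2)).
  by apply: le_trans b2 _; rewrite ler_wpM2l// e inv_1Dsqr_half.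
have := lerD (ler_wpM2l (s0 k.+1) b1) (ler_wpM2l (s0 k) b2).
move=> /le_trans; apply; rewrite le_eqVlt; apply/orP; left; apply/eqP.
by move: (1 + _) => I; rewrite exprS; ring.
Qed.

Lemma dyadic_kernel_lip C kap k x h : good_kernel C kap -> 2 ^+ k * `|h| <= 1 ->
  `|dyadic_kernel kap k (x - h) - dyadic_kernel kap k x| <=
     2 * C * (2 ^+ k * `|h|) * (2 ^+ k / (1 + (2 ^+ k * x) ^+ 2)).
Proof.
move=> gk; have [C0 _ _ L] := gk.
have s0 n : 0 <= 2 ^+ n :> R by rewrite exprn_ge0.
case: k => [|k] /= h1.
  rewrite expr0 !mul1r in h1 *; apply: le_trans (L x h h1) _.
  by rewrite ler_wpM2r ?invr_ge0 ?(ltW (gt0_1Dsqr _))// ler_wpM2r//; lra.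
have e : 2 ^+ k * x = (2 ^+ k.+1 * x) / 2 by rewrite exprS; field.
have h2 : 2 ^+ k * `|h| <= 1.
  by apply: le_trans h1; rewrite ler_wpM2r// exprS ler_peMl//; lra.
have b1 := L (2 ^+ k.+1 * x) (2 ^+ k.+1 * h).
rewrite normrM (ger0_norm (s0 _)) -mulrBr in b1; have {}b1 := b1 h1.
have b2 := L (2 ^+ k * x) (2 ^+ k * h).
rewrite normrM (ger0_norm (s0 _)) -mulrBr in b2; have {}b2 := b2 h2.
have {b2} b2 : `|kap (2 ^+ k * (x - h)) - kap (2 ^+ k * x)| <= C * (2 ^+ k * `|h|) * (4 / (1 + (2 ^+ k.+1 * x) ^+ 2)).
  by apply: le_trans b2 _; rewrite ler_wpM2l ?mulr_ge0// e inv_1Dsqr_half.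
set A := kap _ in b1 *; set B := kap _ in b1 *.
set A' := kap _ in b2 *; set B' := kap _ in b2 *.
have -> : 2 ^+ k.+1 * A - 2 ^+ k * A' - (2 ^+ k.+1 * B - 2 ^+ k * B') =
   2 ^+ k.+1 * (A - B) - 2 ^+ k * (A' - B') by ring.
rewrite (le_trans (ler_normB _ _))// !normrM !(ger0_norm (s0 _)).
have := lerD (ler_wpM2l (s0 k.+1) b1) (ler_wpM2l (s0 k) b2).
move=> /le_trans; apply; rewrite le_eqVlt; apply/orP; left; apply/eqP.
by move: (1 + _)^-1 => I; rewrite exprS; ring.
Qed.

(** For k >= 1 the primitive is the increment of P from v/2 to v, which is
    small because kap is small there. There is no decay for k = 0, since the
    integral of kap need not vanish. *)
Lemma dyadic_primitive_le C kap P k u : good_kernel C kap -> has_deriv P kap ->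
  `|dyadic_primitive P k.+1 u| <= 2 * C / (1 + (2 ^+ k.+1 * u) ^+ 2).
Proof.
move=> [C0 _ b _] dP /=.
have -> : 2 ^+ k * u = (2 ^+ k.+1 * u) / 2 by rewrite exprS; field.
move: (2 ^+ k.+1 * u) => {u} v.
pose c := C / (1 + (v / 2) ^+ 2) ^+ 2.
have c0 : 0 <= c by rewrite divr_ge0// exprn_ge0// (ltW (gt0_1Dsqr _)).
have key : `|P v - P (v / 2)| <= c * `|v / 2|.
  have bd t : (v / 2) ^+ 2 <= t ^+ 2 -> `|kap t| <= c * 1.
    move=> vt; rewrite mulr1; apply: le_trans (b t) _; rewrite ler_wpM2l//.
    rewrite lef_pV2 ?posrE ?exprn_gt0 ?gt0_1Dsqr//.
    by rewrite lerXn2r ?nnegrE ?(ltW (gt0_1Dsqr _))// lerD2l.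
  have idc := has_derivZ c (@has_deriv_id R).
  have [v0|v0] := leP 0 v.
    have := le_increment dP idc (a := v / 2) (b := v) _ _.
    rewrite -mulrBr (ger0_norm (_ : 0 <= v / 2)); last by lra.
    have -> : v - v / 2 = v / 2 by field.
    apply; last by lra.
    by move=> t /andP[vt _]; apply: bd; rewrite lerXn2r// nnegrE; lra.
  have := le_increment dP idc (a := v) (b := v / 2) _ _.
  rewrite distrC -mulrBr (ler0_norm (_ : v / 2 <= 0)); last by lra.
  have -> : v / 2 - v = - (v / 2) by field.
  apply; last by lra.
  by move=> t /andP[_ vt]; apply: bd; rewrite -sqrrN -[t ^+ 2]sqrrN lerXn2r ?nnegrE ?lerN2//; lra.
apply: le_trans key _.
have v1 : 2 * `|v / 2| <= 1 + (v / 2) ^+ 2.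
  by rewrite -(real_normK (num_real (v / 2))); have := sqr_ge0 (1 - `|v / 2|); lra.
apply: (@le_trans _ _ (C * (1 / 2) * (1 + (v / 2) ^+ 2)^-1)).
  rewrite /c -!mulrA ler_wpM2l// expr2 invfM -!mulrA.
  rewrite mul1r [leRHS]mulrC ler_wpM2l ?invr_ge0 ?(ltW (gt0_1Dsqr _))//.
  by rewrite ler_pdivrMl ?gt0_1Dsqr//; lra.
apply: le_trans (ler_wpM2l _ (inv_1Dsqr_half v)) _; first by lra.
by rewrite le_eqVlt; apply/orP; left; apply/eqP; field; rewrite gt_eqF// gt0_1Dsqr.
Qed.

End DyadicKernels.

(** * Smoothed b-adic intervals *)

Section CellSystem.
Context {R : realType}.
Local Notation mu := (@lebesgue_measure R).
Implicit Types (kap P F : R -> R) (C M s x y t u v h : R).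

Lemma integral_oneDsqrT : (\int[mu]_y ((1 + y ^+ 2)^-1)%:E = (pi : R)%:E)%E.
Proof.
rewrite (@ge0_symfun_integralT _ (fun y => (1 + y ^+ 2)^-1)).
- rewrite -set_itvcy (@integral0y_oneDsqr R) -EFinM; congr EFin; by field.
- by move=> x; rewrite invr_ge0 ltW// gt0_1Dsqr.
- exact: continuous_oneDsqrV.
- by move=> x /=; rewrite sqrrN.
Qed.

(** All decay estimates are compared with this Cauchy bump of width 1/s. *)
Lemma integral_bump s x : 0 < s ->
  (\int[mu]_y ((1 + (s * (y - x)) ^+ 2)^-1)%:E = (pi / s)%:E)%E.
Proof.
move=> s0; pose F y : R := s * y + (- s * x).
have dF : has_deriv F (fun=> s).
  have := has_deriv_lin s (- s * x) (@has_deriv_id R).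
  by apply: has_deriv_ext => y /=; rewrite mulr1.
have F' : F^`()%classic = cst s.
  by apply/funext => y; rewrite derive1E; have [] := dF y.
have := @increasing_ge0_integration_by_substitutionT R F (fun y => (1 + y ^+ 2)^-1).
rewrite integral_oneDsqrT F' => /(_ _ _ _ _ _ _ _ _ _)/esym H.
have {H} : (\int[mu]_y (((1 + (s * (y - x)) ^+ 2)^-1)%:E * s%:E) = (pi : R)%:E)%E.
  rewrite -H.
  - apply: eq_integral => y _; rewrite -EFinM/= /F; congr (EFin (_^-1 * _)).
    by congr (1 + _ ^+ 2); rewrite mulrBr mulNr.
  - by move=> a c ac; rewrite /F ltrD2r ltr_pM2l.
  - by move=> ?; exact: cvg_cst.
  - exact: is_cvg_cst.
  - exact: is_cvg_cst.
  - by move=> y; have [] := dF y.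
  - apply/cvgrNyPle => A; near=> y.
    have : y <= (A + s * x) / s by near: y; apply: nbhs_ninfty_le; exact: num_real.
    by rewrite ler_pdivlMr// /F; lra.
  - apply/cvgryPge => A; near=> y.
    have : (A + s * x) / s <= y by near: y; apply: nbhs_pinfty_ge; exact: num_real.
    by rewrite ler_pdivrMr// /F; lra.
  - exact: continuous_oneDsqrV.
  - by move=> y; rewrite invr_ge0 ltW// gt0_1Dsqr.
have mb : measurable_fun setT (fun y => (1 + (s * (y - x)) ^+ 2)^-1).
  apply: continuous_measurable_fun => y.
  have -> : (fun y => (1 + (s * (y - x)) ^+ 2)^-1) = (fun y => (1 + y ^+ 2)^-1) \o F.
    by apply/funext => z; rewrite /= /F mulrBr mulNr.
  apply: continuous_comp; first exact: (has_deriv_cont dF).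
  exact: continuous_oneDsqrV.
move=> H; transitivity ((s^-1)%:E * \int[mu]_y (((1 + (s * (y - x)) ^+ 2)^-1)%:E * s%:E))%E.
  rewrite -ge0_integralZl//.
  - apply: eq_integral => y _; rewrite -!EFinM; congr EFin.
    by rewrite mulrCA mulVf ?mulr1// gt_eqF.
  - by apply/measurable_EFinP; apply: measurable_funM => //; exact: measurable_cst.
  - by move=> y _; rewrite -EFinM lee_fin mulr_ge0 ?invr_ge0 ?(ltW s0) ?(ltW (gt0_1Dsqr _)).
  - by rewrite lee_fin invr_ge0 ltW.
by rewrite H -EFinM mulrC.
Unshelve. all: end_near. Qed.

Lemma sum_nat_mul (m n : nat) (F : nat -> R) :
  \sum_(0 <= a < m * n) F a = \sum_(0 <= A < m) \sum_(0 <= d < n) F (A * n + d)%N.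
Proof.
elim: m => [|m IH]; first by rewrite mul0n !big_nil.
rewrite big_nat_recr//= -IH mulSnr (big_cat_nat (n := (m * n)%N)) ?leq_addr//=.
congr (_ + _); rewrite -{1}[(m * n)%N]add0n big_addn addKn.
by apply: eq_bigr => i _; rewrite addnC.
Qed.

Variable b : nat.
Hypothesis b_ge2 : (2 <= b)%N.

(** The convolution of the dyadic kernel with the indicator of the a-th b-adic
    interval of level j. *)
Definition cell P (k j a : nat) y : R :=
  dyadic_primitive P k (y - a%:R / b%:R ^+ j) - dyadic_primitive P k (y - a.+1%:R / b%:R ^+ j).

Let b0 : 0 < b%:R :> R. Proof. by rewrite ltr0n (leq_trans _ b_ge2). Qed.
Let b1 : 1 <= b%:R :> R. Proof. by rewrite ler1n (leq_trans _ b_ge2). Qed.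
Let bj0 j : 0 < b%:R ^+ j :> R. Proof. by rewrite exprn_gt0. Qed.

Lemma dyadic_primitive_cont P kap k : has_deriv P kap -> continuous (dyadic_primitive P k).
Proof. by move=> dP; exact: has_deriv_cont (dyadic_primitive_deriv k dP). Qed.

Lemma cell_cont P kap k j a : has_deriv P kap -> continuous (cell P k j a).
Proof.
move=> dP y; apply: (@cvgB R R^o) .
- apply: (continuous_comp (f := fun y => y - a%:R / b%:R ^+ j)).
    by apply: cvgB; [exact: cvg_id|exact: cvg_cst].
  exact: dyadic_primitive_cont dP _.
- apply: (continuous_comp (f := fun y => y - a.+1%:R / b%:R ^+ j)).
    by apply: cvgB; [exact: cvg_id|exact: cvg_cst].
  exact: dyadic_primitive_cont dP _.
Qed.

Lemma sum_cell P k j (m n : nat) y : (m <= n)%N ->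
  \sum_(m <= a < n) cell P k j a y =
  dyadic_primitive P k (y - m%:R / b%:R ^+ j) - dyadic_primitive P k (y - n%:R / b%:R ^+ j).
Proof.
move=> mn; pose f a := - dyadic_primitive P k (y - a%:R / b%:R ^+ j).
rewrite (eq_bigr (fun a => f a.+1 - f a)); last by move=> a _; rewrite /f /cell opprK addrC.
by rewrite telescope_sumr// /f opprK addrC.
Qed.

Lemma sum_cell_children P k j A y :
  \sum_(0 <= d < b) cell P k j.+1 (A * b + d) y = cell P k j A y.
Proof.
have e m : m%:R / b%:R ^+ j = (m * b)%:R / b%:R ^+ j.+1 :> R.
  by rewrite natrM exprSr invfM mulrACA divff ?mulr1// gt_eqF.
have <- : \sum_(A * b <= a < A.+1 * b) cell P k j.+1 a y = cell P k j A y.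
  by rewrite sum_cell ?leq_mul2r ?leqnSn ?orbT// -!e.
have := big_addn 0 (A.+1 * b) (A * b) xpredT (fun a => cell P k j.+1 a y).
rewrite add0n => ->; rewrite mulSn addnK.
by apply: eq_bigr => i _; rewrite addnC.
Qed.

Lemma sum_atan_cells s j y :
  \sum_(0 <= a < b ^ j) (atan (s * (y - a%:R / b%:R ^+ j)) - atan (s * (y - a.+1%:R / b%:R ^+ j))) <= pi.
Proof.
pose f a := - atan (s * (y - a%:R / b%:R ^+ j)).
rewrite (eq_bigr (fun a => f a.+1 - f a)); last by move=> a _; rewrite /f opprK addrC.
rewrite telescope_sumr// /f opprK addrC.
have := atan_ltpi2 (s * (y - 0%:R / b%:R ^+ j)).
have := atan_gtNpi2 (s * (y - (b ^ j)%:R / b%:R ^+ j)).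
by lra.
Qed.

(** The sequence is orthogonal to functions that are constant on the intervals
    of the coarser level, as Haar coefficients are. There is no condition at
    level 0. *)
Definition child_sum_zero (j : nat) (f : nat -> R) :=
  if j is j'.+1 then forall A, (A < b ^ j')%N -> \sum_(0 <= d < b) f (A * b + d)%N = 0
  else True.

Definition scale_ratio (k j : nat) : R := 2 ^+ k / b%:R ^+ j.

(** In a Haar sum over cells each cell may be modified by any function that
    depends on the parent interval only. After such a modification, to Q, the
    cells satisfy a pointwise bound in sum and an L_1 bound one by one. *)
Definition dominated_cells P k j (K : R) (Q : nat -> R -> R) :=
  [/\ forall a, continuous (Q a),
      forall f y, child_sum_zero j f ->
        \sum_(0 <= a < b ^ j) f a * cell P k j a y = \sum_(0 <= a < b ^ j) f a * Q a y,
      forall y, \sum_(0 <= a < b ^ j) `|Q a y| <= K * Num.min 1 (scale_ratio k j) &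
      forall a, (a < b ^ j)%N -> (\int[mu]_y (`|Q a y|)%:E <=
        (K / b%:R ^+ j * Num.min (scale_ratio k j) (scale_ratio k j)^-1)%:E)%E].

Lemma integral_bump_le (Q : R -> R) s M x : 0 < s -> 0 <= M -> continuous Q ->
  (forall y, `|Q y| <= M / (1 + (s * (y - x)) ^+ 2)) ->
  (\int[mu]_y (`|Q y|)%:E <= (M * pi / s)%:E)%E.
Proof.
move=> s0 M0 cQ QM.
have mb : measurable_fun setT (fun y => (1 + (s * (y - x)) ^+ 2)^-1).
  apply: continuous_measurable_fun.
  have h := has_deriv_lin s (- s * x) (@has_deriv_id R).
  have -> : (fun y => (1 + (s * (y - x)) ^+ 2)^-1) = (fun y => (1 + y ^+ 2)^-1) \o (fun y => s * y + - s * x).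
    by apply/funext => z; rewrite /= mulrBr mulNr.
  move=> y; apply: continuous_comp; first exact: (has_deriv_cont h).
  exact: continuous_oneDsqrV.
rewrite -mulrA EFinM -(integral_bump x s0) -ge0_integralZl//; last 2 first.
- exact/measurable_EFinP.
- by move=> y _; rewrite lee_fin invr_ge0 ltW// gt0_1Dsqr.
apply: ge0_le_integral => //.
- by apply/measurable_EFinP/measurableT_comp => //; exact: continuous_measurable_fun.
- by apply/measurable_EFinP; apply: measurable_funM => //; exact: measurable_cst.
- by move=> y _; rewrite -EFinM lee_fin.
Qed.

Section good.
Variables (C : R) (kap P : R -> R).
Hypotheses (gk : good_kernel C kap) (dP : has_deriv P kap).

Let C0 : 0 <= C. Proof. by have [] := gk. Qed.
Let s0 k : 0 < 2 ^+ k :> R. Proof. by rewrite exprn_gt0. Qed.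
Let dPk k := dyadic_primitive_deriv k dP.

Lemma cell_split j a y : y - a.+1%:R / b%:R ^+ j = (y - a%:R / b%:R ^+ j) - (b%:R ^+ j)^-1.
Proof. by rewrite -natr1 mulrDl mul1r opprD addrA. Qed.

Let pi0 : 0 <= pi :> R. Proof. exact: pi_ge0. Qed.

Lemma scale_ratio_gt0 k j : 0 < scale_ratio k j.
Proof. by rewrite divr_gt0. Qed.

Lemma cell_le_atan k j a y : `|cell P k j a y| <=
  3 * C * (atan (2 ^+ k * (y - a%:R / b%:R ^+ j)) - atan (2 ^+ k * (y - a.+1%:R / b%:R ^+ j))).
Proof.
apply: (increment_le_atan (dPk k)) => [t|]; first exact: dyadic_kernel_le.
by rewrite lerB// ler_wpM2r ?invr_ge0 ?(ltW (bj0 _))// ler_nat.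
Qed.

(** The arctangents telescope. *)
Lemma sum_cell_le k j y : \sum_(0 <= a < b ^ j) `|cell P k j a y| <= 3 * C * pi.
Proof.
apply: le_trans (ler_sum _ (fun a _ => cell_le_atan k j a y)) _.
by rewrite -mulr_sumr ler_wpM2l ?mulr_ge0// sum_atan_cells.
Qed.

Lemma integral_cell_le k j a :
  (\int[mu]_y (`|cell P k.+1 j a y|)%:E <= (4 * C * pi / 2 ^+ k.+1)%:E)%E.
Proof.
have cP x : continuous (fun y => dyadic_primitive P k.+1 (y - x)).
  move=> y; apply: (continuous_comp (f := fun y => y - x)).
    by apply: cvgB; [exact: cvg_id|exact: cvg_cst].
  exact: dyadic_primitive_cont dP _.
have iP x : (\int[mu]_y (`|dyadic_primitive P k.+1 (y - x)|)%:E <= (2 * C * pi / 2 ^+ k.+1)%:E)%E.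
  apply: (@integral_bump_le _ _ _ x) => //; first by rewrite mulr_ge0.
  by move=> y; exact: (dyadic_primitive_le _ _ gk dP).
have mP x : measurable_fun setT (fun y => (`|dyadic_primitive P k.+1 (y - x)|)%:E).
  by apply/measurable_EFinP/measurableT_comp => //; exact: continuous_measurable_fun.
have -> : 4 * C * pi / 2 ^+ k.+1 = 2 * C * pi / 2 ^+ k.+1 + 2 * C * pi / 2 ^+ k.+1 by ring.
rewrite EFinD; apply: le_trans (leeD (iP (a%:R / b%:R ^+ j)) (iP (a.+1%:R / b%:R ^+ j))).
rewrite -(ge0_integralD mu measurableT _ (mP _) _ (mP _))//; apply: ge0_le_integral => //.
- apply/measurable_EFinP/measurableT_comp => //; apply: continuous_measurable_fun.
  exact: cell_cont dP.
- by apply: emeasurable_funD; exact: mP.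
- by move=> y _; rewrite -EFinD lee_fin ler_normB.
Qed.

Lemma child_sum_zero_first j (f F : nat -> R) : child_sum_zero j.+1 f ->
  \sum_(0 <= a < b ^ j.+1) f a * F (a %/ b)%N = 0.
Proof.
move=> f0; rewrite expnSr sum_nat_mul big_nat big1// => A /andP[_ Aj].
under eq_big_nat => d /andP[_ db].
  by rewrite divnMDl ?(leq_trans _ b_ge2)// divn_small// addn0 over.
by rewrite -mulr_suml f0// mul0r.
Qed.

(** The kernel is finer than the interval, and the cell lives near the two end
    points of the interval, because primitives decay. For k = 0 this decay is
    missing and only the single interval of level 0 can be admitted. *)
Lemma large_cells k j : b%:R ^+ j <= b%:R * 2 ^+ k :> R ->
    (0 < k)%N || (j == 0%N) ->
  dominated_cells P k j (9 * C * pi * b%:R ^+ 2) (cell P k j).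
Proof.
move=> bk kj; split => //.
- by move=> a; exact: cell_cont dP.
- move=> y; apply: le_trans (sum_cell_le k j y) _.
  have um : b%:R^-1 <= Num.min 1 (scale_ratio k j).
    rewrite le_min invf_le1// b1/= /scale_ratio ler_pdivlMr// mulrC ler_pdivrMr// mulrC.
    by [].
  apply: (@le_trans _ _ (9 * C * pi * b%:R ^+ 2 * b%:R^-1)); last first.
    by rewrite ler_wpM2l// !mulr_ge0.
  rewrite expr2 mulrA mulfK ?gt_eqF//.
  apply: (@le_trans _ _ (9 * C * pi * 1)); last by rewrite ler_wpM2l ?mulr_ge0.
  by rewrite mulr1 ler_wpM2r// ler_wpM2r//; lra.
- move=> a ab; have u0 := scale_ratio_gt0 k j.
  have ui : b%:R^-1 <= scale_ratio k j.
    by rewrite /scale_ratio ler_pdivlMr// mulrC ler_pdivrMr// mulrC.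
  have um : (scale_ratio k j)^-1 <= b%:R ^+ 2 * Num.min (scale_ratio k j) (scale_ratio k j)^-1.
    case: (leP (scale_ratio k j) (scale_ratio k j)^-1) => uu.
      have bu : 1 <= b%:R * scale_ratio k j by rewrite -ler_pdivrMl// mulr1.
      by rewrite -[leLHS]div1r ler_pdivrMr// -mulrA -expr2 -exprMn exprn_ege1.
    by rewrite ler_peMl ?invr_ge0 ?(ltW u0)// exprn_ege1.
  have uj : (scale_ratio k j)^-1 / b%:R ^+ j = (2 ^+ k)^-1.
    by rewrite /scale_ratio invf_div mulrAC divff ?mul1r// gt_eqF.
  apply: (@le_trans _ _ (9 * C * pi / 2 ^+ k)%:E); last first.
    rewrite lee_fin -uj.
    have -> : 9 * C * pi * b%:R ^+ 2 / b%:R ^+ j * Num.min (scale_ratio k j) (scale_ratio k j)^-1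
     = 9 * C * pi * ((b%:R ^+ 2 * Num.min (scale_ratio k j) (scale_ratio k j)^-1) / b%:R ^+ j) by ring.
    by rewrite ler_wpM2l ?mulr_ge0// ler_wpM2r ?invr_ge0 ?(ltW (bj0 _)).
  case: k kj {bk u0 ui um uj} => [/= /eqP j0|k _].
    have a0 : a = 0%N by move: ab; rewrite j0 expn0; case: (a).
    rewrite expr0; apply: (@integral_bump_le _ _ _ 0) => //.
    + by rewrite mulr_ge0.
    + exact: cell_cont dP.
    + move=> y; rewrite a0 j0 /cell expr0 !divr1 subr0 mul1r.
      have := increment_le_local (dPk 0) (M := 3 * C) (s := 1) (u := y) (v := y - 1).
      have -> : y - (y - 1) = 1 by ring.
      rewrite !mul1r mulr1.
      have -> : 3 * (3 * C) = 9 * C by ring.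
      apply => //; first by rewrite mulr_ge0.
        by move=> t; have := dyadic_kernel_le 0 t gk; rewrite expr0 !mul1r.
      by lra.
  apply: le_trans (integral_cell_le k j a) _; rewrite lee_fin ler_wpM2r ?invr_ge0 ?(ltW (s0 _))//.
  by rewrite ler_wpM2r// ler_wpM2r//; lra.
Qed.

(** The cell of the first child of the same parent is subtracted, which leaves
    Haar sums unchanged. *)
Definition centered_cell k j a y : R := cell P k j a y - cell P k j (a %/ b * b) y.

Lemma centered_cell_cont k j a : continuous (centered_cell k j a).
Proof.
have c a' : continuous (cell P k j a') by exact: cell_cont dP.
by move=> y; apply: (@cvgB R R^o); exact: c.
Qed.

Let shifted k h y := dyadic_primitive P k (y - h) - dyadic_primitive P k y.

(** A second difference of the primitive, with both steps at most b times the
    length of the interval. *)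
Lemma centered_cellE k j a y :
  let h := (a %/ b * b)%:R / b%:R ^+ j - a%:R / b%:R ^+ j in
  let z := y - a%:R / b%:R ^+ j in
  centered_cell k j a y = - (shifted k h z - shifted k h (z - (b%:R ^+ j)^-1)).
Proof.
rewrite /= /centered_cell /cell /shifted -!natr1 !mulrDl !mul1r.
set x := a%:R / _; set x' := _%:R / _; set l := _^-1.
have -> : y - x - (x' - x) = y - x' by ring.
have -> : y - x - l - (x' - x) = y - (x' + l) by ring.
by rewrite opprD addrA; ring.
Qed.

(** The kernel is coarser than the interval: one step of the second difference
    is absorbed by the Lipschitz bound of the kernel, the other one by the
    increment of its primitive. *)
Lemma small_cells k j : b%:R * 2 ^+ k <= b%:R ^+ j.+1 :> R ->
  dominated_cells P k j.+1 (6 * C * pi * b%:R) (centered_cell k j.+1).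
Proof.
move=> kb; pose s : R := 2 ^+ k; pose l : R := (b%:R ^+ j.+1)^-1.
have sp : 0 < s by rewrite exprn_gt0.
have l0 : 0 < l by rewrite invr_gt0.
have uE : scale_ratio k j.+1 = s * l by [].
have u0 : 0 < s * l by rewrite mulr_gt0.
have bu : b%:R * (s * l) <= 1 by rewrite mulrA ler_pdivrMr// mul1r.
have u1 : s * l <= 1 by apply: le_trans bu; rewrite ler_peMl// ltW.
pose h a := (a %/ b * b)%:R * l - a%:R * l.
have hb a : s * `|h a| <= b%:R * (s * l).
  rewrite /h -mulrBl normrM (gtr0_norm l0) [leRHS]mulrCA ler_wpM2l ?(ltW sp)// ler_wpM2r ?(ltW l0)//.
  rewrite distrC -natrB; last exact: leq_trunc_div.
  by rewrite ger0_norm// ler_nat {1}(divn_eq a b) addKn ltnW// ltn_pmod// (leq_trans _ b_ge2).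
have h1 a : s * `|h a| <= 1 by exact: le_trans bu.
have dS a : has_deriv (shifted k (h a)) (fun t => dyadic_kernel kap k (t - h a) - dyadic_kernel kap k t).
  have dl := has_deriv_lin 1 (- h a) (dPk k).
  have e : (fun x => dyadic_primitive P k (1 * x + - h a)) = fun x => dyadic_primitive P k (x - h a).
    by apply/funext => x; rewrite mul1r.
  rewrite e in dl; apply: has_deriv_ext (has_derivB dl (dPk k)) => x /=.
  by rewrite !mul1r.
have bS a t : `|dyadic_kernel kap k (t - h a) - dyadic_kernel kap k t| <=
    2 * C * (b%:R * (s * l)) * (s / (1 + (s * t) ^+ 2)).
  apply: le_trans (dyadic_kernel_lip t gk (h1 a)) _.
  rewrite ler_wpM2r ?divr_ge0 ?(ltW sp) ?(ltW (gt0_1Dsqr _))//.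
  by rewrite ler_wpM2l ?mulr_ge0.
have M0 : 0 <= 2 * C * (b%:R * (s * l)) by rewrite !mulr_ge0// ltW.
split.
- exact: centered_cell_cont.
- move=> f y f0; apply/esym/eqP; rewrite -subr_eq0 -sumrB; apply/eqP.
  under eq_bigr do rewrite -mulrBr /centered_cell addrAC subrr add0r mulrN.
  rewrite sumrN (child_sum_zero_first (fun A => cell P k j.+1 (A * b) y))//.
  by rewrite oppr0.
- move=> y; rewrite uE (min_idPr u1).
  apply: (@le_trans _ _ (\sum_(0 <= a < b ^ j.+1) 2 * C * (b%:R * (s * l)) *
      (atan (s * (y - a%:R / b%:R ^+ j.+1)) - atan (s * (y - a.+1%:R / b%:R ^+ j.+1))))).
    apply: ler_sum => a _; rewrite centered_cellE normrN cell_split.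
    apply: (increment_le_atan (dS a)) => [t|]; first exact: bS.
    by rewrite gerBl ltW.
  rewrite -mulr_sumr; apply: le_trans (ler_wpM2l M0 (sum_atan_cells _ _ _)) _.
  have -> : 2 * C * (b%:R * (s * l)) * pi = (2 * (C * pi * b%:R)) * (s * l) by ring.
  have -> : 6 * C * pi * b%:R * (s * l) = (6 * (C * pi * b%:R)) * (s * l) by ring.
  rewrite ler_wpM2r ?(ltW u0)// ler_wpM2r ?mulr_ge0//; lra.
- move=> a ab; rewrite uE (min_idPl _); last first.
    by apply: (le_trans u1); rewrite (invf_ge1 u0) u1.
  have -> : 6 * C * pi * b%:R / b%:R ^+ j.+1 * (s * l) =
     (3 * (2 * C * (b%:R * (s * l))) * (s * l)) * pi / s.
    by rewrite -/l; field; rewrite gt_eqF.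
  apply: (@integral_bump_le _ _ _ (a%:R / b%:R ^+ j.+1)) => //.
  + by rewrite !mulr_ge0// ltW.
  + exact: centered_cell_cont.
  + move=> y; rewrite centered_cellE normrN.
    set z := y - _.
    have := increment_le_local (s := s) (u := z) (v := z - l) (dS a) M0 (ltW sp) (bS a).
    have -> : z - (z - l) = l by ring.
    by apply => //; rewrite gerBl ltW.
Qed.

(** The case k = 0, j >= 1 is excluded from large_cells, but then 2^k <=
    b^(j-1) and small_cells applies. *)
Lemma dominated_cells_ex : exists2 K : R, 0 < K & forall k j, exists Q, dominated_cells P k j K Q.
Proof.
exists (9 * C * pi * b%:R ^+ 2 + 6 * C * pi * b%:R + 1).
  by rewrite ltr_wpDl// addr_ge0// !mulr_ge0// exprn_ge0.
have mono K K' k j Q : K <= K' -> dominated_cells P k j K Q -> dominated_cells P k j K' Q.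
  move=> KK [cQ eQ sQ iQ]; have u0 := scale_ratio_gt0 k j; split => //.
    move=> y; apply: le_trans (sQ y) _; rewrite ler_wpM2r//.
    by rewrite le_min ler01 ltW.
  move=> a ab; apply: le_trans (iQ a ab) _; rewrite lee_fin.
  rewrite ler_wpM2r//; first by rewrite le_min invr_ge0 !ltW.
  by rewrite ler_wpM2r// invr_ge0 ltW.
have n1 : 0 <= 9 * C * pi * b%:R ^+ 2 by rewrite !mulr_ge0.
have n2 : 0 <= 6 * C * pi * b%:R by rewrite !mulr_ge0.
move=> k j; have [bk|kb] := leP (b%:R ^+ j) (b%:R * 2 ^+ k :> R).
  have [kj|] := boolP ((0 < k)%N || (j == 0%N)).
    by eexists; apply: mono (large_cells bk kj); lra.
  rewrite negb_or -eqn0Ngt => /andP[/eqP k0]; rewrite k0 in bk *.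
  case: j bk => // j bk _; eexists; apply: mono (@small_cells 0 j _); first by lra.
  by rewrite expr0 mulr1 exprS ler_peMr// exprn_ege1.
case: j kb => [|j] kb.
  by move: kb; rewrite expr0 ltNge mulr_ege1// exprn_ege1// ler1n.
by eexists; apply: mono (small_cells (ltW kb)); lra.
Qed.

End good.
End CellSystem.

(** * Norms of tensor sums *)

Section PlaneNorms.
Context {R : realType}.
Local Notation mu := (@lebesgue_measure R).
Local Notation plane := (@plane_measure R).
Implicit Types (f g : R * R -> R) (P Q : R -> R).

(** From |f|^p <= alpha^(p-1) |f|. *)
Lemma Lnorm_interpolation d (T : measurableType d) (nu : {measure set T -> \bar R})
    (f : T -> R) (p alpha beta : R) : measurable_fun setT f -> 1 <= p ->
  0 <= alpha -> 0 <= beta ->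
  (forall y, `|f y| <= alpha) -> (\int[nu]_y (`|f y|)%:E <= beta%:E)%E ->
  ('N[nu]_p%:E [EFin \o f] <= (alpha `^ (1 - p^-1) * beta `^ p^-1)%:E)%E.
Proof.
move=> mf p1 a0 b0 fa fb.
have p0 : 0 < p by exact: lt_le_trans p1.
have h : (\int[nu]_y (`|(EFin \o f) y| `^ p) <= (alpha `^ (p - 1) * beta)%:E)%E.
  apply: (@le_trans _ _ (\int[nu]_y ((alpha `^ (p - 1))%:E * (`|f y|)%:E)%E)%E).
    apply: ge0_le_integral => //.
    - by move=> y _; exact: poweR_ge0.
    - under eq_fun do rewrite abse_EFin poweR_EFin.
      apply/measurable_EFinP.
      by apply: (measurableT_comp (measurable_powR p)); exact: measurableT_comp.
    - apply/measurable_EFinP; apply: measurable_funM => //; exact: measurableT_comp.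
    - move=> y _; rewrite abse_EFin poweR_EFin -EFinM lee_fin.
      rewrite -mulr_powRB1// mulrC ler_wpM2r//.
      by rewrite ge0_ler_powR ?nnegrE// subr_ge0.
  rewrite ge0_integralZl//; last 2 first.
  - by apply/measurable_EFinP/measurableT_comp.
  - by rewrite lee_fin powR_ge0.
  by rewrite EFinM lee_wpmul2l// lee_fin powR_ge0.
rewrite unlock /Lnorm.
apply: (@le_trans _ _ (((alpha `^ (p - 1) * beta)%:E) `^ p^-1)%E).
  by apply: gt0_ler_poweR => //; rewrite ?invr_ge0 ?(ltW p0)//
    ?in_itv/= ?leey ?andbT ?lee_fin ?mulr_ge0 ?powR_ge0// integral_ge0.
rewrite poweR_EFin powRM ?powR_ge0// -powRrM lee_fin.
by rewrite mulrBl divff ?gt_eqF// mul1r.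
Qed.

Lemma measurable_tensor P Q : measurable_fun setT P -> measurable_fun setT Q ->
  measurable_fun setT (fun y : R * R => P y.1 * Q y.2).
Proof.
move=> mP mQ; apply: measurable_funM.
- by apply: (measurableT_comp mP); exact: measurable_fst.
- by apply: (measurableT_comp mQ); exact: measurable_snd.
Qed.

Lemma integral_tensor_abs P Q : measurable_fun setT P -> measurable_fun setT Q ->
  (\int[plane]_y (`|P y.1 * Q y.2|)%:E =
   \int[mu]_x (`|P x|)%:E * \int[mu]_y (`|Q y|)%:E)%E.
Proof.
move=> mP mQ; rewrite /plane_measure.
have mPQ : measurable_fun setT (fun y : R * R => (`|P y.1 * Q y.2|)%:E).
  by apply/measurable_EFinP/measurableT_comp => //; exact: measurable_tensor.
rewrite fubini_tonelli1//= /fubini_F/=.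
have mP' : measurable_fun setT (fun x => (`|P x|)%:E) by apply/measurable_EFinP/measurableT_comp.
have mQ' : measurable_fun setT (fun x => (`|Q x|)%:E) by apply/measurable_EFinP/measurableT_comp.
under eq_integral => x _.
  under eq_integral => y _ do rewrite normrM EFinM.
  rewrite ge0_integralZl//; over.
under eq_integral do rewrite muleC.
rewrite ge0_integralZl//; first by rewrite muleC.
exact: integral_ge0.
Qed.

Definition tensor_sum (M N : nat) (f : nat -> nat -> R) (P Q : nat -> R -> R) (y : R * R) : R :=
  \sum_(0 <= a < M) \sum_(0 <= c < N) f a c * P a y.1 * Q c y.2.

Lemma measurable_tensor_sum M N (f : nat -> nat -> R) (P Q : nat -> R -> R) :
  (forall a, measurable_fun setT (P a)) -> (forall a, measurable_fun setT (Q a)) ->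
  measurable_fun setT (tensor_sum M N f P Q).
Proof.
move=> mP mQ; apply: measurable_sum => a; apply: measurable_sum => c.
under eq_fun do rewrite -mulrA.
apply: measurable_funM; first exact: measurable_cst.
exact: measurable_tensor.
Qed.

Lemma tensor_sum_le M N (f : nat -> nat -> R) (P Q : nat -> R -> R) (alpha A B : R) y : 0 <= alpha ->
  (forall a c, (a < M)%N -> (c < N)%N -> `|f a c| <= alpha) ->
  \sum_(0 <= a < M) `|P a y.1| <= A -> \sum_(0 <= c < N) `|Q c y.2| <= B ->
  `|tensor_sum M N f P Q y| <= alpha * (A * B).
Proof.
move=> a0 fa PA QB.
apply: le_trans (ler_norm_sum _ _ _) _.
apply: (@le_trans _ _ (\sum_(0 <= a < M) \sum_(0 <= c < N) alpha * (`|P a y.1| * `|Q c y.2|))).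
  rewrite !big_nat; apply: ler_sum => a /andP[_ aM].
  apply: le_trans (ler_norm_sum _ _ _) _.
  rewrite !big_nat; apply: ler_sum => c /andP[_ cN].
  by rewrite -mulrA !normrM ler_wpM2r ?mulr_ge0// fa.
under eq_bigr do rewrite -mulr_sumr -mulr_sumr.
rewrite -mulr_sumr -mulr_suml ler_wpM2l// ler_pM// sumr_ge0//.
Qed.

Lemma tensor_sum_integral_le M N (f : nat -> nat -> R) (P Q : nat -> R -> R) (beta A B : R) : 0 <= A -> 0 <= B ->
  (forall a, measurable_fun setT (P a)) -> (forall a, measurable_fun setT (Q a)) ->
  \sum_(0 <= a < M) \sum_(0 <= c < N) `|f a c| <= beta ->
  (forall a, (a < M)%N -> (\int[mu]_x (`|P a x|)%:E <= A%:E)%E) ->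
  (forall c, (c < N)%N -> (\int[mu]_x (`|Q c x|)%:E <= B%:E)%E) ->
  (\int[plane]_y (`|tensor_sum M N f P Q y|)%:E <= (beta * (A * B))%:E)%E.
Proof.
move=> A0 B0 mP mQ fb PA QB.
have mt a c : measurable_fun setT (fun y : R * R => (`|f a c|)%:E * (`|P a y.1 * Q c y.2|)%:E)%E.
  under eq_fun do rewrite -EFinM.
  apply/measurable_EFinP; apply: measurable_funM; first exact: measurable_cst.
  by apply: measurableT_comp => //; exact: measurable_tensor.
have mt2 a c : measurable_fun setT (fun y : R * R => (`|P a y.1 * Q c y.2|)%:E)%E.
  by apply/measurable_EFinP/measurableT_comp => //; exact: measurable_tensor.
apply: (@le_trans _ _ (\int[plane]_y (\sum_(0 <= a < M) \sum_(0 <= c < N)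
    (`|f a c|)%:E * (`|P a y.1 * Q c y.2|)%:E)))%E.
  apply: ge0_le_integral => //.
  - by apply/measurable_EFinP/measurableT_comp => //; exact: measurable_tensor_sum.
  - apply: emeasurable_sum => a; apply: emeasurable_sum => c; exact: mt.
  - move=> y _; under eq_bigr do [under eq_bigr do rewrite -EFinM; rewrite sumEFin].
    rewrite sumEFin lee_fin; apply: le_trans (ler_norm_sum _ _ _) _.
    apply: ler_sum => a _; apply: le_trans (ler_norm_sum _ _ _) _.
    by apply: ler_sum => c _; rewrite -mulrA normrM.
rewrite ge0_integral_sum//; last 2 first.
- by move=> a; apply: emeasurable_sum => c; exact: mt.
- by move=> a y _ ; apply: sume_ge0 => c _; rewrite mule_ge0// lee_fin.
apply: (@le_trans _ _ (\sum_(0 <= a < M) \sum_(0 <= c < N) (`|f a c| * (A * B))%:E)%E).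
  rewrite !big_nat; apply: lee_sum => a /andP[_ aM].
  rewrite ge0_integral_sum//; last by move=> c; exact: mt.
  rewrite !big_nat; apply: lee_sum => c /andP[_ cN].
  have E : (\int[plane]_x (`|f a c|%:E * (`|P a x.1 * Q c x.2|)%:E) =
      `|f a c|%:E * \int[plane]_x (`|P a x.1 * Q c x.2|)%:E)%E.
    by apply: ge0_integralZl => //; exact: mt2.
  apply: (@le_trans _ _ (`|f a c|%:E * \int[plane]_x (`|P a x.1 * Q c x.2|)%:E)%E).
    by rewrite le_eqVlt; apply/orP; left; apply/eqP/E.
  rewrite integral_tensor_abs// EFinM lee_wpmul2l ?lee_fin// EFinM.
  by apply: lee_pmul; rewrite ?integral_ge0 ?PA ?QB.
under eq_bigr do rewrite sumEFin -mulr_suml.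
by rewrite sumEFin -mulr_suml lee_fin ler_wpM2r// mulr_ge0.
Qed.

(** For the L_oo bound the supremum of f is combined with bounds for sums of
    |P a| and |Q c|; for the L_1 bound the sum of |f| is combined with bounds
    for single integrals. *)
Lemma tensor_sum_Lnorm_le M N (f : nat -> nat -> R) (P Q : nat -> R -> R) (p alpha beta A A' B B' : R) : 1 <= p ->
  0 <= alpha -> 0 <= beta -> 0 <= A -> 0 <= A' -> 0 <= B -> 0 <= B' ->
  (forall a, measurable_fun setT (P a)) -> (forall a, measurable_fun setT (Q a)) ->
  (forall a c, (a < M)%N -> (c < N)%N -> `|f a c| <= alpha) ->
  \sum_(0 <= a < M) \sum_(0 <= c < N) `|f a c| <= beta ->
  (forall y, \sum_(0 <= a < M) `|P a y| <= A) ->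
  (forall y, \sum_(0 <= c < N) `|Q c y| <= B) ->
  (forall a, (a < M)%N -> (\int[mu]_x (`|P a x|)%:E <= A'%:E)%E) ->
  (forall c, (c < N)%N -> (\int[mu]_x (`|Q c x|)%:E <= B'%:E)%E) ->
  ('N[plane]_p%:E [EFin \o tensor_sum M N f P Q] <=
     ((alpha * (A * B)) `^ (1 - p^-1) * (beta * (A' * B')) `^ p^-1)%:E)%E.
Proof.
move=> p1 a0 b0 A0 A'0 B0 B'0 mP mQ fa fb PA QB PA' QB'.
apply: Lnorm_interpolation => //.
- exact: measurable_tensor_sum.
- by rewrite !mulr_ge0.
- by rewrite !mulr_ge0.
- by move=> y; exact: tensor_sum_le.
- exact: tensor_sum_integral_le.
Qed.

End PlaneNorms.

(** * Digits, and the b-adic levels of a point *)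

Section Digits.
Variables (b n : nat).
Hypothesis b_ge2 : (2 <= b)%N.
Implicit Types tau : 'I_n -> 'I_b.

Let b0 : (0 < b)%N. Proof. exact: leq_trans b_ge2. Qed.

Definition digit_value tau := (\sum_(i < n) tau i * b ^ i)%N.

(** The digits below position p determine the position of the point inside its
    b-adic interval of level n - p, those from p on (high_value) the index of
    this interval. *)
Definition low_value tau (p : nat) := (\sum_(i < n | i < p) tau i * b ^ i)%N.
Definition high_value tau (p : nat) := (\sum_(i < n | p <= i) tau i * b ^ (i - p))%N.

Lemma low_value_lt tau p : (low_value tau p < b ^ p)%N.
Proof.
rewrite /low_value; elim: p => [|p IH].
  by rewrite big_pred0 ?expn0.
have [pn|np] := ltnP p n.
  rewrite (bigD1 (Ordinal pn)) //=.
  rewrite (eq_bigl (fun i : 'I_n => (i < p)%N)); last first.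
    move=> i; rewrite ltnS -val_eqE/= [RHS]ltn_neqAle.
    by rewrite andbC.
  rewrite expnS; apply: (@leq_trans (tau (Ordinal pn) * b ^ p + b ^ p)%N).
    by rewrite ltn_add2l.
  by rewrite -mulSnr leq_mul2r ltn_ord orbT.
rewrite (eq_bigl (fun i : 'I_n => (i < p)%N)).
  by apply: leq_trans IH _; rewrite leq_exp2l.
by move=> i; rewrite !(leq_trans (ltn_ord i))// leqW.
Qed.

Lemma digit_valueE tau p : digit_value tau = (high_value tau p * b ^ p + low_value tau p)%N.
Proof.
rewrite /digit_value (bigID (fun i : 'I_n => (p <= i)%N))/=; congr (_ + _)%N.
  rewrite /high_value big_distrl/=; apply: eq_bigr => i pi.
  by rewrite -mulnA -expnD subnK.
by apply: eq_bigl => i; rewrite -ltnNge.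
Qed.

Lemma digit_value_div tau p : (digit_value tau %/ b ^ p)%N = high_value tau p.
Proof.
by rewrite (digit_valueE tau p) divnMDl ?expn_gt0 ?b0// divn_small ?addn0 ?low_value_lt.
Qed.

Lemma digit_value_lt tau : (digit_value tau < b ^ n)%N.
Proof.
have := low_value_lt tau n; rewrite /low_value (eq_bigl xpredT)//.
by move=> i; rewrite ltn_ord.
Qed.

Lemma high_valueS tau (i : 'I_n) : high_value tau i = (high_value tau i.+1 * b + tau i)%N.
Proof.
rewrite /high_value (bigD1 i)//= subnn expn0 muln1 addnC; congr (_ + _)%N.
rewrite big_distrl/=; rewrite (eq_bigl (fun k : 'I_n => (i < k)%N)); last first.
  by move=> k; rewrite ltn_neqAle andbC -val_eqE eq_sym.
by apply: eq_bigr => k ik; rewrite -mulnA -expnSr -subSn.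
Qed.

Lemma high_value_mod tau (i : 'I_n) : (high_value tau i %% b)%N = tau i.
Proof. by rewrite high_valueS modnMDl modn_small. Qed.

Lemma high_value_div tau (i : 'I_n) : (high_value tau i %/ b)%N = high_value tau i.+1.
Proof. by rewrite high_valueS divnMDl// divn_small ?addn0. Qed.

Lemma high_value_n tau p : (n <= p)%N -> high_value tau p = 0%N.
Proof.
by move=> np; rewrite /high_value big_pred0// => i; rewrite leqNgt (leq_trans (ltn_ord i)).
Qed.

Lemma high_value_eq tau p A : (p <= n)%N -> (A < b ^ (n - p))%N ->
  (high_value tau p == A) =
  [forall i : 'I_n, (p <= i)%N ==> (tau i == (A %/ b ^ (i - p)) %% b :> nat)%N].
Proof.
move=> pn; move: {-2}(n - p)%N (erefl (n - p)%N) => m; elim: m p pn A => [|m IH] p pn A mE Am.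
  have np : (n <= p)%N by rewrite -subn_eq0 -mE.
  rewrite high_value_n//; move: Am; rewrite expn0 ltnS leqn0 => /eqP ->; rewrite eqxx.
  apply/esym/forallP => i; apply/implyP => pi.
  by move: (ltn_ord i); rewrite ltnNge (leq_trans np pi).
have {}pn : (p < n)%N by rewrite -subn_gt0 -mE.
have Ab : (A %/ b < b ^ m)%N by rewrite ltn_divLR// -expnSr.
have mE' : m = (n - p.+1)%N by rewrite subnS -mE.
have IH' := IH p.+1 pn (A %/ b)%N mE' Ab.
have hS := high_valueS tau (Ordinal pn); rewrite /= in hS.
apply/idP/idP.
- move=> /eqP hA; apply/forallP => i; apply/implyP; rewrite leq_eqVlt => /predU1P[pi|pi].
    have -> : i = Ordinal pn by apply/val_inj.
    rewrite /= subnn expn0 divn1 -hA hS modnMDl modn_small//.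
  have hA1 : high_value tau p.+1 == (A %/ b)%N by rewrite -hA hS divnMDl// divn_small ?addn0.
  move: hA1; rewrite IH' => /forallP /(_ i)/implyP /(_ pi).
  by rewrite -divnMA -expnS -subSn.
- move=> /forallP h.
  have /eqP h0 : tau (Ordinal pn) == (A %% b)%N :> nat.
    by have := h (Ordinal pn); rewrite /= leqnn subnn expn0 divn1.
  have /eqP h1 : high_value tau p.+1 == (A %/ b)%N.
    rewrite IH'; apply/forallP => i; apply/implyP => pi.
    by have /implyP /(_ (ltnW pi)) := h i; rewrite -divnMA -expnS -subSn.
  by rewrite hS h0 h1 -divn_eq.
Qed.

End Digits.

Section Averaging.
Variables (R : comNzRingType) (b n : nat).
Implicit Types t : {ffun 'I_n -> 'I_b}.

(** Averages over all digit strings are taken one digit at a time, the others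
    being fixed. *)
Definition set_digit t (i : 'I_n) (x : 'I_b) : {ffun 'I_n -> 'I_b} :=
  [ffun k => if k == i then x else t k].

(** Averaging over one digit does not change the mean over all strings. *)
Lemma sum_set_digit (F : {ffun 'I_n -> 'I_b} -> R) i :
  \sum_t \sum_x F (set_digit t i x) = b%:R * \sum_t F t.
Proof.
pose h (p : {ffun 'I_n -> 'I_b} * 'I_b) := (set_digit p.1 i p.2, p.1 i).
have hK : involutive h.
  move=> [t x]; rewrite /h /= ffunE eqxx; congr pair.
  by apply/ffunP => k; rewrite !ffunE; case: eqVneq => // ->.
rewrite pair_big/= (reindex_inj (inv_inj hK))/=.
rewrite (eq_bigr (fun p => F p.1)); last first.
  by move=> p _; have /(congr1 fst) := hK p; rewrite /= => ->.
rewrite -(pair_big xpredT xpredT (fun t _ => F t))/=.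
under eq_bigr do rewrite sumr_const card_ord.
by rewrite big_distrr/=; apply: eq_bigr => t _; rewrite mulr_natl.
Qed.

End Averaging.

Section Cells.
Context {R : realType}.
Variable b : nat.
Hypothesis b_ge2 : (2 <= b)%N.

Let b0 : (0 < b)%N. Proof. exact: leq_trans b_ge2. Qed.
Let bR0 : 0 < b%:R :> R. Proof. by rewrite ltr0n. Qed.
Let bR1 : 1 <= b%:R :> R. Proof. by rewrite ler1n. Qed.
Let bN0 : b%:R != 0 :> R. Proof. by rewrite gt_eqF. Qed.

Definition pos (x : R) : R := Num.max 0 x.

Lemma posZ (c x : R) : 0 <= c -> pos (c * x) = c * pos x.
Proof. by move=> c0; rewrite /pos maxr_pMr// mulr0. Qed.

(** The average, over the a-th b-adic interval of level j, of the indicator of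
    the half-line to the right of z. *)
Definition ecell (j : nat) (z : R) (a : nat) : R :=
  pos (a.+1%:R - b%:R ^+ j * z) - pos (a%:R - b%:R ^+ j * z).

(** The difference of averages on consecutive levels is the Haar component of
    level j of this indicator. In the same way mcell and mucell belong to the
    function x. *)
Definition ucell (j : nat) (z : R) (a : nat) : R :=
  if j is j'.+1 then ecell j z a - ecell j' z (a %/ b) else ecell 0 z a.

Definition mcell (j a : nat) : R := (a%:R + 2^-1) / b%:R ^+ j.

Definition mucell (j a : nat) : R :=
  if j is j'.+1 then mcell j a - mcell j' (a %/ b) else mcell 0 a.

Lemma sum_ecell_children j z A :
  \sum_(0 <= d < b) ecell j.+1 z (A * b + d) = b%:R * ecell j z A.
Proof.
pose f d := pos ((A * b + d)%:R - b%:R ^+ j.+1 * z).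
rewrite (eq_bigr (fun d => f d.+1 - f d)); last by move=> d _; rewrite /f addnS.
rewrite telescope_sumr// /f /ecell mulrBr -!posZ ?(ltW bR0)//.
by congr (pos _ - pos _); rewrite ?addn0 exprS ?natrD natrM -?natr1; ring.
Qed.

Lemma sum_ucell_children j z A : \sum_(0 <= d < b) ucell j.+1 z (A * b + d) = 0.
Proof.
rewrite /= sumrB sum_ecell_children.
under [X in _ - X]eq_big_nat => d /andP[_ db].
  rewrite divnMDl// divn_small// addn0; over.
by rewrite sumr_const_nat subn0 mulr_natl subrr.
Qed.

Lemma mucellS j a : mucell j.+1 a = ((a %% b)%:R - (b%:R - 1) / 2) / b%:R ^+ j.+1.
Proof.
rewrite /= /mcell {1}(divn_eq a b) natrD natrM exprS.
by field; rewrite bN0 expf_neq0.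
Qed.

Lemma sum_digits : \sum_(0 <= d < b) (d%:R : R) = b%:R * (b%:R - 1) / 2.
Proof.
elim: (b) => [|m IH]; first by rewrite big_nil mul0r mul0r.
by rewrite big_nat_recr//= IH -natr1; field.
Qed.

Lemma sum_mucell_children j A : \sum_(0 <= d < b) mucell j.+1 (A * b + d) = 0.
Proof.
under eq_big_nat => d /andP[_ db].
  rewrite mucellS modnMDl modn_small//; over.
rewrite -mulr_suml sumrB sum_digits sumr_const_nat subn0 -[X in _ - X]mulr_natl.
by rewrite mulrA subrr mul0r.
Qed.

Lemma ecellE j z a N phi : b%:R ^+ j * z = N%:R + phi -> 0 <= phi < 1 ->
  ecell j z a = (N < a)%N%:R + (N == a)%:R * (1 - phi).
Proof.
move=> zE /andP[p0 p1]; rewrite /ecell zE /pos.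
case: ltngtP => [Na|aN|->].
- have : (N.+1%:R <= a%:R :> R) by rewrite ler_nat.
  rewrite -!natr1 => h; rewrite !max_r /= ?mulr1n ?mulr0n; lra.
- have : (a.+1%:R <= N%:R :> R) by rewrite ler_nat.
  rewrite -!natr1 => h; rewrite !max_l /= ?mulr1n ?mulr0n; lra.
- rewrite -!natr1 max_r; last by lra.
  by rewrite max_l /= ?mulr1n ?mulr0n; lra.
Qed.

(** With wdigit: ucell is an affine function of the position phi of z inside
    its own interval, with value vdigit at the left end and slope wdigit; here
    d is the digit of the interval a and tau the corresponding digit of z. *)
Definition vdigit (d tau : nat) : R := (tau <= d)%N%:R - 1 + tau%:R / b%:R.
Definition wdigit (d tau : nat) : R := b%:R^-1 - (tau == d)%:R.

Lemma ucellE j z a N phi : b%:R ^+ j.+1 * z = N%:R + phi -> 0 <= phi < 1 ->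
  ucell j.+1 z a = (N %/ b == a %/ b)%N%:R *
    (vdigit (a %% b) (N %% b) + phi * wdigit (a %% b) (N %% b)).
Proof.
move=> zE p01; have /andP[p0 p1] := p01.
have zE' : b%:R ^+ j * z = (N %/ b)%N%:R + ((N %% b)%N%:R + phi) / b%:R.
  apply: (mulfI bN0); rewrite mulrA -exprS zE {1}(divn_eq N b) natrD natrM.
  by field.
have p01' : 0 <= ((N %% b)%N%:R + phi) / b%:R < 1.
  rewrite divr_ge0 ?addr_ge0//= ltr_pdivrMr// mul1r.
  have : ((N %% b).+1%:R <= b%:R :> R) by rewrite ler_nat ltn_mod.
  by rewrite -natr1; lra.
rewrite /= (ecellE _ zE p01) (ecellE _ zE' p01').
have [Na|Na] := eqVneq (N %/ b)%N (a %/ b)%N; last first.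
  rewrite !mul0r addr0; case: (ltngtP (N %/ b)%N (a %/ b)%N) Na => // h _.
    have -> : (N < a)%N by rewrite ltnNge; apply: contraL h => /(leq_div2r b); rewrite -leqNgt.
    have /negPf -> : N != a by apply: contraTneq h => ->; rewrite ltnn.
    by rewrite mul0r addr0 subrr.
  have /negPf -> : ~~ (N < a)%N.
    by rewrite -leqNgt ltnW// ltnNge; apply: contraL h => /(leq_div2r b); rewrite -leqNgt.
  have /negPf -> : N != a by apply: contraTneq h => ->; rewrite ltnn.
  by rewrite mul0r addr0 subrr.
rewrite Na ltnn add0r !mul1r.
have -> : (N < a)%N = (N %% b < a %% b)%N.
  by rewrite {1}(divn_eq N b) {1}(divn_eq a b) Na ltn_add2l.
have -> : (N == a) = (N %% b == a %% b)%N.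
  by rewrite {1}(divn_eq N b) {1}(divn_eq a b) Na eqn_add2l.
rewrite /vdigit /wdigit.
by case: ltngtP => _ /=; rewrite ?mulr1n ?mulr0n; field.
Qed.

Lemma vdigit_norm d tau : (tau < b)%N -> `|vdigit d tau| <= 1.
Proof.
move=> tb; have : 0 <= (tau%:R / b%:R : R) <= 1.
  by rewrite divr_ge0//= ler_pdivrMr// mul1r ler_nat ltnW.
by rewrite /vdigit ler_norml; case: leqP => _ /=; rewrite ?mulr1n ?mulr0n; lra.
Qed.

Lemma wdigit_norm d tau : `|wdigit d tau| <= 1.
Proof.
have : 0 <= (b%:R^-1 : R) <= 1 by rewrite invr_ge0 ltW//= invf_le1.
by rewrite /wdigit ler_norml; case: eqP => _ /=; rewrite ?mulr1n ?mulr0n; lra.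
Qed.

Lemma sum_wdigit d : (d < b)%N -> \sum_(tau < b) wdigit d tau = 0.
Proof.
move=> db; rewrite /wdigit sumrB sumr_const card_ord -[X in X - _]mulr_natl divff//.
rewrite (bigD1 (Ordinal db))//= eqxx big1 ?addr0 ?subrr// => i /negPf id.
by rewrite -val_eqE/= in id; rewrite id.
Qed.

Lemma sum_vdigit d : (d < b)%N -> \sum_(tau < b) vdigit d tau = d%:R - (b%:R - 1) / 2.
Proof.
move=> db; rewrite /vdigit big_split/= sumrB sumr_const card_ord.
rewrite -mulr_suml -(big_mkord xpredT (fun i => i%:R)) sum_digits.
have -> : \sum_(i < b) ((i <= d)%N%:R : R) = d.+1%:R.
  rewrite -(big_mkord xpredT (fun i => (i <= d)%N%:R)) (big_cat_nat (n := d.+1))//=.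
  rewrite [X in _ + X]big_nat [X in _ + X]big1 ?addr0; last first.
    by move=> i /andP[di _]; rewrite leqNgt di.
  rewrite big_nat (eq_bigr (fun=> 1)); last by move=> i /andP[_ id]; rewrite -ltnS id.
  by rewrite -big_nat sumr_const_nat subn0.
by rewrite -natr1; field.
Qed.

End Cells.

(** * Counting points of a net *)

Section NetCounting.
Context {R : realType}.
Variables (b n : nat).
Hypothesis b_ge2 : (2 <= b)%N.

Let b0 : (0 < b)%N. Proof. exact: leq_trans b_ge2. Qed.
Let bR0 : 0 < b%:R :> R. Proof. by rewrite ltr0n. Qed.
Let bR1 : 1 <= b%:R :> R. Proof. by rewrite ler1n. Qed.
Let bN0 : b%:R != 0 :> R. Proof. by rewrite gt_eqF. Qed.
Let bn0 k : 0 < b%:R ^+ k :> R. Proof. by rewrite exprn_gt0. Qed.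

Implicit Types (t tau : {ffun 'I_n -> 'I_b}) (i : 'I_n).

Definition point_coord tau : R := (digit_value tau)%:R / b%:R ^+ n.

(** The index N of the interval of level j around the point determines those
    of all coarser levels. For j > n the further digits of the point are
    zeros. *)
Lemma digits_scaled tau j : exists (N : nat) (phi : R),
  [/\ b%:R ^+ j * point_coord tau = N%:R + phi, 0 <= phi < 1 &
      forall l, (l <= j)%N -> (l <= n)%N -> (N %/ b ^ (j - l))%N = high_value tau (n - l)].
Proof.
exists (digit_value tau * b ^ j %/ b ^ n)%N, ((digit_value tau * b ^ j %% b ^ n)%N%:R / b%:R ^+ n).
have bn : (0 < b ^ n)%N by rewrite expn_gt0 b0.
split.
- apply: (mulIf (lt0r_neq0 (bn0 n))); rewrite mulrDl divfK ?gt_eqF//.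
  rewrite /point_coord mulrA divfK ?gt_eqF// -!natrX -!natrM -natrD -divn_eq.
  by rewrite mulnC.
- rewrite divr_ge0 ?(ltW (bn0 n))//= ltr_pdivrMr// mul1r -natrX ltr_nat.
  by rewrite ltn_mod.
- move=> l lj ln; rewrite -divnMA -expnD -digit_value_div//.
  have -> : (n + (j - l) = n - l + j)%N by lia.
  by rewrite expnD divnMr// expn_gt0 b0.
Qed.

(** The component vanishes unless the point lies in the parent interval, hence
    in every coarser interval that contains a. *)
Lemma ucell_bound tau j l a : (l < j)%N -> (l <= n)%N ->
  `|ucell b j (point_coord tau) a| <= 2 * (high_value tau (n - l) == a %/ b ^ (j - l))%N%:R.
Proof.
case: j => // j lj ln; have [N [phi [zE p01 hN]]] := digits_scaled tau j.+1.
rewrite (ucellE b_ge2 a zE p01) -(hN l (ltnW lj) ln).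
have [Na|Na] := eqVneq (N %/ b)%N (a %/ b)%N; last first.
  by rewrite mul0r normr0 mulr_ge0.
have -> : (N %/ b ^ (j.+1 - l))%N = (a %/ b ^ (j.+1 - l))%N.
  by rewrite subSn// expnS !divnMA Na.
rewrite eqxx mulr1 mul1r; have /andP[p0 p1] := p01.
rewrite (le_trans (ler_normD _ _))// (_ : 2 = 1 + 1)// lerD//.
  by apply: vdigit_norm => //; rewrite ltn_mod.
by rewrite normrM (ger0_norm p0) mulr_ile1 ?(ltW p1)// wdigit_norm.
Qed.

(** Only the digit at position p = n - j - 1 is resolved by level j.+1 but not
    by level j; the lower ones enter affinely through the position inside the
    interval, the higher ones select the parent interval. *)
Lemma ucell_digits tau (p : 'I_n) j a : (p + j.+1 = n)%N ->
  ucell b j.+1 (point_coord tau) a = (high_value tau p.+1 == a %/ b)%N%:R *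
    (vdigit b (a %% b) (tau p) +
      (low_value tau p)%:R / b%:R ^+ p * wdigit b (a %% b) (tau p)).
Proof.
move=> pj; have zE : b%:R ^+ j.+1 * point_coord tau =
    (high_value tau p)%:R + (low_value tau p)%:R / b%:R ^+ p.
  rewrite /point_coord (digit_valueE tau p) natrD natrM natrX -[in X in _ / X]pj exprD.
  by field; rewrite !expf_neq0.
rewrite (ucellE b_ge2 a zE); last first.
  by rewrite divr_ge0 ?(ltW (bn0 p))//= ltr_pdivrMr// mul1r -natrX ltr_nat low_value_lt.
by rewrite high_value_div// high_value_mod.
Qed.

Lemma high_value_set_digit tau i x p : (i < p)%N -> high_value (set_digit tau i x) p = high_value tau p.
Proof.
move=> ip; apply: eq_bigr => k pk; rewrite ffunE; case: eqVneq => // ki.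
by move: pk; rewrite ki leqNgt ip.
Qed.

Lemma low_value_set_digit tau i x p : (p <= i)%N -> low_value (set_digit tau i x) p = low_value tau p.
Proof.
move=> pi; apply: eq_bigr => k kp; rewrite ffunE; case: eqVneq => // ki.
by move: kp; rewrite ki ltnNge pi.
Qed.

Lemma low_value_set_digit_below tau i p : (i < p)%N -> exists c : nat, forall x,
  low_value (set_digit tau i x) p = (c + x * b ^ i)%N.
Proof.
move=> ip; exists (\sum_(k < n | (k < p) && (k != i)) tau k * b ^ k)%N => x.
rewrite /low_value (bigD1 i)//= ffunE eqxx addnC; congr (_ + _)%N.
by apply: eq_bigr => k /andP[_ /negPf ki]; rewrite ffunE ki.
Qed.

Variable s : 'I_n -> 'I_b -> 'I_b.
Hypothesis sK : forall i, involutive (s i).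

(** The second coordinate of a point reads the digits in the opposite order,
    through the maps s. *)
Definition mirror t : {ffun 'I_n -> 'I_b} := [ffun i => s (rev_ord i) (t (rev_ord i))].

Lemma mirror_set_digit t i x : mirror (set_digit t i x) = set_digit (mirror t) (rev_ord i) (s i x).
Proof.
apply/ffunP => k; rewrite !ffunE (inv_eq (@rev_ordK n)).
by case: eqVneq => // ->; rewrite rev_ordK.
Qed.

Lemma forall_prod (I : finType) (P : pred I) :
  ([forall i, P i])%:R = \prod_i (P i)%:R :> R.
Proof.
case: forallP => [h|/forallP]; first by rewrite big1// => i _; rewrite h.
rewrite negb_forall => /existsP[i /negPf Pi].
by rewrite (bigD1 i)//= Pi mul0r.
Qed.

Lemma prod_window (l1 l2 : nat) : (l1 + l2 <= n)%N ->
  \prod_(i < n) (if (n - l1 <= i)%N || (i < l2)%N then 1 else b%:R) =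
    b%:R ^+ (n - (l1 + l2)) :> R.
Proof.
move=> ln; rewrite -(big_mkord xpredT (fun i : nat => if (n - l1 <= i)%N || (i < l2)%N then 1 else b%:R)).
rewrite (big_cat_nat (n := l2))//=; last by lia.
rewrite (big_cat_nat (m := l2) (n := n - l1))//=; [|lia|lia].
rewrite big_nat big1 ?mul1r; last by move=> i /andP[_ ->]; rewrite orbT.
rewrite [X in _ * X]big_nat [X in _ * X]big1 ?mulr1; last by move=> i /andP[-> _].
rewrite big_nat (eq_bigr (fun=> b%:R)); last first.
  by move=> i /andP[li il]; rewrite leqNgt il ltnNge li.
by rewrite -big_nat prodr_const_nat; congr (_ ^+ _); lia.
Qed.

(** The net property: the first l1 digits of one coordinate and the first l2
    digits of the other one prescribe disjoint sets of digits of t, and the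
    remaining n - l1 - l2 digits are free. *)
Lemma sum_net_count l1 l2 A1 A2 : (l1 + l2 <= n)%N -> (A1 < b ^ l1)%N -> (A2 < b ^ l2)%N ->
  \sum_(t : {ffun 'I_n -> 'I_b}) (high_value t (n - l1) == A1)%:R * (high_value (mirror t) (n - l2) == A2)%:R =
    b%:R ^+ (n - (l1 + l2)) :> R.
Proof.
move=> ln A1b A2b.
(* D1 and D2 are the digits prescribed for the two coordinates. *)
pose D1 (i : 'I_n) := ((A1 %/ b ^ (i - (n - l1))) %% b)%N.
pose D2 (i : 'I_n) := ((A2 %/ b ^ (rev_ord i - (n - l2))) %% b)%N.
pose G (i : 'I_n) (x : 'I_b) : R := ((n - l1 <= i) ==> (x == D1 i :> nat))%N%:R *
   ((n - l2 <= rev_ord i) ==> (s i x == D2 i :> nat))%N%:R.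
have e1 : (n - (n - l1) = l1)%N by lia.
have e2 : (n - (n - l2) = l2)%N by lia.
rewrite (eq_bigr (fun t : {ffun 'I_n -> 'I_b} => \prod_i G i (t i))); last first.
  move=> t _; rewrite !high_value_eq ?e1 ?e2 ?leq_subr//.
  rewrite !forall_prod [X in _ * X](reindex_inj rev_ord_inj)/= -big_split/=.
  by apply: eq_bigr => i _; rewrite /G ffunE rev_ordK.
rewrite -(bigA_distr_bigA G) -(prod_window ln); apply: eq_bigr => i _.
have db k : (k %% b < b)%N by rewrite ltn_mod.
have one (y : 'I_b) : \sum_(x < b) ((x == y :> nat)%N%:R : R) = 1.
  rewrite (bigD1 y)//= eqxx big1 ?addr0// => x /negPf xy.
  by rewrite -val_eqE/= in xy; rewrite xy.
have rv : (n - l2 <= rev_ord i)%N = (i < l2)%N by rewrite /=; have := ltn_ord i; lia.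
rewrite /G rv; case: (leqP (n - l1) i) => il; case: (ltnP i l2) => il2 /=.
- by lia.
- under eq_bigr do rewrite mulr1.
  exact: (one (Ordinal (db _))).
- under eq_bigr do rewrite mul1r.
  rewrite (reindex_inj (inv_inj (sK i)))/=.
  under eq_bigr do rewrite sK.
  exact: (one (Ordinal (db _))).
- by under eq_bigr do rewrite mulr1; rewrite sumr_const card_ord.
Qed.

End NetCounting.

(** * Haar coefficients of the discrepancy on coarse levels *)

Section Coefficients.
Context {R : realType}.
Variables (b n : nat).
Hypothesis b_ge2 : (2 <= b)%N.

Let b0 : (0 < b)%N. Proof. exact: leq_trans b_ge2. Qed.
Let bR0 : 0 < b%:R :> R. Proof. by rewrite ltr0n. Qed.
Let bR1 : 1 <= b%:R :> R. Proof. by rewrite ler1n. Qed.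
Let bN0 : b%:R != 0 :> R. Proof. by rewrite gt_eqF. Qed.
Let bn0 k : 0 < b%:R ^+ k :> R. Proof. by rewrite exprn_gt0. Qed.
Let bnN k : b%:R ^+ k != 0 :> R. Proof. by rewrite gt_eqF. Qed.

Implicit Types (t tau : {ffun 'I_n -> 'I_b}) (i : 'I_n).

(** The coefficient of the discrepancy with respect to the intervals a and c
    of levels j1 and j2, in the form counting part minus area part. *)
Definition coef (s : 'I_n -> 'I_b -> 'I_b) (j1 j2 a c : nat) : R :=
  (b%:R ^+ n)^-1 * \sum_(t : {ffun 'I_n -> 'I_b})
     ucell b j1 (point_coord t) a * ucell b j2 (point_coord (mirror s t)) c
  - mucell b j1 a * mucell b j2 c.

(** Since w1 and w2 sum to 0, of all terms with a w only the one that couples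
    both variables on both sides survives. *)
Lemma expand_affine_product (v1 w1 v2 w2 g h : 'I_b -> R) (A1 A2 q : R) :
  \sum_x w1 x = 0 -> \sum_y w2 y = 0 ->
  \sum_y \sum_x (v1 x + (A1 + q * g y) * w1 x) * (v2 y + (A2 + q * h x) * w2 y) =
  (\sum_x v1 x) * (\sum_y v2 y) + q ^+ 2 * ((\sum_x h x * w1 x) * (\sum_y g y * w2 y)).
Proof.
move=> w10 w20; rewrite exchange_big/=.
have -> : \sum_x \sum_y (v1 x + (A1 + q * g y) * w1 x) * (v2 y + (A2 + q * h x) * w2 y) =
   \sum_x \sum_y (v1 x + A1 * w1 x) * (v2 y + A2 * w2 y)
   + q * \sum_x \sum_y ((v1 x + A1 * w1 x) * h x) * w2 y
   + q * \sum_x \sum_y w1 x * (g y * (v2 y + A2 * w2 y))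
   + q ^+ 2 * \sum_x \sum_y (h x * w1 x) * (g y * w2 y).
  rewrite 3!mulr_sumr -!big_split/=; apply: eq_bigr => x _.
  rewrite 3!mulr_sumr -!big_split/=; apply: eq_bigr => y _; ring.
rewrite -!big_distrlr/= w10 w20 !big_split/= -!mulr_sumr w10 w20.
by rewrite !mulr0 mul0r !mulr0 !addr0.
Qed.

Lemma sum_digit_weight_le (f : 'I_b -> 'I_b) d :
  `|\sum_(x < b) (f x : nat)%:R * wdigit b d x| <= b%:R ^+ 2 :> R.
Proof.
apply: le_trans (ler_norm_sum _ _ _) _.
apply: (@le_trans _ _ (\sum_(x < b) (b%:R : R))).
  apply: ler_sum => x _; rewrite normrM (ger0_norm (ler0n _ _)).
  by rewrite -[leRHS]mulr1 ler_pM// ?ler_nat ?(ltnW (ltn_ord _))// wdigit_norm.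
by rewrite sumr_const card_ord -[leLHS]mulr_natl expr2.
Qed.

Section fixed_maps.
Variable s : 'I_n -> 'I_b -> 'I_b.
Hypothesis sK : forall i, involutive (s i).

(** The mean is first taken over the two digits that the levels resolve. Their
    contribution v times v reproduces the area part exactly; the coupling
    terms carry the factor q^2, where q is the relative weight of such a digit
    in the other coordinate. *)
Lemma coef_below j1 j2 a c : (j1.+1 + j2.+1 <= n)%N ->
  (a < b ^ j1.+1)%N -> (c < b ^ j2.+1)%N ->
  `|coef s j1.+1 j2.+1 a c| <= b%:R ^+ 2 * (b%:R ^+ (j1.+1 + j2.+1) / b%:R ^+ (2 * n)).
Proof.
move=> jn ab cb.
have i1n : (n - j1.+1 < n)%N by lia.
have i2n : (j2 < n)%N by lia.
pose i1 := Ordinal i1n; pose i2 := Ordinal i2n.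
have p1j : (i1 + j1.+1 = n)%N by rewrite /=; lia.
have p2j : (rev_ord i2 + j2.+1 = n)%N by rewrite /=; lia.
(* q is the weight of digit i2 in the position of the first coordinate inside
   its interval of level j1.+1, and, by symmetry, of digit i1 in that of the
   second coordinate. *)
pose q : R := b%:R ^+ i2 / b%:R ^+ i1.
have qE : q = b%:R ^+ rev_ord i1 / b%:R ^+ rev_ord i2.
  rewrite /q; apply/eqP; rewrite eqr_div// -!exprD; apply/eqP; congr (_ ^+ _).
  by rewrite /=; lia.
set d1 := (a %% b)%N; set d2 := (c %% b)%N.
have d1b : (d1 < b)%N by rewrite ltn_mod.
have d2b : (d2 < b)%N by rewrite ltn_mod.
pose S1 : R := \sum_(x < b) (s i1 x : nat)%:R * wdigit b d1 x.
pose S2 : R := \sum_(y < b) (s i2 y : nat)%:R * wdigit b d2 y.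
pose r1 : R := d1%:R - (b%:R - 1) / 2; pose r2 : R := d2%:R - (b%:R - 1) / 2.
pose F t := ucell b j1.+1 (point_coord t) a * ucell b j2.+1 (point_coord (mirror s t)) c : R.
have inner t : \sum_y \sum_x F (set_digit (set_digit t i2 y) i1 x) =
  ((high_value t (n - j1) == a %/ b)%N%:R * (high_value (mirror s t) (n - j2) == c %/ b)%N%:R) *
   (r1 * r2 + q ^+ 2 * (S1 * S2)).
  have [A1 hA1] := @low_value_set_digit_below b n t i2 i1 ltac:(rewrite /=; lia).
  have [A2 hA2] := @low_value_set_digit_below b n (mirror s t) (rev_ord i1) (rev_ord i2) ltac:(rewrite /=; lia).
  have FE x y : F (set_digit (set_digit t i2 y) i1 x) =
    ((high_value t (n - j1) == a %/ b)%N%:R * (high_value (mirror s t) (n - j2) == c %/ b)%N%:R) *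
    ((vdigit b d1 x + (A1%:R / b%:R ^+ i1 + q * y%:R) * wdigit b d1 x) *
     (vdigit b d2 (s i2 y) + (A2%:R / b%:R ^+ rev_ord i2 + q * (s i1 x)%:R) * wdigit b d2 (s i2 y))).
    rewrite /F !mirror_set_digit (ucell_digits b_ge2 _ a p1j) (ucell_digits b_ge2 _ c p2j).
    rewrite !high_value_set_digit; [|rewrite /=; lia..].
    have -> : (i1.+1 = n - j1)%N by rewrite /=; lia.
    have -> : ((rev_ord i2).+1 = n - j2)%N by rewrite /=; lia.
    rewrite low_value_set_digit// hA1 !ffunE eqxx.
    have /negPf -> : rev_ord i2 != rev_ord i1.
      by rewrite (inj_eq rev_ord_inj) -val_eqE /=; lia.
    have -> : low_value (set_digit (set_digit (mirror s t) (rev_ord i2) (s i2 y)) (rev_ord i1) (s i1 x)) (rev_ord i2)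
       = (A2 + s i1 x * b ^ rev_ord i1)%N.
      rewrite -hA2; apply: eq_bigr => k kp; rewrite !ffunE; case: eqVneq => // _.
      by case: eqVneq => // ki; move: kp; rewrite ki ltnn.
    have E1 : (A1 + y * b ^ i2)%N%:R / b%:R ^+ i1 = A1%:R / b%:R ^+ i1 + q * y%:R :> R.
      by rewrite natrD natrM natrX /q; ring.
    have E2 : (A2 + s i1 x * b ^ rev_ord i1)%N%:R / b%:R ^+ rev_ord i2 =
        A2%:R / b%:R ^+ rev_ord i2 + q * (s i1 x)%:R :> R.
      by rewrite natrD natrM natrX qE; ring.
    by rewrite eqxx E1 E2 mulrACA.
  under eq_bigr do under eq_bigr do rewrite FE.
  under eq_bigr do rewrite -mulr_sumr.
  rewrite -mulr_sumr; congr (_ * _).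
  rewrite (reindex_inj (inv_inj (sK i2)))/=.
  under eq_bigr do under eq_bigr do rewrite sK.
  rewrite expand_affine_product ?sum_wdigit// !sum_vdigit//.
have total : b%:R * (b%:R * \sum_t F t) =
   b%:R ^+ (n - (j1 + j2)) * (r1 * r2 + q ^+ 2 * (S1 * S2)).
  rewrite -(sum_set_digit F i1) -(sum_set_digit (fun t => \sum_x F (set_digit t i1 x)) i2).
  rewrite (eq_bigr _ (fun t _ => inner t)) -mulr_suml sum_net_count//; first by lia.
  + by rewrite ltn_divLR// -expnSr.
  + by rewrite ltn_divLR// -expnSr.
have {total} total : \sum_t F t =
   b%:R ^+ (n - (j1 + j2)) / b%:R ^+ 2 * (r1 * r2 + q ^+ 2 * (S1 * S2)).
  apply: (mulfI bN0); apply: (mulfI bN0); rewrite total; field; exact: bN0.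
have e1 : (b%:R ^+ n)^-1 * (b%:R ^+ (n - (j1 + j2)) / b%:R ^+ 2) = (b%:R ^+ j1.+1 * b%:R ^+ j2.+1)^-1 :> R.
  have {1}-> : n = (n - (j1 + j2) + (j1 + j2))%N by lia.
  by rewrite !exprD !exprS; field; rewrite !bnN bN0.
have -> : coef s j1.+1 j2.+1 a c = q ^+ 2 / (b%:R ^+ j1.+1 * b%:R ^+ j2.+1) * (S1 * S2).
  rewrite /coef total mulrA e1 !mucellS// -/d1 -/d2 -/r1 -/r2.
  by field; rewrite !bnN.
rewrite normrM.
have S12 : `|S1 * S2| <= b%:R ^+ 4.
  by rewrite normrM -[4%N]/(2 + 2)%N exprD ler_pM// sum_digit_weight_le.
have q0 : 0 <= q ^+ 2 / (b%:R ^+ j1.+1 * b%:R ^+ j2.+1).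
  by rewrite divr_ge0 ?exprn_ge0 ?mulr_ge0 ?(ltW (bn0 _))// /q divr_ge0 ?(ltW (bn0 _)).
rewrite (ger0_norm q0); apply: le_trans (ler_wpM2l q0 S12) _.
rewrite le_eqVlt; apply/orP; left; apply/eqP.
have -> : q = b%:R ^+ (j1.+1 + j2) / b%:R ^+ n.
  rewrite /q; apply/eqP; rewrite eqr_div// -!exprD; apply/eqP; congr (_ ^+ _).
  by rewrite /=; lia.
rewrite mul2n -addnn !exprD !exprS.
by field; rewrite !bnN bN0.
Qed.

(** The second coordinates of the points are equidistributed on every level up
    to n, so that their counting part agrees with the area part. *)
Lemma sum_ucell_mirror j c : (j.+1 <= n)%N -> (c < b ^ j.+1)%N ->
  (b%:R ^+ n)^-1 * \sum_(t : {ffun 'I_n -> 'I_b}) ucell b j.+1 (point_coord (mirror s t)) c =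
    mucell b j.+1 c :> R.
Proof.
move=> jn cb; have p2j : (rev_ord (Ordinal jn) + j.+1 = n)%N by rewrite /=; lia.
set i2 := Ordinal jn in p2j.
have inner t : \sum_y ucell b j.+1 (point_coord (mirror s (set_digit t i2 y)) : R) c =
  ((high_value t (n - 0) == 0)%N%:R * (high_value (mirror s t) (n - j) == c %/ b)%N%:R) *
    ((c %% b)%N%:R - (b%:R - 1) / 2).
  rewrite subn0 high_value_n// eqxx mul1r -(sum_vdigit b_ge2 (ltn_pmod c b0)).
  have FE y : ucell b j.+1 (point_coord (mirror s (set_digit t i2 y)) : R) c =
     (high_value (mirror s t) (n - j) == c %/ b)%N%:R *
     (vdigit b (c %% b) (s i2 y) + (low_value (mirror s t) (rev_ord i2))%:R / b%:R ^+ rev_ord i2 *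
        wdigit b (c %% b) (s i2 y)).
    rewrite mirror_set_digit (ucell_digits b_ge2 _ c p2j) high_value_set_digit; last by rewrite /=; lia.
    have -> : ((rev_ord i2).+1 = n - j)%N by rewrite /=; lia.
    by rewrite low_value_set_digit// ffunE eqxx.
  under eq_bigr do rewrite FE.
  rewrite -mulr_sumr; congr (_ * _); rewrite (reindex_inj (inv_inj (sK i2)))/=.
  under eq_bigr do rewrite sK.
  by rewrite big_split/= -mulr_sumr sum_wdigit ?ltn_mod// mulr0 addr0.
have total := sum_set_digit (fun t => ucell b j.+1 (point_coord (mirror s t) : R) c) i2.
rewrite (eq_bigr _ (fun t _ => inner t)) -mulr_suml sum_net_count// in total; last 2 first.
- by lia.
- by rewrite ltn_divLR// -expnSr.
apply: (mulfI bN0); rewrite mulrCA -total mucellS//.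
have {1}-> : n = (n - (0 + j) + j)%N by lia.
by rewrite exprD !exprS; field; rewrite !bnN bN0.
Qed.

Lemma sum_norm_ucell_mirror j c : (j.+1 <= n)%N -> (c < b ^ j.+1)%N ->
  \sum_(t : {ffun 'I_n -> 'I_b}) `|ucell b j.+1 (point_coord (mirror s t)) c : R| <=
    2 * b%:R ^+ (n - j).
Proof.
move=> jn cb; rewrite -[X in _ <= _ * b%:R ^+ (n - X)]add0n.
rewrite -(@sum_net_count R b n b_ge2 s sK 0 j 0 (c %/ b)%N)//; last 2 first.
- by lia.
- by rewrite ltn_divLR// -expnSr.
rewrite mulr_sumr; apply: ler_sum => t _.
apply: le_trans (ucell_bound b_ge2 _ c (ltnSn j) (ltnW jn)) _.
have h0 : high_value t n = 0%N by exact: high_value_n.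
by rewrite subSnn expn1 subn0 h0 eqxx mul1r.
Qed.

(** The centred coordinate, a sum of independent centred digits (deviationE). *)
Definition deviation tau : R := point_coord tau - (1 - (b%:R ^+ n)^-1) / 2.

Lemma deviationE tau : deviation tau =
  \sum_(i < n) ((tau i : nat)%:R - (b%:R - 1) / 2) * (b%:R ^+ i / b%:R ^+ n).
Proof.
rewrite /deviation /point_coord /digit_value natr_sum mulr_suml.
under [RHS]eq_bigr do rewrite mulrBl.
rewrite sumrB; congr (_ - _); last first.
  rewrite -mulr_sumr -mulr_suml.
  have -> : (b%:R - 1) / 2 * ((\sum_(i < n) b%:R ^+ i) / b%:R ^+ n) =
     ((b%:R - 1) * \sum_(i < n) b%:R ^+ i) / (b%:R ^+ n * 2) :> R.
    by field; rewrite bnN.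
  by rewrite -subrX1; field; rewrite bnN.
by apply: eq_bigr => i _; rewrite natrM natrX mulrA.
Qed.

Lemma sum_centered_digit (f : 'I_b -> 'I_b) : involutive f ->
  \sum_(x < b) ((f x : nat)%:R - (b%:R - 1) / 2 : R) = 0.
Proof.
move=> fK; rewrite (reindex_inj (inv_inj fK))/=.
under eq_bigr do rewrite fK.
rewrite sumrB -(big_mkord xpredT (fun i : nat => i%:R)) sum_digits sumr_const card_ord.
by rewrite -[X in _ - X]mulr_natl mulrA subrr.
Qed.

Lemma ecell0 tau : ucell b 0 (point_coord tau) 0 = (1 + (b%:R ^+ n)^-1) / 2 - deviation tau.
Proof.
have z0 : 0 <= point_coord tau :> R by rewrite divr_ge0 ?(ltW (bn0 n)).
have z1 : point_coord tau <= 1 :> R.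
  by rewrite ler_pdivrMr// mul1r -natrX ler_nat ltnW// digit_value_lt.
rewrite /ucell /ecell expr0 mul1r /pos max_r; last by rewrite subr_ge0.
rewrite max_l; last by rewrite sub0r oppr_le0.
by rewrite /deviation; field; rewrite bnN.
Qed.

Lemma sum_high_powers (m : nat) : (m <= n)%N ->
  \sum_(i < n | (i < m)%N) (b%:R ^+ i : R) <= b%:R ^+ m.
Proof.
elim: m => [|m IH] mn; first by rewrite big_pred0// ler01.
rewrite (bigD1 (Ordinal mn)) //=.
rewrite (eq_bigl (fun i : 'I_n => (i < m)%N)); last first.
  by move=> i; rewrite ltnS -val_eqE/= [RHS]ltn_neqAle andbC.
apply: le_trans (lerD (lexx _) (IH (ltnW mn))) _.
by rewrite exprS -mulr2n -[_ *+ 2]mulr_natl ler_wpM2r ?(ltW (bn0 _))// ler_nat.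
Qed.

(** On level 0 the first factor is a constant minus the deviation. Only the
    j+1 digits that the second coordinate needs on level j+1 are correlated
    with it, and among the digits of the first coordinate these have the small
    weights b^(i-n), i <= j. *)
Lemma coef_left_edge j c : (j.+1 <= n)%N -> (c < b ^ j.+1)%N ->
  `|coef s 0 j.+1 0 c| <= 3 * b%:R ^+ 2 / b%:R ^+ n.
Proof.
move=> jn cb; have p2j : (rev_ord (Ordinal jn) + j.+1 = n)%N by rewrite /=; lia.
set i2 := Ordinal jn in p2j.
pose m : R := (b%:R - 1) / 2.
pose u t : R := ucell b j.+1 (point_coord (mirror s t)) c.
(* The second coordinate does not involve digit i except through the position
   that digit i2 averages out. *)
have dz i : (i2 < i)%N -> \sum_(t : {ffun 'I_n -> 'I_b}) ((t i : nat)%:R - m) * u t = 0.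
  move=> ii; apply: (mulfI bN0); rewrite mulr0 -(sum_set_digit _ i2).
  pose G t := (high_value (mirror s t) (n - j) == c %/ b)%N%:R * ((c %% b)%N%:R - (b%:R - 1) / 2) : R.
  have inner t : \sum_y ((set_digit t i2 y i : nat)%:R - m) * u (set_digit t i2 y) = ((t i : nat)%:R - m) * G t.
    have ti y : set_digit t i2 y i = t i.
      by rewrite ffunE; case: eqVneq => // ei; move: ii; rewrite ei ltnn.
    under eq_bigr do rewrite ti.
    rewrite -mulr_sumr /G -(sum_vdigit b_ge2 (ltn_pmod c b0)); congr (_ * _).
    have FE y : u (set_digit t i2 y) =
       (high_value (mirror s t) (n - j) == c %/ b)%N%:R *
       (vdigit b (c %% b) (s i2 y) + (low_value (mirror s t) (rev_ord i2))%:R / b%:R ^+ rev_ord i2 *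
          wdigit b (c %% b) (s i2 y)).
      rewrite /u mirror_set_digit (ucell_digits b_ge2 _ c p2j) high_value_set_digit; last by rewrite /=; lia.
      have -> : ((rev_ord i2).+1 = n - j)%N by rewrite /=; lia.
      by rewrite low_value_set_digit// ffunE eqxx.
    under eq_bigr do rewrite FE.
    rewrite -mulr_sumr; congr (_ * _); rewrite (reindex_inj (inv_inj (sK i2)))/=.
    under eq_bigr do rewrite sK.
    by rewrite big_split/= -mulr_sumr sum_wdigit ?ltn_mod// mulr0 addr0.
  rewrite (eq_bigr _ (fun t _ => inner t)).
  apply: (mulfI bN0); rewrite mulr0 -(sum_set_digit _ i) big1// => t _.
  rewrite (eq_bigr (fun x : 'I_b => ((x : nat)%:R - m) * G t)); last first.
    move=> x _; rewrite ffunE eqxx /G mirror_set_digit high_value_set_digit//=.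
    by have := ltn_ord i; move: ii; rewrite /=; lia.
  by rewrite -mulr_suml (sum_centered_digit (f := id))// mul0r.
have -> : coef s 0 j.+1 0 c = (b%:R ^+ n)^-1 / 2 * mucell b j.+1 c -
   (b%:R ^+ n)^-1 * \sum_(t : {ffun 'I_n -> 'I_b}) deviation t * u t.
  rewrite /coef; under eq_bigr do rewrite ecell0 mulrBl.
  rewrite sumrB -mulr_sumr.
  have e := sum_ucell_mirror jn cb.
  have e0 : mucell b 0 0 = 2^-1 :> R by rewrite /mucell /mcell expr0 divr1 add0r.
  rewrite e0 mulrBr mulrCA e; rewrite -/u; ring.
have mu1 : `|mucell b j.+1 c| <= b%:R :> R.
  rewrite mucellS// normrM (@ger0_norm _ (b%:R ^+ _)^-1) ?invr_ge0 ?(ltW (bn0 _))//.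
  have h1 : `|(c %% b)%N%:R - (b%:R - 1) / 2| <= b%:R :> R.
    have : (c %% b)%N%:R <= b%:R :> R by rewrite ler_nat ltnW// ltn_mod.
    have : 0 <= (c %% b)%N%:R :> R by [].
    by move: bR1; rewrite ler_norml; lra.
  rewrite -[leRHS]mulr1 ler_pM ?invr_ge0 ?(ltW (bn0 _))//.
  by rewrite invf_le1// exprn_ege1.
have dev : `|\sum_(t : {ffun 'I_n -> 'I_b}) deviation t * u t| <= 2 * b%:R ^+ 2.
  under eq_bigr do rewrite deviationE mulr_suml.
  rewrite exchange_big/=.
  have ei (i : 'I_n) : \sum_(t : {ffun 'I_n -> 'I_b}) ((t i : nat)%:R - m) * (b%:R ^+ i / b%:R ^+ n) * u t =
     (b%:R ^+ i / b%:R ^+ n) * \sum_(t : {ffun 'I_n -> 'I_b}) ((t i : nat)%:R - m) * u t.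
    by rewrite mulr_sumr; apply: eq_bigr => t _; ring.
  under eq_bigr do rewrite ei.
  rewrite (bigID (fun i : 'I_n => (i < j.+1)%N))/= [X in _ + X]big1 ?addr0; last first.
    by move=> i; rewrite -leqNgt => ji; rewrite dz ?mulr0.
  apply: le_trans (ler_norm_sum _ _ _) _.
  have bd (i : 'I_n) : `|b%:R ^+ i / b%:R ^+ n * \sum_(t : {ffun 'I_n -> 'I_b}) ((t i : nat)%:R - m) * u t| <=
     b%:R ^+ i * (b%:R * (2 * b%:R ^+ (n - j)) / b%:R ^+ n).
    rewrite normrM ger0_norm ?divr_ge0 ?(ltW (bn0 _))// -[leLHS]mulrA ler_wpM2l ?(ltW (bn0 _))//.
    rewrite [leLHS]mulrC ler_wpM2r ?invr_ge0 ?(ltW (bn0 _))//.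
    apply: le_trans (ler_norm_sum _ _ _) _.
    apply: (@le_trans _ _ (\sum_(t : {ffun 'I_n -> 'I_b}) b%:R * `|u t|)).
      apply: ler_sum => t _; rewrite normrM ler_wpM2r//.
      have : (t i)%:R <= b%:R :> R by rewrite ler_nat ltnW.
      have : 0 <= (t i)%:R :> R by [].
      by move: bR1; rewrite /m ler_norml; lra.
    by rewrite -mulr_sumr ler_wpM2l// sum_norm_ucell_mirror.
  apply: le_trans (ler_sum _ (fun i _ => bd i)) _.
  rewrite -mulr_suml; apply: le_trans (ler_wpM2r _ (sum_high_powers jn)) _.
    by rewrite !mulr_ge0 ?invr_ge0 ?(ltW (bn0 _)).
  rewrite le_eqVlt; apply/orP; left; apply/eqP.
  have {2}-> : n = (n - j + j)%N by lia.
  by rewrite exprD exprS; field; rewrite !bnN.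
have I0 : 0 < (b%:R ^+ n)^-1 :> R by rewrite invr_gt0.
rewrite (le_trans (ler_normB _ _))// !normrM (gtr0_norm I0) (@ger0_norm _ 2^-1)//.
have b2 : b%:R <= b%:R ^+ 2 :> R by rewrite expr2 ler_peMr.
have := ler_wpM2l (ltW I0) mu1; have := ler_wpM2l (ltW I0) dev.
have : 0 <= (b%:R ^+ n)^-1 * `|mucell b j.+1 c| :> R by rewrite mulr_ge0 ?(ltW I0).
have := ler_wpM2l (ltW I0) b2.
lra.
Qed.

End fixed_maps.
End Coefficients.

(** * Haar coefficients on level zero and on fine levels *)

Section MoreCoefficients.
Context {R : realType}.
Variables (b n : nat).
Hypothesis b_ge2 : (2 <= b)%N.

Let b0 : (0 < b)%N. Proof. exact: leq_trans b_ge2. Qed.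
Let bR0 : 0 < b%:R :> R. Proof. by rewrite ltr0n. Qed.
Let bR1 : 1 <= b%:R :> R. Proof. by rewrite ler1n. Qed.
Let bN0 : b%:R != 0 :> R. Proof. by rewrite gt_eqF. Qed.
Let bn0 k : 0 < b%:R ^+ k :> R. Proof. by rewrite exprn_gt0. Qed.
Let bnN k : b%:R ^+ k != 0 :> R. Proof. by rewrite gt_eqF. Qed.

Implicit Types (t tau : {ffun 'I_n -> 'I_b}) (i : 'I_n) (s : 'I_n -> 'I_b -> 'I_b).

Lemma mirrorK s : (forall i, involutive (s i)) ->
  cancel (mirror s) (mirror (fun i => s (rev_ord i))).
Proof. by move=> sK t; apply/ffunP => i; rewrite !ffunE rev_ordK sK. Qed.

Lemma mirrorVK s : (forall i, involutive (s i)) ->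
  cancel (mirror (fun i => s (rev_ord i))) (mirror s).
Proof. by move=> sK t; apply/ffunP => i; rewrite !ffunE !rev_ordK sK. Qed.

(** Exchanging the coordinates produces the net of the reversed sequence of
    maps. *)
Lemma coef_swap s j1 j2 a c : (forall i, involutive (s i)) ->
  coef s j1 j2 a c = coef (fun i => s (rev_ord i)) j2 j1 c a :> R.
Proof.
move=> sK; rewrite /coef [X in _ - X]mulrC; congr (_ * _ - _).
rewrite (reindex_inj (can_inj (mirrorVK sK)))/=.
by apply: eq_bigr => t _; rewrite mirrorVK// mulrC.
Qed.

Lemma coef_right_edge s j a : (forall i, involutive (s i)) ->
  (j.+1 <= n)%N -> (a < b ^ j.+1)%N ->
  `|coef s j.+1 0 a 0 : R| <= 3 * b%:R ^+ 2 / b%:R ^+ n.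
Proof. by move=> sK jn ab; rewrite coef_swap//; apply: coef_left_edge. Qed.

Lemma digit_maps_involutive s : digit_maps s -> forall i, involutive (s i).
Proof.
move=> hs i x; case: (hs i) => h; first by rewrite !h.
by apply/val_inj; rewrite /= !h; have := ltn_ord x; lia.
Qed.

Lemma sum_deviation s : (forall i, involutive (s i)) ->
  \sum_(t : {ffun 'I_n -> 'I_b}) deviation (mirror s t) = 0 :> R.
Proof.
move=> sK; under eq_bigr do rewrite deviationE//.
rewrite exchange_big/= big1// => i _; rewrite -mulr_suml.
set S := \sum_(t : {ffun 'I_n -> 'I_b}) _.
suff -> : S = 0 by rewrite mul0r.
apply: (mulfI bN0); rewrite mulr0 -(sum_set_digit _ (rev_ord i)) big1// => t _.
under eq_bigr do rewrite ffunE ffunE eqxx.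
exact: (sum_centered_digit (sK _)).
Qed.

Definition digit_variance : R := \sum_(x < b) ((x : nat)%:R - (b%:R - 1) / 2) ^+ 2.

(** Only the digit i of the first coordinate and the digit rev_ord i of the
    second depend on the same t i. Their covariance is plus the variance of a
    digit for the identity and minus it for the reflection, and the product of
    their weights is b^-(n+1) for every i. *)
Lemma sum_deviation_product s : digit_maps s ->
  \sum_(t : {ffun 'I_n -> 'I_b}) deviation t * deviation (mirror s t) =
    digit_variance / b%:R ^+ 2 * (2 * (num_id s)%:R - n%:R) :> R.
Proof.
move=> hs; have sK := digit_maps_involutive hs.
pose m : R := (b%:R - 1) / 2.
pose w (i : 'I_n) : R := b%:R ^+ i / b%:R ^+ n.
under eq_bigr do rewrite !deviationE// big_distrlr/=.
rewrite exchange_big/=; under eq_bigr do rewrite exchange_big/=.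
have V i : \sum_(x < b) ((x : nat)%:R - m) * ((s i x : nat)%:R - m) =
   digit_variance * (2 * [forall t, s i t == t]%:R - 1).
  rewrite /digit_variance mulr_suml.
  case: forallP => [h|h].
    by apply: eq_bigr => x _; rewrite (eqP (h x)) /= mulr1n /m; ring.
  case: (hs i) => hi; first by case: h => x; rewrite hi.
  apply: eq_bigr => x _; rewrite hi.
  have -> : (b - 1 - x)%N%:R = b%:R - 1 - x%:R :> R.
    by rewrite -subnDA natrB ?natrD; [ring|have := ltn_ord x; lia].
  by rewrite /= mulr0n /m; field.
have inner i k : \sum_(t : {ffun 'I_n -> 'I_b}) ((t i : nat)%:R - (b%:R - 1) / 2) * (b%:R ^+ i / b%:R ^+ n) *
     (((mirror s t k : nat)%:R - (b%:R - 1) / 2) * (b%:R ^+ k / b%:R ^+ n)) =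
  (k == rev_ord i)%:R * (digit_variance / b%:R ^+ 2 * (2 * [forall t, s i t == t]%:R - 1)).
  rewrite (eq_bigr (fun t : {ffun 'I_n -> 'I_b} => (w i * w k) *
    (((t i : nat)%:R - m) * ((mirror s t k : nat)%:R - m)))); last by move=> t _; rewrite /w /m; ring.
  rewrite -mulr_sumr; apply: (mulfI bN0); rewrite mulrCA -(sum_set_digit _ i).
  have [->|ki] := eqVneq k (rev_ord i).
    rewrite (eq_bigr (fun _ => digit_variance * (2 * [forall t, s i t == t]%:R - 1))); last first.
      by move=> t _; rewrite -V; apply: eq_bigr => x _; rewrite !ffunE rev_ordK eqxx.
    rewrite sumr_const card_ffun !card_ord -[_ *+ (b ^ n)%N]mulr_natl natrX mul1r.
    have -> : w i * w (rev_ord i) = (b%:R * b%:R ^+ n)^-1.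
      rewrite /w mulrACA -exprD.
      have -> : (i + rev_ord i = n - 1)%N by rewrite /=; have := ltn_ord i; lia.
      have {2 3 4}-> : n = (n - 1).+1 by have := ltn_ord i; lia.
      by rewrite !exprS; field; rewrite bnN bN0.
    by field; rewrite bnN bN0.
  rewrite !mul0r big1 ?mulr0// => t _.
  rewrite (eq_bigr (fun x : 'I_b => ((x : nat)%:R - m) * ((mirror s t k : nat)%:R - m))); last first.
    move=> x _; rewrite !ffunE eqxx; case: eqVneq => // ek.
    by move: ki; rewrite -ek rev_ordK eqxx.
  by rewrite -mulr_suml (sum_centered_digit (f := id))// mul0r.
under eq_bigr do under eq_bigr do rewrite inner.
rewrite (eq_bigr (fun i => digit_variance / b%:R ^+ 2 * (2 * [forall t, s i t == t]%:R - 1))); last first.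
  move=> i _; rewrite (bigD1 (rev_ord i))//= eqxx mul1r big1 ?addr0// => k /negPf ->.
  by rewrite mul0r.
rewrite -mulr_sumr; congr (_ * _); rewrite sumrB -mulr_sumr sumr_const card_ord.
congr (_ * _ - _); rewrite /num_id -sum1_card natr_sum [RHS]big_mkcond/=.
by apply: eq_bigr => i _; rewrite inE; case: ifP.
Qed.

Lemma digit_variance_le : 0 <= digit_variance <= b%:R ^+ 3.
Proof.
apply/andP; split; first by apply: sumr_ge0 => x _; exact: sqr_ge0.
apply: (@le_trans _ _ (\sum_(x < b) (b%:R ^+ 2 : R))).
  apply: ler_sum => x _.
  have h : `|(x : nat)%:R - (b%:R - 1) / 2| <= b%:R :> R.
    have : (x : nat)%:R <= b%:R :> R by rewrite ler_nat ltnW.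
    have : 0 <= (x : nat)%:R :> R by [].
    by move: bR1; rewrite ler_norml; lra.
  by rewrite -(real_normK (num_real _)) lerXn2r// nnegrE.
by rewrite sumr_const card_ord -[leLHS]mulr_natl -exprS.
Qed.

(** The mean of the product of the two coordinates is a constant plus their
    covariance. *)
Lemma coef_corner s (c0 : R) : digit_maps s -> `|2 * (num_id s)%:R - n%:R| <= c0 ->
  `|coef s 0 0 0 0| <= (1 + b%:R * c0) / b%:R ^+ n.
Proof.
move=> hs ac; have sK := digit_maps_involutive hs.
pose h : R := (1 + (b%:R ^+ n)^-1) / 2.
have e0 : mucell b 0 0 = 2^-1 :> R by rewrite /mucell /mcell expr0 divr1 add0r.
have S1 : \sum_(t : {ffun 'I_n -> 'I_b}) deviation t = 0 :> R.
  have := sum_deviation (s := fun _ => id) (fun _ => frefl _).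
  rewrite (reindex_inj (can_inj (@mirrorK (fun _ => id) (fun _ => frefl _))))/=.
  by under eq_bigr do rewrite (@mirrorVK (fun _ => id) (fun _ => frefl _)).
have S2 := sum_deviation sK.
have S3 := sum_deviation_product hs.
have -> : coef s 0 0 0 0 = (b%:R ^+ n)^-1 / 2 + (b%:R ^+ n)^-1 ^+ 2 / 4 +
    (b%:R ^+ n)^-1 * (digit_variance / b%:R ^+ 2 * (2 * (num_id s)%:R - n%:R)).
  rewrite /coef -S3 e0.
  rewrite (eq_bigr (fun t : {ffun 'I_n -> 'I_b} => h * h - h * deviation t - h * deviation (mirror s t) +
      deviation t * deviation (mirror s t))); last first.
    by move=> t _; rewrite !ecell0//; rewrite /h; ring.
  rewrite big_split/= !sumrB -!mulr_sumr S1 S2 sumr_const card_ffun !card_ord.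
  by rewrite -[_ *+ (b ^ n)%N]mulr_natl natrX /h; field; rewrite bnN.
have I0 : 0 < (b%:R ^+ n)^-1 :> R by rewrite invr_gt0.
have I1 : (b%:R ^+ n)^-1 <= 1 :> R by rewrite invf_le1// exprn_ege1.
have /andP[V0 V1] := digit_variance_le.
have h3 : `|digit_variance / b%:R ^+ 2 * (2 * (num_id s)%:R - n%:R)| <= b%:R * c0.
  rewrite normrM ger0_norm ?divr_ge0 ?exprn_ge0// ler_pM// ?divr_ge0 ?exprn_ge0//.
  by rewrite ler_pdivrMr ?exprn_gt0// -exprS.
have h2 : (b%:R ^+ n)^-1 ^+ 2 <= (b%:R ^+ n)^-1 :> R by rewrite expr2 ler_piMl ?(ltW I0).
have h20 : 0 <= (b%:R ^+ n)^-1 ^+ 2 :> R by rewrite sqr_ge0.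
have -> : (1 + b%:R * c0) / b%:R ^+ n = (b%:R ^+ n)^-1 + (b%:R ^+ n)^-1 * (b%:R * c0) by ring.
rewrite (le_trans (ler_normD _ _))// normrM (gtr0_norm I0) lerD//.
  by rewrite ger0_norm; lra.
by rewrite ler_wpM2l ?(ltW I0).
Qed.

Lemma mucell_norm j a : (a < b ^ j)%N -> `|mucell b j a : R| <= b%:R / b%:R ^+ j.
Proof.
case: j => [|j] ab.
  have -> : a = 0%N by move: ab; rewrite expn0; case: (a).
  rewrite /mucell /mcell expr0 !divr1 add0r ger0_norm ?invr_ge0//.
  by rewrite (le_trans _ bR1)// invf_le1// ler1n.
rewrite mucellS// normrM (@ger0_norm _ (b%:R ^+ _)^-1) ?invr_ge0 ?(ltW (bn0 _))//.
rewrite ler_wpM2r ?invr_ge0 ?(ltW (bn0 _))//.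
have : (a %% b)%N%:R <= b%:R :> R by rewrite ler_nat ltnW// ltn_mod.
have : 0 <= (a %% b)%N%:R :> R by [].
by move: bR1; rewrite ler_norml; lra.
Qed.

Lemma ucell0_norm tau a : (a < b ^ 0)%N -> `|ucell b 0 (point_coord tau) a : R| <= 1.
Proof.
move=> ab; have -> : a = 0%N by move: ab; rewrite expn0; case: (a).
have z0 : 0 <= point_coord tau :> R by rewrite divr_ge0 ?(ltW (bn0 n)).
have z1 : point_coord tau <= 1 :> R.
  by rewrite ler_pdivrMr// mul1r -natrX ler_nat ltnW// digit_value_lt.
rewrite /ucell /ecell expr0 mul1r /pos max_r; last by rewrite subr_ge0.
rewrite max_l; last by rewrite sub0r oppr_le0.
by rewrite subr0 ger0_norm ?subr_ge0// gerBl.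
Qed.

Lemma ucell_le_match tau j l a : (l <= j.-1)%N -> (l <= n)%N -> (a < b ^ j)%N ->
  `|ucell b j (point_coord tau) a : R| <= 2 * (high_value tau (n - l) == a %/ b ^ (j - l))%N%:R.
Proof.
case: j => [|j] lj ln ab; last exact: ucell_bound.
move: lj; rewrite leqn0 => /eqP ->; rewrite !subn0 expn0 divn1.
have -> : a = 0%N by move: ab; rewrite expn0; case: (a).
rewrite high_value_n// eqxx mulr1; apply: le_trans (ucell0_norm _ _) _ => //.
by rewrite ler1n.
Qed.

(** Only points in an elementary rectangle of area b^-n or b^(1-n) contribute
    to the counting part, and it contains at most b points. *)
Lemma coef_above s j1 j2 a c : (forall i, involutive (s i)) -> (n < j1 + j2)%N ->
  (a < b ^ j1)%N -> (c < b ^ j2)%N ->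
  `|coef s j1 j2 a c : R| <= 5 * b%:R ^+ 2 / b%:R ^+ n.
Proof.
move=> sK nj ab cb.
(* The net property is available for levels l1 and l2 with l1 + l2 <= n; those
   chosen here are strictly coarser than j1 and j2 unless these are 0, and l1
   + l2 is at least n - 1 because j1 + j2 > n. *)
pose l1 := minn j1.-1 n; pose l2 := minn j2.-1 (n - l1).
have l1j : (l1 <= j1.-1)%N by exact: geq_minl.
have l1n : (l1 <= n)%N by exact: geq_minr.
have l2j : (l2 <= j2.-1)%N by exact: geq_minl.
have l2n : (l2 <= n - l1)%N by exact: geq_minr.
have lsum : (n - (l1 + l2) <= 1)%N by rewrite /l2 /l1; lia.
have main : `|(b%:R ^+ n)^-1 * \sum_(t : {ffun 'I_n -> 'I_b})
     ucell b j1 (point_coord t) a * ucell b j2 (point_coord (mirror s t)) c| <=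
     4 * b%:R ^+ 2 / b%:R ^+ n :> R.
  rewrite normrM gtr0_norm ?invr_gt0// mulrC ler_wpM2r ?invr_ge0 ?(ltW (bn0 _))//.
  apply: le_trans (ler_norm_sum _ _ _) _.
  apply: (@le_trans _ _ (\sum_(t : {ffun 'I_n -> 'I_b}) 4 *
     ((high_value t (n - l1) == a %/ b ^ (j1 - l1))%N%:R *
      (high_value (mirror s t) (n - l2) == c %/ b ^ (j2 - l2))%N%:R))).
    apply: ler_sum => t _; rewrite normrM (_ : 4 = 2 * 2 :> R); last by ring.
    rewrite mulrACA.
    by rewrite ler_pM// ucell_le_match//; lia.
  rewrite -mulr_sumr sum_net_count//.
  - rewrite ler_wpM2l//; apply: (@le_trans _ _ (b%:R ^+ 1)).
      by rewrite ler_weXn2l.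
    by rewrite ler_weXn2l.
  - by lia.
  - by rewrite ltn_divLR ?expn_gt0 ?b0// -expnD (_ : l1 + (j1 - l1) = j1)%N//; lia.
  - by rewrite ltn_divLR ?expn_gt0 ?b0// -expnD (_ : l2 + (j2 - l2) = j2)%N//; lia.
have muu : `|mucell b j1 a * mucell b j2 c| <= b%:R ^+ 2 / b%:R ^+ n :> R.
  rewrite normrM; apply: (@le_trans _ _ ((b%:R / b%:R ^+ j1) * (b%:R / b%:R ^+ j2))).
    by rewrite ler_pM// mucell_norm.
  rewrite mulrACA -expr2 -invfM -exprD ler_wpM2l ?exprn_ge0//.
  by rewrite lef_pV2 ?posrE// ler_weXn2l// ltnW.
rewrite /coef (le_trans (ler_normB _ _))//.
have -> : 5 * b%:R ^+ 2 / b%:R ^+ n = 4 * b%:R ^+ 2 / b%:R ^+ n + b%:R ^+ 2 / b%:R ^+ n :> R by ring.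
by rewrite lerD.
Qed.

Lemma sum_ucell_norm tau j :
  \sum_(0 <= a < b ^ j) `|ucell b j (point_coord tau) a : R| <= 2 * b%:R.
Proof.
case: j => [|j].
  rewrite big_nat1; apply: le_trans (ucell0_norm _ _) _ => //.
  by rewrite mulr_ege1// ler1n.
have [N [phi [zE p01 _]]] := @digits_scaled R _ _ b_ge2 tau j.+1.
apply: (@le_trans _ _ (\sum_(0 <= a < b ^ j.+1) (2 * (N %/ b == a %/ b)%N%:R : R))).
  apply: ler_sum => a _; rewrite (ucellE b_ge2 a zE p01).
  have [Na|Na] := eqVneq (N %/ b)%N (a %/ b)%N; last by rewrite mul0r normr0 mulr_ge0.
  rewrite mulr1 mul1r; have /andP[p0 p1] := p01.
  rewrite (le_trans (ler_normD _ _))// (_ : 2 = 1 + 1)// lerD//.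
    by apply: vdigit_norm => //; rewrite ltn_mod.
  by rewrite normrM (ger0_norm p0) mulr_ile1 ?(ltW p1)// wdigit_norm.
rewrite -mulr_sumr ler_wpM2l// expnSr sum_nat_mul.
rewrite (eq_bigr (fun A : nat => b%:R * (N %/ b == A)%N%:R)); last first.
  move=> A _; under eq_big_nat => d /andP[_ db].
    rewrite (divnMDl A d b0) (divn_small db) addn0; over.
  by rewrite sumr_const_nat subn0 -[LHS]mulr_natl.
rewrite -mulr_sumr -[leRHS]mulr1 ler_wpM2l//.
have [Nj|jN] := ltnP (N %/ b)%N (b ^ j)%N.
  rewrite big_mkord (bigD1 (Ordinal Nj))//= eqxx big1 ?addr0// => A /negPf e.
  by rewrite eq_sym -val_eqE/= in e; rewrite e.
rewrite big_nat big1// => A /andP[_ Aj].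
by rewrite gtn_eqF// (leq_trans Aj).
Qed.

(** Every point contributes a bounded amount per level to the counting part. *)
Lemma sum_coef_norm s j1 j2 :
  \sum_(0 <= a < b ^ j1) \sum_(0 <= c < b ^ j2) `|coef s j1 j2 a c : R| <= 5 * b%:R ^+ 2.
Proof.
pose U j t a : R := `|ucell b j (point_coord t) a|.
pose W j a : R := `|mucell b j a|.
have Wsum j : \sum_(0 <= a < b ^ j) W j a <= b%:R.
  apply: (@le_trans _ _ (\sum_(0 <= a < b ^ j) (b%:R / b%:R ^+ j : R))).
    by rewrite !big_nat; apply: ler_sum => a /andP[_ aj]; exact: mucell_norm.
  by rewrite sumr_const_nat subn0 -[leLHS]mulr_natr natrX divfK.
apply: (@le_trans _ _ (\sum_(0 <= a < b ^ j1) \sum_(0 <= c < b ^ j2)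
   ((b%:R ^+ n)^-1 * \sum_(t : {ffun 'I_n -> 'I_b}) U j1 t a * U j2 (mirror s t) c + W j1 a * W j2 c))).
  apply: ler_sum => a _; apply: ler_sum => c _.
  rewrite /coef (le_trans (ler_normB _ _))// !normrM lerD//.
  rewrite gtr0_norm ?invr_gt0// ler_wpM2l ?invr_ge0 ?(ltW (bn0 _))//.
  apply: le_trans (ler_norm_sum _ _ _) _.
  by apply: ler_sum => t _; rewrite normrM.
under eq_bigr do rewrite big_split/= -!mulr_sumr exchange_big/=.
rewrite big_split/= -mulr_sumr -mulr_suml exchange_big/=.
under eq_bigr do under eq_bigr do rewrite -mulr_sumr.
under eq_bigr do rewrite -mulr_suml.
have W0 j : 0 <= \sum_(0 <= a < b ^ j) W j a by apply: sumr_ge0 => a _; exact: normr_ge0.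
have -> : 5 * b%:R ^+ 2 = 4 * b%:R ^+ 2 + b%:R * b%:R :> R by ring.
apply: lerD; last by rewrite ler_pM.
rewrite ler_pdivrMl//.
apply: (@le_trans _ _ (\sum_(t : {ffun 'I_n -> 'I_b}) (4 * b%:R ^+ 2))).
  apply: ler_sum => t _.
  have -> : 4 * b%:R ^+ 2 = (2 * b%:R) * (2 * b%:R) :> R by ring.
  by rewrite ler_pM ?sum_ucell_norm// sumr_ge0// => a _; exact: normr_ge0.
by rewrite sumr_const card_ffun !card_ord -[leLHS]mulr_natl natrX.
Qed.

Lemma coef_child_sum_left s j1 j2 c : child_sum_zero b j1 (fun a => coef s j1 j2 a c : R).
Proof.
case: j1 => // j A _; rewrite /coef sumrB -mulr_sumr exchange_big/=.
under eq_bigr do rewrite -mulr_suml sum_ucell_children// mul0r.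
by rewrite big1// -mulr_suml sum_mucell_children// mul0r mulr0 subr0.
Qed.

Lemma coef_child_sum_right s j1 j2 a : child_sum_zero b j2 (fun c => coef s j1 j2 a c : R).
Proof.
case: j2 => // j A _; rewrite /coef sumrB -mulr_sumr exchange_big/=.
under eq_bigr do rewrite -mulr_sumr sum_ucell_children// mulr0.
by rewrite big1// -mulr_sumr sum_mucell_children// !mulr0 subr0.
Qed.

End MoreCoefficients.

(** * Summation of the levels *)

Section Reconstruction.
Context {R : realType}.
Local Notation mu := (@lebesgue_measure R).
Variable b : nat.
Hypothesis b_ge2 : (2 <= b)%N.
Implicit Types (kap P : R -> R) (y z C : R).

Let b0 : (0 < b)%N. Proof. exact: leq_trans b_ge2. Qed.
Let bR0 : 0 < b%:R :> R. Proof. by rewrite ltr0n. Qed.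
Let bN0 : b%:R != 0 :> R. Proof. by rewrite gt_eqF. Qed.
Let bn0 k : 0 < b%:R ^+ k :> R. Proof. by rewrite exprn_gt0. Qed.
Let bnN k : b%:R ^+ k != 0 :> R. Proof. by rewrite gt_eqF. Qed.

(** Since cells add up over the parts of an interval, the levels telescope. *)
Lemma sum_levels (f g : nat -> nat -> R) P k m y :
  (forall a, f 0%N a = g 0%N a) ->
  (forall j a, f j.+1 a = g j.+1 a - g j (a %/ b)%N) ->
  \sum_(0 <= j < m.+1) \sum_(0 <= a < b ^ j) f j a * cell b P k j a y =
  \sum_(0 <= a < b ^ m) g m a * cell b P k m a y.
Proof.
move=> f0 fS; elim: m => [|m IH].
  by rewrite big_nat1; apply: eq_bigr => a _; rewrite f0.
rewrite big_nat_recr//= IH.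
under [X in _ + X]eq_bigr do rewrite fS mulrBl.
rewrite sumrB [X in _ - X](_ : _ = \sum_(0 <= a < b ^ m) g m a * cell b P k m a y).
  by rewrite addrC subrK.
rewrite expnSr sum_nat_mul; apply: eq_bigr => A _.
under eq_big_nat => d /andP[_ db].
  rewrite (divnMDl A d b0) (divn_small db) addn0; over.
by rewrite -mulr_sumr sum_cell_children.
Qed.

(** A level m >= n resolves the point exactly: the average is 1 on the
    intervals to the right of the point and 0 on the others, and the cells
    telescope once more. *)
Lemma sum_ucell_levels n (tau : {ffun 'I_n -> 'I_b}) P k m y : (n <= m)%N ->
  \sum_(0 <= j < m.+1) \sum_(0 <= a < b ^ j) ucell b j (point_coord tau) a * cell b P k j a y =
  dyadic_primitive P k (y - point_coord tau) - dyadic_primitive P k (y - 1).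
Proof.
move=> nm; rewrite (@sum_levels _ (fun j a => ecell b j (point_coord tau) a))//.
pose N := (digit_value tau * b ^ (m - n))%N.
have Nb : (N <= b ^ m)%N.
  by rewrite /N -[in X in (_ <= X)%N](subnK nm) expnD mulnC leq_mul2l ltnW ?digit_value_lt ?orbT.
have zE : b%:R ^+ m * point_coord tau = N%:R + 0 :> R.
  rewrite addr0 /N natrM natrX /point_coord -[in LHS](subnK nm) exprD.
  by field; rewrite bnN.
have ze : point_coord tau = N%:R / b%:R ^+ m :> R
  by apply: (mulfI (bnN m)); rewrite zE addr0 mulrC divfK.
rewrite (eq_bigr (fun a => (N <= a)%N%:R * cell b P k m a y)); last first.
  move=> a _; rewrite (ecellE _ zE) ?lexx ?ltr01// subr0 mulr1.
  by case: ltngtP => //= _; rewrite ?addr0 ?add0r.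
rewrite (big_cat_nat (n := N))//= big_nat big1 ?add0r; last first.
  by move=> a /andP[_ aN]; rewrite leqNgt aN mul0r.
rewrite big_nat (eq_bigr (fun a => cell b P k m a y)); last by move=> a /andP[-> _]; rewrite mul1r.
by rewrite -big_nat sum_cell// ze natrX divff.
Qed.

(** The profile in y of the unit interval seen by bumps of width 2^-k; it
    dominates the linear moment and its approximations. *)
Definition spread (k : nat) y : R := atan (2 ^+ k * y) - atan (2 ^+ k * (y - 1)).

Lemma sum_atan_spread k j y :
  \sum_(0 <= a < b ^ j) (atan (2 ^+ k * (y - a%:R / b%:R ^+ j)) - atan (2 ^+ k * (y - a.+1%:R / b%:R ^+ j)))
   = spread k y.
Proof.
pose f a := - atan (2 ^+ k * (y - a%:R / b%:R ^+ j)) : R.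
rewrite (eq_bigr (fun a => f a.+1 - f a)); last by move=> a _; rewrite /f opprK addrC.
by rewrite telescope_sumr// /f opprK addrC natrX divff// mul0r subr0.
Qed.

Lemma spread_ge0 k y : 0 <= spread k y.
Proof.
have := increment_le_atan (M := 1) (s := 2 ^+ k) (u := y) (v := y - 1) (@has_deriv_cst R 0).
rewrite subrr normr0 mul1r; apply; last by rewrite gerBl.
by move=> t; rewrite mul1r divr_ge0 ?exprn_ge0// ltW// gt0_1Dsqr.
Qed.

Lemma spread_le k y : `|spread k y| <= pi.
Proof.
rewrite ger0_norm ?spread_ge0// /spread.
have := atan_ltpi2 (2 ^+ k * y); have := atan_gtNpi2 (2 ^+ k * (y - 1)).
lra.
Qed.

Lemma spread_cont k : continuous (spread k).
Proof.
have h := has_deriv_atan (2 ^+ k : R).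
have := has_deriv_cont (has_derivB h (has_deriv_lin 1 (-1) h)).
by under eq_fun do rewrite mul1r.
Qed.

(** The unit interval is cut into 2^k pieces, each of which contributes a bump
    of integral O(2^-k). *)
Lemma spread_integral k : (\int[mu]_y (`|spread k y|)%:E <= (3 * pi)%:E)%E.
Proof.
pose c i y : R := atan (2 ^+ k * (y - i%:R / 2 ^+ k)) - atan (2 ^+ k * (y - i.+1%:R / 2 ^+ k)).
have s0 : 0 < 2 ^+ k :> R by rewrite exprn_gt0.
have cc i : continuous (c i).
  have h := has_deriv_atan (2 ^+ k : R).
  have := has_deriv_cont (has_derivB (has_deriv_lin 1 (- (i%:R / 2 ^+ k)) h) (has_deriv_lin 1 (- (i.+1%:R / 2 ^+ k)) h)).
  by under eq_fun do rewrite !mul1r.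
have ce i y : y - i.+1%:R / 2 ^+ k = (y - i%:R / 2 ^+ k) - (2 ^+ k)^-1 :> R.
  by rewrite -natr1 mulrDl mul1r opprD addrA.
have ic i : (\int[mu]_y (`|c i y|)%:E <= (3 * pi / 2 ^+ k)%:E)%E.
  apply: (@integral_bump_le _ _ _ _ (i%:R / 2 ^+ k)) => //.
  move=> y; rewrite /c ce; set u := y - _.
  have := increment_le_local (M := 1) (s := 2 ^+ k) (u := u) (v := u - (2 ^+ k)^-1) (has_deriv_atan (2 ^+ k)).
  rewrite (_ : u - (u - (2 ^+ k)^-1) = (2 ^+ k)^-1); last by ring.
  rewrite mulfV ?gt_eqF// !mulr1; apply => //.
    by move=> t; rewrite mul1r ger0_norm// divr_ge0 ?(ltW s0) ?(ltW (gt0_1Dsqr _)).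
  by rewrite gerBl invr_ge0 (ltW s0).
have e y : spread k y = \sum_(0 <= i < 2 ^ k) c i y.
  pose f i := - atan (2 ^+ k * (y - i%:R / 2 ^+ k)) : R.
  rewrite (eq_bigr (fun i => f i.+1 - f i)); last by move=> i _; rewrite /f opprK addrC.
  by rewrite telescope_sumr// /f opprK addrC natrX divff ?gt_eqF// mul0r subr0.
have mc i : measurable_fun setT (fun y => (`|c i y|)%:E).
  by apply/measurable_EFinP/measurableT_comp => //; exact: continuous_measurable_fun.
apply: (@le_trans _ _ (\int[mu]_y (\sum_(0 <= i < 2 ^ k) (`|c i y|)%:E))%E).
  apply: ge0_le_integral => //.
  - apply/measurable_EFinP/measurableT_comp => //; apply: continuous_measurable_fun.
    exact: spread_cont.
  - by apply: emeasurable_sum => i; exact: mc.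
  - by move=> y _; rewrite sumEFin lee_fin e ler_norm_sum.
rewrite ge0_integral_sum//.
apply: (@le_trans _ _ (\sum_(0 <= i < 2 ^ k) (3 * pi / 2 ^+ k)%:E)%E).
  by apply: lee_sum => i _; exact: ic.
rewrite sumEFin sumr_const_nat subn0 -[_ *+ (2 ^ k)%N]mulr_natr natrX divfK ?gt_eqF//.
Qed.

Section good.
Variables (C : R) (kap P Pi : R -> R) (k : nat).
Hypotheses (gk : good_kernel C kap) (dP : has_deriv P kap).
Hypothesis (dPi : has_deriv Pi (dyadic_primitive P k)).

Let C0 : 0 <= C. Proof. by have [] := gk. Qed.

(** The integral over [0, 1] of t times the kernel at y - t, integrated by
    parts. *)
Definition linear_moment y : R := - dyadic_primitive P k (y - 1) + Pi y - Pi (y - 1).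

(** The same integral after t has been replaced by its averages on level m. *)
Definition linear_moment_approx m y : R :=
  \sum_(0 <= a < b ^ m) mcell b m a * cell b P k m a y.

Lemma sum_mucell_levels m y :
  \sum_(0 <= j < m.+1) \sum_(0 <= a < b ^ j) mucell b j a * cell b P k j a y =
  linear_moment_approx m y.
Proof. by apply: sum_levels. Qed.

Definition moment_primitive y t : R := - (t * dyadic_primitive P k (y - t)) - Pi (y - t).

Lemma moment_primitive_deriv y : has_deriv (moment_primitive y) (fun t => t * dyadic_kernel kap k (y - t)).
Proof.
have dp := dyadic_primitive_deriv k dP.
have h1 := has_derivN (has_derivM (@has_deriv_id R) (has_deriv_lin (-1) y dp)).
have h2 := has_deriv_lin (-1) y dPi.
have := has_derivB h1 h2.
have -> : (fun x : R => - (x * dyadic_primitive P k (-1 * x + y)) - Pi (-1 * x + y)) = moment_primitive y.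
  by apply/funext => t; rewrite /moment_primitive !mulN1r !(addrC _ y).
by apply: has_deriv_ext => t /=; rewrite !mulN1r !(addrC _ y); ring.
Qed.

(** On an interval of level m the function t and its average differ by at most
    b^-m. *)
Lemma linear_moment_approx_error m y :
  `|linear_moment y - linear_moment_approx m y| <= 3 * C * spread k y / b%:R ^+ m.
Proof.
have xN : (b ^ m)%N%:R / b%:R ^+ m = 1 :> R by rewrite natrX divff.
have -> : linear_moment y = \sum_(0 <= a < b ^ m) (moment_primitive y (a.+1%:R / b%:R ^+ m) - moment_primitive y (a%:R / b%:R ^+ m)).
  by rewrite telescope_sumr// xN !mul0r /moment_primitive /linear_moment subr0; ring.
rewrite /linear_moment_approx -sumrB -(sum_atan_spread k m) mulr_sumr mulr_suml.
apply: le_trans (ler_norm_sum _ _ _) _; apply: ler_sum => a _.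
have dp := dyadic_primitive_deriv k dP.
have h1 := has_derivD (moment_primitive_deriv y) (has_derivZ (mcell b m a) (has_deriv_lin (-1) y dp)).
have h2 := has_derivZ (- (3 * C / b%:R ^+ m)) (has_deriv_lin (-1) y (has_deriv_atan (2 ^+ k : R))).
have ax : a%:R / b%:R ^+ m <= a.+1%:R / b%:R ^+ m :> R.
  by rewrite ler_wpM2r ?invr_ge0 ?(ltW (bn0 _))// ler_nat.
have := le_increment h1 h2 (a := a%:R / b%:R ^+ m) (b := a.+1%:R / b%:R ^+ m) _ ax.
rewrite !mulN1r !(addrC _ y) /cell.
set p1 := dyadic_primitive P k _; set p2 := dyadic_primitive P k _.
set q1 := atan _; set q2 := atan _.
have -> : moment_primitive y (a.+1%:R / b%:R ^+ m) + mcell b m a * p1 - (moment_primitive y (a%:R / b%:R ^+ m) + mcell b m a * p2) =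
   moment_primitive y (a.+1%:R / b%:R ^+ m) - moment_primitive y (a%:R / b%:R ^+ m) - mcell b m a * (p2 - p1) by ring.
have -> : - (3 * C / b%:R ^+ m) * q1 - - (3 * C / b%:R ^+ m) * q2 = 3 * C * (q2 - q1) / b%:R ^+ m by ring.
apply => t /andP[at1 at2] /=.
rewrite !mulN1r !(addrC _ y).
have -> : t * dyadic_kernel kap k (y - t) + mcell b m a * - dyadic_kernel kap k (y - t) =
   (t - mcell b m a) * dyadic_kernel kap k (y - t) by ring.
rewrite mulrN mulNr opprK normrM.
have -> : 3 * C / b%:R ^+ m * (2 ^+ k / (1 + (2 ^+ k * (y - t)) ^+ 2)) =
  (b%:R ^+ m)^-1 * (3 * C * (2 ^+ k / (1 + (2 ^+ k * (y - t)) ^+ 2))) by ring.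
rewrite ler_pM// ?dyadic_kernel_le//.
have : a.+1%:R / b%:R ^+ m = a%:R / b%:R ^+ m + (b%:R ^+ m)^-1 :> R by rewrite -natr1 mulrDl mul1r.
have : mcell b m a = a%:R / b%:R ^+ m + (b%:R ^+ m)^-1 / 2 :> R by rewrite /mcell mulrDl (mulrC 2^-1).
have : 0 < (b%:R ^+ m)^-1 :> R by rewrite invr_gt0.
by move: at1 at2; rewrite ler_norml; lra.
Qed.

Lemma linear_moment_approx_le m y : `|linear_moment_approx m y| <= 3 * C * spread k y.
Proof.
rewrite -(sum_atan_spread k m) mulr_sumr; apply: le_trans (ler_norm_sum _ _ _) _.
rewrite !big_nat; apply: ler_sum => a /andP[_ ab]; rewrite normrM -[leRHS]mul1r ler_pM//.
  rewrite /mcell ger0_norm ?divr_ge0 ?addr_ge0 ?invr_ge0 ?(ltW (bn0 _))//.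
  rewrite ler_pdivrMr// mul1r -natrX.
  have : a.+1%:R <= (b ^ m)%N%:R :> R by rewrite ler_nat.
  by rewrite -natr1; lra.
exact: (cell_le_atan b_ge2 gk dP).
Qed.

Lemma linear_moment_le y : `|linear_moment y| <= 6 * C * spread k y.
Proof.
have h1 := linear_moment_approx_error 0 y; have h2 := linear_moment_approx_le 0 y.
rewrite expr0 divr1 in h1.
have -> : linear_moment y = (linear_moment y - linear_moment_approx 0 y) + linear_moment_approx 0 y by ring.
by rewrite (le_trans (ler_normD _ _))//; lra.
Qed.

Lemma linear_moment_cont : continuous linear_moment.
Proof.
have dp := dyadic_primitive_deriv k dP.
have h := has_derivB (has_derivD (has_derivN (has_deriv_lin 1 (-1) dp)) dPi) (has_deriv_lin 1 (-1) dPi).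
have := has_deriv_cont h.
by under eq_fun do rewrite !mul1r.
Qed.

Lemma linear_moment_approx_measurable m : measurable_fun setT (linear_moment_approx m).
Proof.
apply: measurable_sum => a; apply: measurable_funM; first exact: measurable_cst.
by apply: continuous_measurable_fun; exact: cell_cont dP.
Qed.

End good.

End Reconstruction.

(** * The smoothed discrepancy as a Haar series *)

Section SmoothedDiscrepancy.
Context {R : realType}.
Local Notation mu := (@lebesgue_measure R).
Local Notation plane := (@plane_measure R).
Implicit Types (kap P : R -> R) (C : R).

Lemma Lnorm_sum_le (I : Type) (r : seq I) (f : I -> R * R -> R) (p : R) : 1 <= p ->
  (forall i, measurable_fun setT (f i)) ->
  ('N[plane]_p%:E [EFin \o (fun y => (\sum_(i <- r) f i y)%R)] <=
     \sum_(i <- r) 'N[plane]_p%:E [EFin \o f i])%E.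
Proof.
move=> p1 mf; have p0 : 0 < p by exact: lt_le_trans p1.
elim: r => [|i r IH].
  rewrite big_nil (_ : EFin \o _ = cst 0%E); last by apply/funext => y; rewrite /= big_nil.
  by rewrite Lnorm0// eqe gt_eqF.
rewrite big_cons (_ : (fun y => _) = (f i \+ (fun y => \sum_(i <- r) f i y))); last first.
  by apply/funext => y; rewrite big_cons.
have mg : measurable_fun setT (fun y => \sum_(i <- r) f i y) by exact: measurable_sum.
have := @minkowski_EFin _ _ _ plane (f i) _ p (mf i) mg p1.
by move/le_trans; apply; rewrite leeD2l.
Qed.

Variables (b n : nat).
Hypothesis b_ge2 : (2 <= b)%N.
Variables (k1 k2 : nat) (C1 C2 : R) (kap1 P1 Pi1 kap2 P2 Pi2 : R -> R).
Hypotheses (gk1 : good_kernel C1 kap1) (dP1 : has_deriv P1 kap1).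
Hypotheses (gk2 : good_kernel C2 kap2) (dP2 : has_deriv P2 kap2).
Hypothesis (dPi1 : has_deriv Pi1 (dyadic_primitive P1 k1)).
Hypothesis (dPi2 : has_deriv Pi2 (dyadic_primitive P2 k2)).
Variable s : 'I_n -> 'I_b -> 'I_b.

Let b0 : (0 < b)%N. Proof. exact: leq_trans b_ge2. Qed.
Let bR0 : 0 < b%:R :> R. Proof. by rewrite ltr0n. Qed.
Let bn0 k : 0 < b%:R ^+ k :> R. Proof. by rewrite exprn_gt0. Qed.
Let C10 : 0 <= C1. Proof. by have [] := gk1. Qed.
Let C20 : 0 <= C2. Proof. by have [] := gk2. Qed.

(** The convolution of the discrepancy, extended by zero, with the product of
    two dyadic kernels. Subtracted primitives at y - 1 come from the right
    ends of the intervals ]z, 1[. *)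
Definition smoothed_discrepancy (y : R * R) : R :=
  (b%:R ^+ n)^-1 * \sum_(t : {ffun 'I_n -> 'I_b})
    (dyadic_primitive P1 k1 (y.1 - point_coord t) - dyadic_primitive P1 k1 (y.1 - 1)) *
    (dyadic_primitive P2 k2 (y.2 - point_coord (mirror s t)) - dyadic_primitive P2 k2 (y.2 - 1))
  - linear_moment P1 Pi1 k1 y.1 * linear_moment P2 Pi2 k2 y.2.

Definition haar_term (j1 j2 : nat) : R * R -> R :=
  tensor_sum (b ^ j1) (b ^ j2) (coef s j1 j2) (cell b P1 k1 j1) (cell b P2 k2 j2).

(** Finitely many levels resolve the points exactly, but the area part only in
    the limit. *)
Definition moment_error (m : nat) (y : R * R) : R :=
  linear_moment_approx b P1 k1 m y.1 * linear_moment_approx b P2 k2 m y.2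
  - linear_moment P1 Pi1 k1 y.1 * linear_moment P2 Pi2 k2 y.2.

Lemma smoothed_discrepancyE m y : (n <= m)%N ->
  smoothed_discrepancy y =
   \sum_(0 <= j1 < m.+1) \sum_(0 <= j2 < m.+1) haar_term j1 j2 y + moment_error m y.
Proof.
move=> nm; rewrite /smoothed_discrepancy /moment_error addrA; congr (_ - _).
rewrite -(sum_mucell_levels b_ge2 P1 k1 m y.1) -(sum_mucell_levels b_ge2 P2 k2 m y.2).
under eq_bigr do rewrite -!(sum_ucell_levels b_ge2 _ _ _ _ nm) big_distrlr/=.
rewrite big_distrlr/= exchange_big/= mulr_sumr -big_split/=; apply: eq_bigr => j1 _.
rewrite exchange_big/= mulr_sumr -big_split/=; apply: eq_bigr => j2 _.
under eq_bigr do rewrite big_distrlr/=.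
rewrite exchange_big/= mulr_sumr big_distrlr/= -big_split/=; apply: eq_bigr => a _.
rewrite exchange_big/= mulr_sumr -big_split/=; apply: eq_bigr => c _.
rewrite /coef !mulrBl -!mulrA.
have -> : mucell b j1 a * (mucell b j2 c * (cell b P1 k1 j1 a y.1 * cell b P2 k2 j2 c y.2)) =
 mucell b j1 a * (cell b P1 k1 j1 a y.1 * (mucell b j2 c * cell b P2 k2 j2 c y.2)) by ring.
rewrite subrK; congr (_ * _); rewrite mulr_suml; apply: eq_bigr => t _; ring.
Qed.

Lemma measurable_cell kap P k j a : has_deriv P kap -> measurable_fun setT (cell b P k j a).
Proof. by move=> dP; apply: continuous_measurable_fun; exact: cell_cont dP. Qed.

Lemma measurable_haar_term j1 j2 : measurable_fun setT (haar_term j1 j2).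
Proof. by apply: measurable_tensor_sum => a; exact: measurable_cell. Qed.

Lemma measurable_moment_error m : measurable_fun setT (moment_error m).
Proof.
apply: measurable_funB; apply: measurable_tensor.
- exact: (linear_moment_approx_measurable _ _ dP1).
- exact: (linear_moment_approx_measurable _ _ dP2).
- by apply: continuous_measurable_fun; exact: linear_moment_cont.
- by apply: continuous_measurable_fun; exact: linear_moment_cont.
Qed.

Lemma measurable_smoothed_discrepancy : measurable_fun setT smoothed_discrepancy.
Proof.
have -> : smoothed_discrepancy = (fun y => \sum_(0 <= j1 < n.+1) \sum_(0 <= j2 < n.+1) haar_term j1 j2 y + moment_error n y).
  by apply/funext => y; exact: smoothed_discrepancyE.
apply: measurable_funD; last exact: measurable_moment_error.
apply: measurable_sum => j1; apply: measurable_sum => j2; exact: measurable_haar_term.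
Qed.

Lemma moment_error_Lnorm p m : 1 <= p ->
  ('N[plane]_p%:E [EFin \o moment_error m] <=
    (27 * C1 * C2 * (3 * pi) ^+ 2 / b%:R ^+ m)%:E)%E.
Proof.
move=> p1; have pi0 : 0 <= pi :> R by exact: pi_ge0.
set A := _ / b%:R ^+ m.
have A0 : 0 <= A by rewrite /A !mulr_ge0 ?sqr_ge0// invr_ge0 ltW.
pose q y : R := 27 * C1 * C2 / b%:R ^+ m * (spread k1 y.1 * spread k2 y.2).
have q0 (y : R * R) : 0 <= spread k1 y.1 * spread k2 y.2 by rewrite mulr_ge0// spread_ge0.
have eq (y : R * R) : `|moment_error m y| <= q y.
  have e1 := linear_moment_approx_error b_ge2 gk1 dP1 dPi1 m y.1.
  have e2 := linear_moment_approx_error b_ge2 gk2 dP2 dPi2 m y.2.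
  have f1 := linear_moment_approx_le b_ge2 k1 gk1 dP1 m y.1.
  have f2 := linear_moment_le b_ge2 gk2 dP2 dPi2 y.2.
  have -> : moment_error m y = - ((linear_moment P1 Pi1 k1 y.1 - linear_moment_approx b P1 k1 m y.1) * linear_moment P2 Pi2 k2 y.2)
     - linear_moment_approx b P1 k1 m y.1 * (linear_moment P2 Pi2 k2 y.2 - linear_moment_approx b P2 k2 m y.2).
    by rewrite /moment_error; ring.
  rewrite (le_trans (ler_normB _ _))// normrN !normrM.
  have -> : q y = (3 * C1 * spread k1 y.1 / b%:R ^+ m) * (6 * C2 * spread k2 y.2) +
     (3 * C1 * spread k1 y.1) * (3 * C2 * spread k2 y.2 / b%:R ^+ m) by rewrite /q; ring.
  by rewrite lerD// ler_pM.
have AE : A = A `^ (1 - p^-1) * A `^ p^-1.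
  rewrite -powRD ?subrK ?powRr1//.
  by apply/implyP; rewrite oner_eq0.
rewrite [leRHS](_ : _ = (A `^ (1 - p^-1) * A `^ p^-1)%:E); last by rewrite -AE.
have AB : 27 * C1 * C2 / b%:R ^+ m * (3 * pi) ^+ 2 = A by rewrite /A; ring.
have c0 : 0 <= 27 * C1 * C2 / b%:R ^+ m by rewrite !mulr_ge0// invr_ge0 ltW.
apply: Lnorm_interpolation => //.
- exact: measurable_moment_error.
- move=> y; apply: le_trans (eq y) _; rewrite -AB /q ler_wpM2l// expr2.
  have sp k (x : R) : spread k x <= 3 * pi.
    apply: le_trans (ler_norm _) _; apply: le_trans (spread_le k x) _.
    by have := pi_ge0 R; lra.
  by rewrite ler_pM// spread_ge0.
- apply: (@le_trans _ _ (\int[plane]_y ((27 * C1 * C2 / b%:R ^+ m)%:E * (`|spread k1 y.1 * spread k2 y.2|)%:E))%E).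
    apply: ge0_le_integral => //.
    + by apply/measurable_EFinP/measurableT_comp => //; exact: measurable_moment_error.
    + under eq_fun do rewrite -EFinM.
      apply/measurable_EFinP; apply: measurable_funM; first exact: measurable_cst.
      apply: measurableT_comp => //; apply: measurable_tensor;
       apply: continuous_measurable_fun; exact: spread_cont.
    + by move=> y _; rewrite -EFinM lee_fin (ger0_norm (q0 y)); exact: eq.
  have ms : measurable_fun setT (fun y : R * R => (`|spread k1 y.1 * spread k2 y.2|)%:E).
    apply/measurable_EFinP/measurableT_comp => //; apply: measurable_tensor;
       apply: continuous_measurable_fun; exact: spread_cont.
  apply: (@le_trans _ _ ((27 * C1 * C2 / b%:R ^+ m)%:E * (\int[plane]_y (`|spread k1 y.1 * spread k2 y.2|)%:E))%E).
    rewrite le_eqVlt; apply/orP; left; apply/eqP; exact: ge0_integralZl.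
  rewrite integral_tensor_abs; [|by apply: continuous_measurable_fun; exact: spread_cont..].
  rewrite -AB [X in (_ <= X)%E]EFinM lee_wpmul2l ?lee_fin// expr2 EFinM.
  by apply: lee_pmul; rewrite ?integral_ge0 ?spread_integral.
Qed.

(** Interpolation between the factor min 1 u of the pointwise bound and the
    factor min u (1/u) of the L_1 bound. *)
Definition ratio_weight (p u : R) : R := Num.min 1 u `^ (1 - p^-1) * Num.min u u^-1 `^ p^-1.

(** The cells may be replaced by their modifications because the coefficients
    are Haar sequences in each index. *)
Lemma haar_term_Lnorm (p K1 K2 : R) j1 j2 (alpha beta : R) :
  (exists Q, dominated_cells b P1 k1 j1 K1 Q) -> (exists Q, dominated_cells b P2 k2 j2 K2 Q) ->
  0 <= K1 -> 0 <= K2 -> 1 <= p -> 0 <= alpha -> 0 <= beta ->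
  (forall a c, (a < b ^ j1)%N -> (c < b ^ j2)%N -> `|coef s j1 j2 a c| <= alpha) ->
  \sum_(0 <= a < b ^ j1) \sum_(0 <= c < b ^ j2) `|coef s j1 j2 a c| <= beta ->
  ('N[plane]_p%:E [EFin \o haar_term j1 j2] <=
    (K1 * K2 * (alpha `^ (1 - p^-1) * (beta / b%:R ^+ (j1 + j2)) `^ p^-1) *
      (ratio_weight p (scale_ratio b k1 j1) * ratio_weight p (scale_ratio b k2 j2)))%:E)%E.
Proof.
move=> [Q1 [cQ1 eQ1 sQ1 iQ1]] [Q2 [cQ2 eQ2 sQ2 iQ2]] K10 K20 p1 a0 be0 fa fb.
have e : haar_term j1 j2 = tensor_sum (b ^ j1) (b ^ j2) (coef s j1 j2) Q1 Q2.
  apply/funext => y; rewrite /haar_term /tensor_sum.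
  transitivity (\sum_(0 <= a < b ^ j1) \sum_(0 <= c < b ^ j2) coef s j1 j2 a c * cell b P1 k1 j1 a y.1 * Q2 c y.2).
    apply: eq_bigr => a _.
    under eq_bigr do rewrite mulrAC mulrC.
    under [RHS]eq_bigr do rewrite mulrAC mulrC.
    by rewrite -!mulr_sumr eQ2//; exact: coef_child_sum_right.
  rewrite exchange_big [RHS]exchange_big/=; apply: eq_bigr => c _.
  by rewrite -!mulr_suml eQ1//; exact: coef_child_sum_left.
rewrite e.
set u1 := scale_ratio b k1 j1; set u2 := scale_ratio b k2 j2.
have u10 : 0 < u1 by exact: scale_ratio_gt0.
have u20 : 0 < u2 by exact: scale_ratio_gt0.
have m1 (u : R) : 0 < u -> 0 <= Num.min 1 u by move=> u0; rewrite le_min ler01 ltW.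
have m2 (u : R) : 0 < u -> 0 <= Num.min u u^-1 by move=> u0; rewrite le_min invr_ge0 !(ltW u0).
have bi j : 0 <= (b%:R ^+ j)^-1 :> R by rewrite invr_ge0 ltW.
apply: (@le_trans _ _ ((alpha * (K1 * Num.min 1 u1 * (K2 * Num.min 1 u2))) `^ (1 - p^-1) *
   (beta * (K1 / b%:R ^+ j1 * Num.min u1 u1^-1 * (K2 / b%:R ^+ j2 * Num.min u2 u2^-1))) `^ p^-1)%:E).
  apply: tensor_sum_Lnorm_le => //; rewrite ?mulr_ge0 ?m1 ?m2//.
  - by move=> a; apply: continuous_measurable_fun.
  - by move=> a; apply: continuous_measurable_fun.
rewrite lee_fin le_eqVlt; apply/orP; left; apply/eqP.
have E1 (x y : R) : beta * (K1 / b%:R ^+ j1 * x * (K2 / b%:R ^+ j2 * y)) =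
  (K1 * K2) * ((beta / b%:R ^+ (j1 + j2)) * (x * y)) by rewrite exprD invfM; ring.
have E2 (x y : R) : alpha * (K1 * x * (K2 * y)) = (K1 * K2) * (alpha * (x * y)) by ring.
rewrite E1 E2.
rewrite (powRM _ (mulr_ge0 K10 K20)); last by rewrite !mulr_ge0 ?m1.
rewrite (powRM _ (mulr_ge0 K10 K20)); last by rewrite !mulr_ge0 ?m2.
rewrite (powRM _ a0); last by rewrite !mulr_ge0 ?m1.
rewrite (powRM _ (mulr_ge0 be0 (bi _))); last by rewrite !mulr_ge0 ?m2.
rewrite !powRM ?m1 ?m2//.
have KE : K1 * K2 = (K1 * K2) `^ (1 - p^-1) * (K1 * K2) `^ p^-1.
  rewrite -powRD ?subrK ?powRr1 ?mulr_ge0//.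
  by apply/implyP; rewrite oner_eq0.
rewrite [in RHS]KE (powRM (1 - p^-1) K10 K20) (powRM p^-1 K10 K20).
have E3 (x1 x2 x3 x4 x5 y1 y2 y3 y4 y5 : R) :
  x1 * x2 * (x3 * (x4 * x5)) * (y1 * y2 * (y3 * (y4 * y5))) =
  (x1 * x2) * (y1 * y2) * (x3 * y3) * ((x4 * y4) * (x5 * y5)) by ring.
exact: E3.
Qed.

End SmoothedDiscrepancy.

(** * Weights on levels and scales *)

Section GeometricSums.
Context {R : realType}.
Variable theta : R.
Hypotheses (theta_ge0 : 0 <= theta) (theta_lt1 : theta < 1).

Let d0 : 0 < 1 - theta. Proof. by rewrite subr_gt0. Qed.

Lemma sum_geometric_le N : \sum_(0 <= i < N) theta ^+ i <= (1 - theta)^-1.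
Proof.
have e : (1 - theta) * \sum_(i < N) theta ^+ i = 1 - theta ^+ N.
  by rewrite -opprB mulNr -subrX1 opprB.
rewrite big_mkord -(ler_pM2l d0) e divff ?gt_eqF// gerBl.
by rewrite exprn_ge0.
Qed.

(** The shift in the second condition lets the sum to the right of the peak
    start afresh with exponent 0. *)
Lemma sum_geometric_peak (w : nat -> R) m0 N : (forall i, 0 <= w i) ->
  (forall i, (i <= m0)%N -> w i <= theta ^+ (m0 - i)) ->
  (forall i, w (m0.+1 + i)%N <= theta ^+ i) ->
  \sum_(0 <= i < N) w i <= 2 / (1 - theta).
Proof.
move=> w0 wl wr.
apply: (@le_trans _ _ (\sum_(0 <= i < m0.+1 + N) w i)).
  rewrite (@big_cat_nat _ _ _ N 0 (m0.+1 + N))//=; last by rewrite leq_addl.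
  by rewrite lerDl sumr_ge0.
rewrite (@big_cat_nat _ _ _ m0.+1 0 (m0.+1 + N))//=; last by rewrite leq_addr.
rewrite mulrDl mul1r lerD//.
- apply: le_trans (sum_geometric_le m0.+1).
  rewrite [leRHS]big_nat_rev/= !big_nat; apply: ler_sum => i /andP[_ im].
  by rewrite add0n subSS wl.
- rewrite -{1}(add0n m0.+1) big_addn addKn.
  apply: le_trans (sum_geometric_le N).
  by apply: ler_sum => i _; rewrite addnC wr.
Qed.

(** The exponent is |l - n|, in truncated subtraction. *)
Definition level_weight (n l : nat) : R := theta ^+ ((l - n) + (n - l)).

Definition edge_weight (n j1 j2 : nat) : R :=
  (((j1 == 0%N) || (j2 == 0%N)) && (j1 + j2 <= n)%N)%:R.

Lemma theta_exp_le1 k : theta ^+ k <= 1.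
Proof. by rewrite exprn_ile1// ltW. Qed.

Lemma level_weight_ge0 n l : 0 <= level_weight n l.
Proof. exact: exprn_ge0. Qed.

(** A row j1 <= n contributes O(1), since j2 has to be close to n - j1, and
    the later rows decay geometrically. *)
Lemma sum_level_weight n N : (0 < n)%N ->
  \sum_(0 <= j1 < N) \sum_(0 <= j2 < N) level_weight n (j1 + j2) <=
    2 / (1 - theta) * (2 + (1 - theta)^-1) * n%:R.
Proof.
move=> n0; have n1 : 1 <= n%:R :> R by rewrite ler1n.
have g0 : 0 <= (1 - theta)^-1 by rewrite invr_ge0 ltW.
have inner j1 : \sum_(0 <= j2 < N) level_weight n (j1 + j2) <= 2 / (1 - theta) * theta ^+ (j1 - n).
  case: (leqP j1 n) => jn.
    rewrite (eqP jn) expr0 mulr1; apply: (@sum_geometric_peak _ (n - j1)) => [i|i im|i].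
    - exact: level_weight_ge0.
    - rewrite /level_weight (_ : (j1 + i - n + (n - (j1 + i)) = n - j1 - i)%N)//; lia.
    - rewrite /level_weight (_ : (_ + _ = i.+1)%N); last lia.
      by rewrite exprS ler_piMl ?exprn_ge0// ltW.
  apply: (@le_trans _ _ (\sum_(0 <= j2 < N) theta ^+ (j1 - n) * theta ^+ j2)).
    rewrite le_eqVlt; apply/orP; left; apply/eqP; apply: eq_bigr => j2 _.
    by rewrite /level_weight -exprD; congr (_ ^+ _); lia.
  rewrite -mulr_sumr [leRHS]mulrC ler_wpM2l ?exprn_ge0//.
  by apply: le_trans (sum_geometric_le N) _; rewrite ler_peMl// ler1n.
apply: le_trans (ler_sum _ (fun j1 _ => inner j1)) _.
rewrite -mulr_sumr -mulrA ler_wpM2l ?mulr_ge0//.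
apply: (@le_trans _ _ (\sum_(0 <= i < n.+1 + N) theta ^+ (i - n))).
  rewrite (@big_cat_nat _ _ _ N 0 (n.+1 + N))//=; last by rewrite leq_addl.
  by rewrite lerDl sumr_ge0// => i _; exact: exprn_ge0.
rewrite (@big_cat_nat _ _ _ n.+1 0 (n.+1 + N))//=; last by rewrite leq_addr.
rewrite mulrDl lerD//.
- apply: (@le_trans _ _ (\sum_(0 <= i < n.+1) 1)).
    by apply: ler_sum => i _; exact: theta_exp_le1.
  by rewrite big_mkord sumr_const card_ord -[n.+1%:R]natr1; lra.
- rewrite -{1}(add0n n.+1) big_addn addKn.
  apply: (@le_trans _ _ ((1 - theta)^-1)); last by rewrite ler_peMr.
  apply: le_trans (sum_geometric_le N).
  apply: ler_sum => i _; rewrite (_ : (i + n.+1 - n = i.+1)%N); last lia.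
  by rewrite exprS ler_piMl ?exprn_ge0// ltW.
Qed.

Lemma sum_edge_weight n N : (0 < n)%N ->
  \sum_(0 <= j1 < N) \sum_(0 <= j2 < N) edge_weight n j1 j2 <= 4 * n%:R.
Proof.
move=> n0; have n1 : 1 <= n%:R :> R by rewrite ler1n.
have s0 : \sum_(0 <= i < N) ((i == 0%N)%:R : R) <= 1.
  case: N => [|N]; first by rewrite big_nil.
  rewrite big_nat_recl//= big1 ?addr0//.
have sn : \sum_(0 <= i < N) ((i <= n)%N%:R : R) <= n.+1%:R.
  apply: (@le_trans _ _ (\sum_(0 <= i < n.+1 + N) ((i <= n)%N%:R : R))).
    rewrite (@big_cat_nat _ _ _ N 0 (n.+1 + N))//=; last by rewrite leq_addl.
    by rewrite lerDl sumr_ge0// => i _; exact: ler0n.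
  rewrite (@big_cat_nat _ _ _ n.+1 0 (n.+1 + N))//=; last by rewrite leq_addr.
  rewrite [X in _ + X]big_nat_cond [X in _ + X]big1 ?addr0.
    rewrite -[n.+1 in leRHS]card_ord -sumr_const big_mkord; apply: ler_sum => i _.
    by case: (_ <= _)%N.
  by move=> i /andP[/andP[h _] _]; rewrite leqNgt h.
have -> : 4 * n%:R = 2 * n%:R + 2 * n%:R :> R by ring.
have h2 : n.+1%:R <= 2 * n%:R :> R by rewrite -natr1; lra.
apply: (@le_trans _ _ (\sum_(0 <= j1 < N) \sum_(0 <= j2 < N)
    ((j1 == 0%N)%:R * (j2 <= n)%N%:R + (j1 <= n)%N%:R * (j2 == 0%N)%:R))).
  apply: ler_sum => j1 _; apply: ler_sum => j2 _.
  rewrite /edge_weight -!natrM -natrD ler_nat; lia.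
under eq_bigr do rewrite big_split/= -!mulr_sumr.
rewrite big_split/= -!mulr_suml.
have p0 (f : nat -> bool) : 0 <= \sum_(0 <= i < N) ((f i)%:R : R) by rewrite sumr_ge0.
rewrite lerD//.
- by rewrite -[leRHS]mul1r ler_pM// (le_trans sn).
- by rewrite -[leRHS]mulr1 ler_pM// (le_trans sn).
Qed.

End GeometricSums.

Section ScaleWeight.
Context {R : realType}.
Variables (b : nat) (del : R).
Hypotheses (b_ge2 : (2 <= b)%N) (del_gt0 : 0 < del).

Let b0 : (0 < b)%N. Proof. exact: leq_trans b_ge2. Qed.
Let bR0 : 0 < b%:R :> R. Proof. by rewrite ltr0n. Qed.

Definition decay : R := 2 `^ (- del).

Lemma decay_ge0 : 0 <= decay. Proof. exact: powR_ge0. Qed.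

Lemma decay_lt1 : decay < 1.
Proof.
rewrite /decay powRN invf_lt1 ?powR_gt0//.
rewrite -[X in X < _](_ : 1 `^ del = 1); last by rewrite powR1.
by rewrite gt0_ltr_powR ?nnegrE// ltr1n.
Qed.

(** Geometrically small away from 2^k = b^j, both in k and in j. *)
Definition scale_weight (k j : nat) : R :=
  Num.min (scale_ratio b k j) (scale_ratio b k j)^-1 `^ del.

Lemma scale_weight_ge0 k j : 0 <= scale_weight k j.
Proof. exact: powR_ge0. Qed.

Lemma scale_weight_decay k j i :
    scale_ratio b k j <= (2 ^+ i)^-1 :> R \/ (scale_ratio b k j)^-1 <= (2 ^+ i)^-1 :> R ->
  scale_weight k j <= decay ^+ i.
Proof.
move=> h.
have u0 : 0 < scale_ratio b k j :> R by exact: scale_ratio_gt0.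
have -> : decay ^+ i = ((2 ^+ i)^-1) `^ del.
  rewrite /decay -powR_mulrn ?powR_ge0// -powR_mulrn// -powRN -!powRrM.
  by congr (_ `^ _); ring.
rewrite /scale_weight ge0_ler_powR ?nnegrE ?(ltW del_gt0)//.
- by rewrite le_min invr_ge0 ltW.
- by rewrite ge_min; apply/orP.
Qed.

Lemma sum_scale_weight_k j N : \sum_(0 <= k < N) scale_weight k j <= 2 / (1 - decay).
Proof.
have bj : (0 < b ^ j)%N by rewrite expn_gt0 b0.
have := trunc_log_bounds (isT : (1 < 2)%N) bj; set m0 := trunc_log _ _ => /= /andP[lo hi].
have bjR : 0 < b%:R ^+ j :> R by rewrite exprn_gt0.
have e2 i : 0 < 2 ^+ i :> R by rewrite exprn_gt0.
apply: (sum_geometric_peak decay_ge0 decay_lt1 (m0 := m0)) => [i|i im|i].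
- exact: scale_weight_ge0.
- apply: scale_weight_decay; left; rewrite /scale_ratio ler_pdivrMr// mulrC ler_pdivlMr//.
  by rewrite -exprD subnKC// -!natrX ler_nat.
- apply: scale_weight_decay; right; rewrite /scale_ratio invf_div ler_pdivrMr// mulrC ler_pdivlMr//.
  rewrite -!natrX -natrM ler_nat (leq_trans (leq_mul (ltnW hi) (leqnn _)))//.
  by rewrite -expnD.
Qed.

Lemma sum_scale_weight_j k N : \sum_(0 <= j < N) scale_weight k j <= 2 / (1 - decay).
Proof.
have k0 : (0 < 2 ^ k)%N by rewrite expn_gt0.
have := trunc_log_bounds b_ge2 k0; set m0 := trunc_log _ _ => /= /andP[lo hi].
have e2 i : 0 < 2 ^+ i :> R by rewrite exprn_gt0.
have eb i : 0 < b%:R ^+ i :> R by rewrite exprn_gt0.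
have b2 i : (2 ^ i <= b ^ i)%N by case: i => // i; rewrite leq_exp2r.
apply: (sum_geometric_peak decay_ge0 decay_lt1 (m0 := m0)) => [i|i im|i].
- exact: scale_weight_ge0.
- apply: scale_weight_decay; right; rewrite /scale_ratio invf_div ler_pdivrMr// mulrC ler_pdivlMr//.
  rewrite -!natrX -natrM ler_nat (leq_trans _ lo)//.
  by rewrite -{2}(subnKC im) expnD leq_mul.
- apply: scale_weight_decay; left; rewrite /scale_ratio ler_pdivrMr// mulrC ler_pdivlMr//.
  rewrite -!natrX -natrM ler_nat expnD leq_mul// ltnW//.
Qed.

End ScaleWeight.

(** * Coefficient bounds in weighted form *)

Section DiscrepancySums.
Context {R : realType}.
Local Notation plane := (@plane_measure R).
Variables (b : nat) (p r c0 : R).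
Hypotheses (b_ge2 : (2 <= b)%N) (p_ge1 : 1 <= p) (r_ge0 : 0 <= r) (r_ltVp : r < p^-1).
Hypothesis c0_gt0 : 0 < c0.

Let b0 : (0 < b)%N. Proof. exact: leq_trans b_ge2. Qed.
Let bR0 : 0 < b%:R :> R. Proof. by rewrite ltr0n. Qed.
Let bR1 : 1 <= b%:R :> R. Proof. by rewrite ler1n. Qed.
Let bN0 : b%:R != 0 :> R. Proof. by rewrite gt_eqF. Qed.
Let bn0 k : 0 < b%:R ^+ k :> R. Proof. by rewrite exprn_gt0. Qed.
Let p0 : 0 < p. Proof. exact: lt_le_trans p_ge1. Qed.
Let Vp1 : p^-1 <= 1. Proof. by rewrite invf_le1. Qed.

(** The strict inequality r < 1/p is what makes all sums over frequencies and
    levels converge. *)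
Definition gap : R := p^-1 - r.
Let gap0 : 0 < gap. Proof. by rewrite subr_gt0. Qed.
Let gap1 : gap <= 1. Proof. by rewrite lerBlDr (le_trans Vp1)// lerDl. Qed.

(** For u <= 1 the exponent on the left is r + 1, at least 1/p - r; for u >= 1
    it is r - 1/p exactly. *)
Lemma powR_ratio_weight (u : R) : 0 < u ->
  u `^ r * ratio_weight p u <= Num.min u u^-1 `^ gap.
Proof.
move=> u0; have uV0 : 0 < u^-1 by rewrite invr_gt0.
rewrite /ratio_weight; case: (leP u 1) => u1.
  have uV : u <= u^-1 by rewrite (le_trans u1)// -[leLHS]invr1 lef_pV2 ?posrE.
  rewrite (min_idPl uV) -!powRD ?(gt_eqF u0)//; try by rewrite implybT.
  apply: ger_powR; first by rewrite u0.
  by rewrite subrK (le_trans gap1)// lerDr.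
have uV : u^-1 <= u by rewrite (le_trans _ (ltW u1))// -[leRHS]invr1 lef_pV2 ?posrE// ltW.
rewrite (min_idPr uV) powR1 mul1r.
rewrite -{1}(invrK u) -powR_inv1 ?(ltW uV0)// -powRrM mulN1r -powRD; last first.
  by rewrite (gt_eqF uV0) implybT.
by rewrite addrC.
Qed.

(** The weight 2^(r k) of the frequency is traded for b^(r j) of the level, at
    the price u^r. *)
Lemma ratio_weight_le k j :
  2 `^ (r * k%:R) * ratio_weight p (scale_ratio b k j) <=
  b%:R `^ (r * j%:R) * scale_weight b gap k j.
Proof.
have u0 : 0 < scale_ratio b k j :> R by exact: scale_ratio_gt0.
have -> : 2 `^ (r * k%:R) = b%:R `^ (r * j%:R) * scale_ratio b k j `^ r.
  rewrite ![r * _]mulrC !powRrM !powR_mulrn ?(ltW bR0)// -powRM ?(ltW u0) ?(ltW (bn0 _))//.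
  by rewrite /scale_ratio mulrC divfK ?gt_eqF.
by rewrite -mulrA ler_wpM2l ?powR_ge0// powR_ratio_weight.
Qed.

Lemma powR_decay e m : gap <= e -> b%:R `^ (- (e * m%:R)) <= decay gap ^+ m.
Proof.
move=> ge; rewrite /decay -powR_mulrn ?powR_ge0// -powRrM mulNr !powRN.
rewrite lef_pV2 ?posrE ?powR_gt0//.
apply: (@le_trans _ _ (b%:R `^ (gap * m%:R))).
  by rewrite ge0_ler_powR ?nnegrE ?mulr_ge0 ?(ltW gap0) ?(ltW bR0)// ler_nat.
by rewrite ler_powR// ler_wpM2r.
Qed.

Definition net_scale (n : nat) : R := b%:R `^ (n%:R * (r - 1)).

Definition pair_weight (n j1 j2 : nat) : R :=
  level_weight (decay gap) n (j1 + j2) + edge_weight n j1 j2.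

Definition coef_constant : R := 5 * b%:R ^+ 2 + 1 + b%:R * c0.

Lemma net_scale_gt0 n : 0 < net_scale n. Proof. exact: powR_gt0. Qed.

Lemma coef_constant_gt0 : 0 < coef_constant.
Proof. have h := mulr_gt0 bR0 c0_gt0; have := sqr_ge0 (b%:R : R); rewrite /coef_constant; lra. Qed.

Lemma pair_weight_ge0 n j1 j2 : 0 <= pair_weight n j1 j2.
Proof. by rewrite addr_ge0 ?ler0n// level_weight_ge0// decay_ge0. Qed.

Lemma pair_weight_le2 n j1 j2 : pair_weight n j1 j2 <= 2.
Proof.
rewrite (_ : 2 = 1 + 1)// lerD//.
  by apply: theta_exp_le1; [exact: decay_ge0|exact: decay_lt1].
by rewrite /edge_weight; case: (_ && _).
Qed.

Variables (n : nat) (s : 'I_n -> 'I_b -> 'I_b).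
Hypotheses (digit_s : digit_maps s) (balanced : `|2 * (num_id s)%:R - n%:R| <= c0).

Let invol : forall i, involutive (s i).
Proof. exact: (@digit_maps_involutive R _ _ b_ge2 _ digit_s). Qed.

(** The three regimes of the coefficients, in the form in which
    haar_term_Lnorm uses them. With X = b^(n (r-1)): for j1 + j2 > n
    interpolation leaves X b^(-(1/p - r)(j1 + j2 - n)); for positive levels
    with j1 + j2 <= n the result is X b^(-(1 + r)(n - j1 - j2)); and on the
    edges it is b^(r (j1 + j2) - n), at most X. *)
Lemma coef_level_bound j1 j2 : exists alpha beta : R,
  [/\ 0 <= alpha, 0 <= beta,
   forall a c, (a < b ^ j1)%N -> (c < b ^ j2)%N -> `|coef s j1 j2 a c| <= alpha,
   \sum_(0 <= a < b ^ j1) \sum_(0 <= c < b ^ j2) `|coef s j1 j2 a c| <= beta &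
   b%:R `^ (r * (j1 + j2)%:R) * (alpha `^ (1 - p^-1) * (beta / b%:R ^+ (j1 + j2)) `^ p^-1)
    <= coef_constant * net_scale n * pair_weight n j1 j2].
Proof.
have bp k : b%:R ^+ k = b%:R `^ k%:R :> R by rewrite powR_mulrn// ltW.
have bpV k : (b%:R ^+ k)^-1 = b%:R `^ (- k%:R) :> R by rewrite powRN bp.
have bD x y : b%:R `^ x * b%:R `^ y = b%:R `^ (x + y) :> R.
  by rewrite -powRD// bN0 implybT.
have Kc0 := coef_constant_gt0.
have B0 : 0 <= b%:R ^+ 2 :> R by exact: ltW.
have bc0 : 0 <= b%:R * c0 by rewrite mulr_ge0// ltW.
case: (ltnP n (j1 + j2)) => L.
  exists (5 * b%:R ^+ 2 / b%:R ^+ n), (5 * b%:R ^+ 2); split.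
  - by rewrite !mulr_ge0// invr_ge0 ltW.
  - by rewrite mulr_ge0.
  - by move=> a c ha hc; exact: coef_above.
  - exact: sum_coef_norm.
  set Z := 5 * b%:R ^+ 2; have Z0 : 0 <= Z by rewrite mulr_ge0.
  have ZK : Z <= coef_constant by rewrite /coef_constant /Z; lra.
  clearbody Z.
  rewrite !bpV !powRM ?powR_ge0// -!powRrM.
  have ZE : Z `^ (1 - p^-1) * Z `^ p^-1 = Z.
    rewrite -powRD ?subrK ?powRr1//.
    by apply/implyP; rewrite oner_eq0.
  set x1 := b%:R `^ _; set x2 := b%:R `^ _; set x3 := b%:R `^ _.
  have -> : x1 * (Z `^ (1 - p^-1) * x2 * (Z `^ p^-1 * x3)) = Z `^ (1 - p^-1) * Z `^ p^-1 * (x1 * x2 * x3) by ring.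
  rewrite ZE /x1 /x2 /x3 !bD.
  have -> : r * (j1 + j2)%:R + - n%:R * (1 - p^-1) + - (j1 + j2)%:R / p =
    n%:R * (r - 1) + - (gap * (j1 + j2 - n)%N%:R).
    by rewrite /gap natrB ?(ltnW L)//; ring.
  rewrite -bD -/(net_scale n) mulrA.
  apply: ler_pM; rewrite ?mulr_ge0 ?powR_ge0// ?(ltW (net_scale_gt0 _))//.
    by rewrite ler_wpM2r ?(ltW (net_scale_gt0 _))//.
  apply: le_trans (powR_decay _ (lexx _)) _.
  rewrite /pair_weight /level_weight (eqP (ltnW L)).
  by rewrite addn0 lerDl /edge_weight ler0n.
(* If j1 + j2 <= n the supremum suffices: there are b^(j1 + j2) coefficients,
   so beta is b^(j1 + j2) alpha and both factors of the interpolation are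
   equal. *)
suff [alpha [al0 al1 al2]] : exists alpha : R, [/\ 0 <= alpha,
   forall a c, (a < b ^ j1)%N -> (c < b ^ j2)%N -> `|coef s j1 j2 a c| <= alpha &
   b%:R `^ (r * (j1 + j2)%:R) * alpha <= coef_constant * net_scale n * pair_weight n j1 j2].
  exists alpha, (b%:R ^+ (j1 + j2) * alpha); split => //.
  - by rewrite mulr_ge0// ltW.
  - apply: (@le_trans _ _ (\sum_(0 <= a < b ^ j1) \sum_(0 <= c < b ^ j2) alpha)).
      rewrite !big_nat; apply: ler_sum => a /andP[_ ha].
      by rewrite !big_nat; apply: ler_sum => c /andP[_ hc]; exact: al1.
    rewrite !sumr_const_nat !subn0 -mulrnA -[leLHS]mulr_natl natrM !natrX exprD.
    by rewrite [X in X * _ <= _]mulrC.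
  rewrite [X in X `^ p^-1](_ : _ = alpha); last by rewrite mulrAC divff ?gt_eqF// mul1r.
  rewrite -powRD ?subrK ?powRr1//.
  by apply/implyP; rewrite oner_eq0.
have edge : ((j1 == 0%N) || (j2 == 0%N)) ->
  (forall a c, (a < b ^ j1)%N -> (c < b ^ j2)%N -> `|coef s j1 j2 a c| <= coef_constant / b%:R ^+ n) ->
  exists alpha : R, [/\ 0 <= alpha,
   forall a c, (a < b ^ j1)%N -> (c < b ^ j2)%N -> `|coef s j1 j2 a c| <= alpha &
   b%:R `^ (r * (j1 + j2)%:R) * alpha <= coef_constant * net_scale n * pair_weight n j1 j2].
  move=> je h; exists (coef_constant / b%:R ^+ n); split => //.
    by rewrite divr_ge0// ltW.
  rewrite bpV mulrCA bD -mulrA ler_wpM2l ?(ltW Kc0)//.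
  apply: (@le_trans _ _ (net_scale n)).
    rewrite ler_powR// mulrBr mulr1 lerD2r mulrC ler_wpM2r// ler_nat//.
  rewrite ler_peMr ?(ltW (net_scale_gt0 _))// /pair_weight /edge_weight je L.
  by rewrite lerDr level_weight_ge0// decay_ge0.
have wide (x : R) m : x <= coef_constant -> x / b%:R ^+ m <= coef_constant / b%:R ^+ m.
  by move=> h; rewrite ler_wpM2r// invr_ge0 ltW.
case: j1 j2 L edge => [|j1] [|j2] L edge.
- apply: edge => // a c; rewrite !expn0 !ltnS !leqn0 => /eqP-> /eqP->.
  apply: le_trans (coef_corner b_ge2 digit_s balanced) _.
  by apply: wide; rewrite /coef_constant; lra.
- apply: edge => // a c; rewrite expn0 !ltnS leqn0 => /eqP-> hc.
  apply: le_trans (coef_left_edge b_ge2 invol _ hc) _ => //.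
  by apply: wide; rewrite /coef_constant; lra.
- apply: edge => // a c ha; rewrite expn0 !ltnS leqn0 => /eqP->.
  apply: le_trans (coef_right_edge b_ge2 invol _ ha) _; first by move: L; rewrite addn0.
  by apply: wide; rewrite /coef_constant; lra.
exists (b%:R ^+ 2 * (b%:R ^+ (j1.+1 + j2.+1) / b%:R ^+ (2 * n))); split.
- by rewrite !mulr_ge0// ?invr_ge0 ltW.
- by move=> a c ha hc; exact: coef_below.
set l := (j1.+1 + j2.+1)%N in L *.
rewrite mulrCA bpV (bp l) !bD.
have -> : r * l%:R + (l%:R + - (2 * n)%N%:R) = n%:R * (r - 1) + - ((1 + r) * (n - l)%N%:R).
  by rewrite natrB// natrM; ring.
rewrite -bD -/(net_scale n) mulrA.
apply: ler_pM; rewrite ?mulr_ge0 ?powR_ge0// ?(ltW (net_scale_gt0 _))//.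
  by rewrite ler_wpM2r ?(ltW (net_scale_gt0 _))// /coef_constant; lra.
apply: le_trans (powR_decay _ _) _; first by rewrite (le_trans gap1)// lerDl.
rewrite /pair_weight /level_weight (eqP L).
by rewrite add0n lerDl /edge_weight ler0n.
Qed.

End DiscrepancySums.

(** * Weighted norms of the smoothed discrepancy *)

Section BesovSums.
Context {R : realType}.
Local Notation plane := (@plane_measure R).
Variables (b : nat) (p r c0 : R).
Hypotheses (b_ge2 : (2 <= b)%N) (p_ge1 : 1 <= p) (r_ge0 : 0 <= r) (r_ltVp : r < p^-1).
Hypothesis c0_gt0 : 0 < c0.
Variables (C1 C2 : R) (kap1 P1 kap2 P2 : R -> R) (Pi1 Pi2 : nat -> R -> R).
Hypotheses (gk1 : good_kernel C1 kap1) (dP1 : has_deriv P1 kap1).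
Hypotheses (gk2 : good_kernel C2 kap2) (dP2 : has_deriv P2 kap2).
Hypothesis (dPi1 : forall k, has_deriv (Pi1 k) (dyadic_primitive P1 k)).
Hypothesis (dPi2 : forall k, has_deriv (Pi2 k) (dyadic_primitive P2 k)).

Let b0 : (0 < b)%N. Proof. exact: leq_trans b_ge2. Qed.
Let bR0 : 0 < b%:R :> R. Proof. by rewrite ltr0n. Qed.
Let bn0 k : 0 < b%:R ^+ k :> R. Proof. by rewrite exprn_gt0. Qed.
Let gap0 : 0 < gap p r. Proof. by rewrite subr_gt0. Qed.

Local Notation om := (scale_weight b (gap p r)).

Definition smoothed n (s : 'I_n -> 'I_b -> 'I_b) k1 k2 : R * R -> R :=
  smoothed_discrepancy k1 k2 P1 (Pi1 k1) P2 (Pi2 k2) s.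

Lemma measurable_smoothed n (s : 'I_n -> 'I_b -> 'I_b) k1 k2 : measurable_fun setT (smoothed s k1 k2).
Proof. exact: (measurable_smoothed_discrepancy b_ge2 dP1 dP2). Qed.

Lemma haar_term_weighted : exists2 K : R, 0 < K & forall n (s : 'I_n -> 'I_b -> 'I_b),
  digit_maps s -> `|2 * (num_id s)%:R - n%:R| <= c0 -> forall k1 k2 j1 j2,
  ((2 `^ (r * (k1 + k2)%:R))%:E * 'N[plane]_p%:E [EFin \o haar_term k1 k2 P1 P2 s j1 j2]
    <= (K * net_scale b r n * (om k1 j1 * om k2 j2 * pair_weight p r n j1 j2))%:E)%E.
Proof.
have [K1 K10 D1] := dominated_cells_ex b_ge2 gk1 dP1.
have [K2 K20 D2] := dominated_cells_ex b_ge2 gk2 dP2.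
exists (K1 * K2 * coef_constant b c0).
  by rewrite !mulr_gt0//; exact: coef_constant_gt0.
move=> n s ds bal k1 k2 j1 j2.
have [alpha [beta [a0 be0 fa fb hb]]] := coef_level_bound b_ge2 p_ge1 r_ge0 r_ltVp c0_gt0 ds bal j1 j2.
have h := haar_term_Lnorm b_ge2 (D1 k1 j1) (D2 k2 j2) (ltW K10) (ltW K20) p_ge1 a0 be0 fa fb.
apply: le_trans (lee_wpmul2l _ h) _; first by rewrite lee_fin powR_ge0.
rewrite -EFinM lee_fin.
have w1 := ratio_weight_le b_ge2 p_ge1 r_ge0 k1 j1.
have w2 := ratio_weight_le b_ge2 p_ge1 r_ge0 k2 j2.
have -> : 2 `^ (r * (k1 + k2)%:R) = 2 `^ (r * k1%:R) * 2 `^ (r * k2%:R) :> R.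
  by rewrite -powRD ?pnatr_eq0 ?implybT// natrD mulrDr.
have hbE : b%:R `^ (r * (j1 + j2)%:R) = b%:R `^ (r * j1%:R) * b%:R `^ (r * j2%:R) :> R.
  by rewrite -powRD ?pnatr_eq0 ?(gtn_eqF b0) ?implybT// natrD mulrDr.
rewrite hbE in hb.
set D := alpha `^ _ * _ in hb *.
have D0 : 0 <= D by rewrite mulr_ge0// powR_ge0.
have rw0 k j : 0 <= ratio_weight p (scale_ratio b k j) by rewrite mulr_ge0// powR_ge0.
set x1 := ratio_weight _ _ in w1 *; set x2 := ratio_weight _ _ in w2 *.
have -> : 2 `^ (r * k1%:R) * 2 `^ (r * k2%:R) * (K1 * K2 * D * (x1 * x2)) =
  K1 * K2 * (D * ((2 `^ (r * k1%:R) * x1) * (2 `^ (r * k2%:R) * x2))) by ring.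
have -> : K1 * K2 * coef_constant b c0 * net_scale b r n * (om k1 j1 * om k2 j2 * pair_weight p r n j1 j2) =
  K1 * K2 * ((coef_constant b c0 * net_scale b r n * pair_weight p r n j1 j2) * (om k1 j1 * om k2 j2)) by ring.
rewrite ler_wpM2l ?mulr_ge0 ?(ltW K10) ?(ltW K20)//.
apply: (@le_trans _ _ (D * ((b%:R `^ (r * j1%:R) * om k1 j1) * (b%:R `^ (r * j2%:R) * om k2 j2)))).
  by rewrite ler_wpM2l// ler_pM// mulr_ge0 ?powR_ge0 ?rw0.
have -> : D * ((b%:R `^ (r * j1%:R) * om k1 j1) * (b%:R `^ (r * j2%:R) * om k2 j2)) =
  (b%:R `^ (r * j1%:R) * b%:R `^ (r * j2%:R) * D) * (om k1 j1 * om k2 j2) by ring.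
by rewrite ler_wpM2r// mulr_ge0// scale_weight_ge0.
Qed.

(** The error term is moment_error. Its constant E does not depend on the net,
    and it disappears as m tends to infinity once finitely many pairs (k1, k2)
    have been summed. *)
Lemma smoothed_Lnorm : exists2 K : R, 0 < K & exists E : nat -> nat -> R,
  forall n (s : 'I_n -> 'I_b -> 'I_b),
  digit_maps s -> `|2 * (num_id s)%:R - n%:R| <= c0 -> forall k1 k2 m, (n <= m)%N ->
  ((2 `^ (r * (k1 + k2)%:R))%:E * 'N[plane]_p%:E [EFin \o smoothed s k1 k2]
    <= (K * net_scale b r n * (\sum_(0 <= j1 < m.+1) \sum_(0 <= j2 < m.+1)
          om k1 j1 * om k2 j2 * pair_weight p r n j1 j2) + E k1 k2 / b%:R ^+ m)%:E)%E.
Proof.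
have [K K0 HK] := haar_term_weighted; exists K => //.
exists (fun k1 k2 => 2 `^ (r * (k1 + k2)%:R) * (27 * C1 * C2 * (3 * pi) ^+ 2)) => n s ds bal k1 k2 m nm.
set w : R := 2 `^ _; have w0 : 0 <= w by exact: powR_ge0.
have mh j1 j2 := measurable_haar_term k1 k2 dP1 dP2 s j1 j2.
have me := measurable_moment_error b dP1 dP2 (dPi1 k1) (dPi2 k2) m.
have he := moment_error_Lnorm b_ge2 gk1 dP1 gk2 dP2 (dPi1 k1) (dPi2 k2) m p_ge1.
pose S1 j1 y := \sum_(0 <= j2 < m.+1) haar_term k1 k2 P1 P2 s j1 j2 y.
have mS1 j1 : measurable_fun setT (S1 j1) by exact: measurable_sum.
have mS : measurable_fun setT (fun y => \sum_(0 <= j1 < m.+1) S1 j1 y) by exact: measurable_sum.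
have -> : smoothed s k1 k2 = (fun y => \sum_(0 <= j1 < m.+1) S1 j1 y) \+ moment_error b k1 k2 P1 (Pi1 k1) P2 (Pi2 k2) m.
  by apply/funext => y; rewrite /smoothed (smoothed_discrepancyE b_ge2 _ _ _ _ _ _ _ _ nm).
have h1 := @minkowski_EFin _ _ _ plane _ _ p mS me p_ge1.
apply: (@le_trans _ _ (w%:E * (\sum_(0 <= j1 < m.+1) \sum_(0 <= j2 < m.+1)
     'N[plane]_p%:E [EFin \o haar_term k1 k2 P1 P2 s j1 j2]) +
     w%:E * (27 * C1 * C2 * (3 * pi) ^+ 2 / b%:R ^+ m)%:E)%E).
  rewrite -muleDr//; last first.
    exact: fin_num_adde_defl.
  apply: lee_wpmul2l; first by rewrite lee_fin.
  apply: le_trans h1 _; apply: leeD => //.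
  apply: le_trans (Lnorm_sum_le _ p_ge1 mS1) _.
  by apply: lee_sum => j1 _; apply: le_trans (Lnorm_sum_le _ p_ge1 (mh j1)) _.
rewrite EFinD; apply: leeD; last by rewrite -EFinM lee_fin [leLHS]mulrA.
rewrite ge0_sume_distrr; last by move=> *; apply: sume_ge0 => *; exact: Lnorm_ge0.
rewrite mulr_sumr -sumEFin; apply: lee_sum => j1 _.
rewrite ge0_sume_distrr; last by move=> *; exact: Lnorm_ge0.
rewrite mulr_sumr -sumEFin; apply: lee_sum => j2 _.
exact: HK.
Qed.

Lemma sum_pair_weight_le n k1 k2 m :
  \sum_(0 <= j1 < m) \sum_(0 <= j2 < m) om k1 j1 * om k2 j2 * pair_weight p r n j1 j2 <=
  2 * (2 / (1 - decay (gap p r))) ^+ 2.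
Proof.
apply: (@le_trans _ _ (2 * \sum_(0 <= j1 < m) \sum_(0 <= j2 < m) om k1 j1 * om k2 j2)).
  rewrite mulr_sumr; apply: ler_sum => j1 _; rewrite mulr_sumr; apply: ler_sum => j2 _.
  by rewrite [leRHS]mulrC ler_wpM2l ?pair_weight_le2 ?mulr_ge0 ?scale_weight_ge0.
rewrite -big_distrlr/= ler_wpM2l// expr2.
by rewrite ler_pM ?sumr_ge0 ?sum_scale_weight_j// => i _; exact: scale_weight_ge0.
Qed.

Lemma sum_sum_pair_weight_le n N m : (0 < n)%N ->
  \sum_(0 <= k1 < N) \sum_(0 <= k2 < N)
    \sum_(0 <= j1 < m) \sum_(0 <= j2 < m) om k1 j1 * om k2 j2 * pair_weight p r n j1 j2 <=
  (2 / (1 - decay (gap p r))) ^+ 2 *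
   (2 / (1 - decay (gap p r)) * (2 + (1 - decay (gap p r))^-1) + 4) * n%:R.
Proof.
move=> n0; set G := 2 / _; set H := _^-1.
apply: (@le_trans _ _ (\sum_(0 <= j1 < m) \sum_(0 <= j2 < m) G ^+ 2 * pair_weight p r n j1 j2)).
  under eq_bigr do rewrite exchange_big/=.
  rewrite exchange_big/=; apply: ler_sum => j1 _.
  under eq_bigr do rewrite exchange_big/=.
  rewrite exchange_big/=; apply: ler_sum => j2 _.
  under eq_bigr do rewrite -mulr_suml.
  rewrite -mulr_suml ler_wpM2r ?pair_weight_ge0// -big_distrlr/= expr2.
  by rewrite ler_pM ?sumr_ge0 ?sum_scale_weight_k// => i _; exact: scale_weight_ge0.
under eq_bigr do rewrite -mulr_sumr.
rewrite -mulr_sumr -mulrA ler_wpM2l ?sqr_ge0//.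
under eq_bigr do rewrite big_split/=.
rewrite big_split/= mulrDl lerD//.
- by apply: sum_level_weight => //; [exact: decay_ge0|exact: decay_lt1].
- by apply: (@sum_edge_weight _ (decay (gap p r))) => //; [exact: decay_ge0|exact: decay_lt1].
Qed.

Lemma le_of_geometric_error (a : \bar R) (A E : R) n :
  (forall m, (n <= m)%N -> (a <= (A + E / b%:R ^+ m)%:E)%E) -> (a <= A%:E)%E.
Proof.
move=> h; apply/lee_addgt0Pr => e e0.
have HN := ltW (truncnS_gt (`|E| / e)); set N := (_.+1) in HN.
have nN : (n <= n + N)%N by rewrite leq_addr.
apply: le_trans (h _ nN) _; rewrite -EFinD lee_fin lerD2l.
rewrite ler_pdivrMr// (le_trans (ler_norm _))// mulrC -ler_pdivrMr// (le_trans HN)//.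
by rewrite -natrX ler_nat (leq_trans (leq_addl n N))// ltnW// ltn_expl.
Qed.

(** For one pair (k1, k2) the pair weights are bounded and scale weights are
    summed over levels; for the sum, scale weights are summed over frequencies
    and the pair weights, of total mass O(n), over levels. *)
Lemma smoothed_besov_sums : exists2 K : R, 0 < K & forall n (s : 'I_n -> 'I_b -> 'I_b),
  (0 < n)%N -> digit_maps s -> `|2 * (num_id s)%:R - n%:R| <= c0 ->
  let a k1 k2 := ((2 `^ (r * (k1 + k2)%:R))%:E * 'N[plane]_p%:E [EFin \o smoothed s k1 k2])%E in
  (forall k1 k2, (a k1 k2 <= (K * net_scale b r n)%:E)%E) /\
  (forall N, (\sum_(0 <= k1 < N) \sum_(0 <= k2 < N) a k1 k2 <= (K * net_scale b r n * n%:R)%:E)%E).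
Proof.
have [K K0 [E HE]] := smoothed_Lnorm.
set th := decay (gap p r).
have th1 : 0 < 1 - th by rewrite subr_gt0 decay_lt1.
have V0 : 0 < (1 - th)^-1 by rewrite invr_gt0.
pose A1 := 2 * (2 / (1 - th)) ^+ 2.
pose A2 := (2 / (1 - th)) ^+ 2 * (2 / (1 - th) * (2 + (1 - th)^-1) + 4).
have A10 : 0 < A1 by rewrite !mulr_gt0.
have A20 : 0 < A2 by rewrite !(mulr_gt0, addr_gt0).
exists (K * (A1 + A2)) => [|n s n0 ds bal a]; first by rewrite mulr_gt0// addr_gt0.
have X0 := net_scale_gt0 r b_ge2 n.
split.
- move=> k1 k2; apply: (@le_of_geometric_error _ _ (E k1 k2) n) => m nm.
  apply: le_trans (HE _ _ ds bal k1 k2 m nm) _; rewrite lee_fin lerD2r.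
  apply: (@le_trans _ _ (K * net_scale b r n * A1)).
    by rewrite ler_wpM2l ?sum_pair_weight_le// mulr_ge0 ?ltW.
  by rewrite mulrAC ler_wpM2r ?(ltW X0)// ler_wpM2l ?(ltW K0)// lerDl ltW.
- move=> N; apply: (@le_of_geometric_error _ _ (\sum_(0 <= k1 < N) \sum_(0 <= k2 < N) E k1 k2) n) => m nm.
  apply: (@le_trans _ _ (\sum_(0 <= k1 < N) \sum_(0 <= k2 < N)
     (K * net_scale b r n * (\sum_(0 <= j1 < m.+1) \sum_(0 <= j2 < m.+1)
          om k1 j1 * om k2 j2 * pair_weight p r n j1 j2) + E k1 k2 / b%:R ^+ m)%:E)%E).
    by apply: lee_sum => k1 _; apply: lee_sum => k2 _; exact: HE.
  under eq_bigr do rewrite sumEFin.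
  rewrite sumEFin lee_fin.
  under eq_bigr do rewrite big_split/= -mulr_sumr -mulr_suml.
  rewrite big_split/= -mulr_sumr -mulr_suml lerD2r.
  apply: (@le_trans _ _ (K * net_scale b r n * (A2 * n%:R))).
    by rewrite ler_wpM2l ?sum_sum_pair_weight_le// mulr_ge0 ?ltW.
  rewrite mulrA ler_wpM2r// mulrAC ler_wpM2r ?(ltW X0)// ler_wpM2l ?(ltW K0)//.
  by rewrite lerDr ltW.
Qed.

End BesovSums.

(** * Integrals of complex functions *)

Local Open Scope complex_scope.
Local Notation Re := (@complex.Re _).
Local Notation Im := (@complex.Im _).
Local Notation normc := (@Normc.normc _).

Section ComplexFunctions.
Context {R : realType}.
Implicit Types (z w : R[i]).

Lemma complex_ext z w : Re z = Re w -> Im z = Im w -> z = w.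
Proof. by case: z w => [a b] [c d] /= -> ->. Qed.

Lemma cReM z w : Re (z * w) = Re z * Re w - Im z * Im w.
Proof. by case: z w => [a b] [c d]. Qed.

Lemma cImM z w : Im (z * w) = Re z * Im w + Im z * Re w.
Proof. by case: z w => [a b] [c d] /=. Qed.

Lemma cnorm_ge_Re z : `|Re z| <= normc z.
Proof.
case: z => a b /=; rewrite -[leLHS]ger0_norm// -sqrtr_sqr real_normK ?num_real//.
by rewrite ler_wsqrtr// lerDl sqr_ge0.
Qed.

Lemma cnorm_ge_Im z : `|Im z| <= normc z.
Proof.
case: z => a b /=; rewrite -[leLHS]ger0_norm// -sqrtr_sqr real_normK ?num_real//.
by rewrite ler_wsqrtr// lerDr sqr_ge0.
Qed.

Lemma cnorm_le z : normc z <= `|Re z| + `|Im z|.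
Proof.
case: z => a b /=; rewrite -[leRHS]ger0_norm ?addr_ge0// -sqrtr_sqr ler_wsqrtr//.
rewrite sqrrD !real_normK ?num_real// lerD2r lerDl.
by rewrite mulrn_wge0// mulr_ge0.
Qed.

Lemma cnorm_ge0 z : 0 <= normc z.
Proof. exact: le_trans (normr_ge0 _) (cnorm_ge_Re z). Qed.

Lemma cnorm_expi (t : R) : normc (expi t) = 1.
Proof. by rewrite /expi/= cos2Dsin2 sqrtr1. Qed.

Lemma expiD (s t : R) : expi (s + t) = expi s * expi t.
Proof.
apply: complex_ext; rewrite ?cReM ?cImM /expi/= ?cosD ?sinD//.
by rewrite addrC; congr (_ + _); rewrite mulrC.
Qed.

Context d {T : measurableType d}.
Implicit Types (f g : T -> R[i]).

Definition cmeasurable f :=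
  measurable_fun setT (fun x => Re (f x)) /\ measurable_fun setT (fun x => Im (f x)).

Lemma cmeasurableM f g : cmeasurable f -> cmeasurable g -> cmeasurable (fun x => f x * g x).
Proof.
move=> [f1 f2] [g1 g2]; split.
  by under eq_fun do rewrite cReM; apply: measurable_funB; exact: measurable_funM.
by under eq_fun do rewrite cImM; apply: measurable_funD; exact: measurable_funM.
Qed.

Lemma cmeasurable_real (f : T -> R) : measurable_fun setT f -> cmeasurable (fun x => (f x)%:C).
Proof. by move=> mf; split => //=; exact: measurable_cst. Qed.

Lemma cmeasurable_expi (f : T -> R) : measurable_fun setT f -> cmeasurable (fun x => expi (f x)).
Proof.
move=> mf; split; rewrite /=; apply: measurableT_comp => //; apply: continuous_measurable_fun.
- exact: continuous_cos.
- exact: continuous_sin.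
Qed.

End ComplexFunctions.

Lemma cmeasurable_comp {R : realType} d d' (T : measurableType d) (T' : measurableType d')
    (f : T -> R[i]) (g : T' -> T) :
  cmeasurable f -> measurable_fun setT g -> cmeasurable (fun x => f (g x)).
Proof. by move=> [f1 f2] mg; split; [exact: (measurableT_comp f1)|exact: (measurableT_comp f2)]. Qed.

Section ComplexIntegral.
Context {R : realType} d (T : measurableType d) (mu : {measure set T -> \bar R}).
Implicit Types (f g : T -> R[i]).

Definition cint f : R[i] := (\int[mu]_x Re (f x)) +i* (\int[mu]_x Im (f x)).

Definition cint_finite f :=
  mu.-integrable setT (EFin \o (fun x => Re (f x))) /\ mu.-integrable setT (EFin \o (fun x => Im (f x))).

Lemma integrable_dominated (f a : T -> R) : measurable_fun setT f ->
  mu.-integrable setT (EFin \o a) -> (forall x, `|f x| <= a x) -> mu.-integrable setT (EFin \o f).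
Proof.
move=> mf ia fa; apply: le_integrable ia => //; first exact/measurable_EFinP.
move=> x _; rewrite /= lee_fin (le_trans (fa x))//.
exact: ler_norm.
Qed.

Lemma cint_finite_dominated f (a : T -> R) : cmeasurable f ->
  mu.-integrable setT (EFin \o a) -> (forall x, normc (f x) <= a x) -> cint_finite f.
Proof.
move=> [f1 f2] ia fa; split; apply: integrable_dominated ia _ => // x.
- exact: le_trans (cnorm_ge_Re _) (fa x).
- exact: le_trans (cnorm_ge_Im _) (fa x).
Qed.

Lemma integral_fin_num (f : T -> \bar R) :
  mu.-integrable setT f -> (\int[mu]_x f x)%E \is a fin_num.
Proof.
by move=> i; rewrite integralE fin_numB integrable_pos_fin_num// integrable_neg_fin_num.
Qed.

Lemma integrable_scale (c : R) (f : T -> R) :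
  mu.-integrable setT (EFin \o f) -> mu.-integrable setT (EFin \o (fun x => c * f x)).
Proof.
move=> i; have := integrableZl measurableT c i.
by apply: eq_integrable.
Qed.

Lemma cintZ (c : R[i]) f : cint_finite f -> cint (fun x => c * f x) = c * cint f.
Proof.
move=> [i1 i2]; apply: complex_ext; rewrite /cint ?cReM ?cImM /=.
- under eq_Rintegral do rewrite cReM.
  rewrite RintegralB ?RintegralZl//; exact: integrable_scale.
- under eq_Rintegral do rewrite cImM.
  rewrite RintegralD ?RintegralZl//; exact: integrable_scale.
Qed.

Lemma cintD f g : cint_finite f -> cint_finite g -> cint (fun x => f x + g x) = cint f + cint g.
Proof.
move=> [i1 i2] [j1 j2]; apply: complex_ext; rewrite /cint /=.
- by rewrite -RintegralD//; apply: eq_Rintegral => x _; case: (f x) (g x) => [a b] [c e].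
- by rewrite -RintegralD//; apply: eq_Rintegral => x _; case: (f x) (g x) => [a b] [c e].
Qed.

Lemma cint_finiteZ (c : R[i]) f : cint_finite f -> cint_finite (fun x => c * f x).
Proof.
move=> [i1 i2]; split.
- under [X in EFin \o X]eq_fun do rewrite cReM.
  exact: (integrableB measurableT (integrable_scale _ i1) (integrable_scale _ i2)).
- under [X in EFin \o X]eq_fun do rewrite cImM.
  exact: (integrableD measurableT (integrable_scale _ i2) (integrable_scale _ i1)).
Qed.

Lemma cint_finiteD f g : cint_finite f -> cint_finite g -> cint_finite (fun x => f x + g x).
Proof.
move=> [i1 i2] [j1 j2]; split.
- rewrite (_ : (fun x => Re _) = (fun x => Re (f x) + Re (g x))).
    exact: (integrableD measurableT i1 j1).
  by apply/funext => x; case: (f x) (g x) => [a b] [c e].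
- rewrite (_ : (fun x => Im _) = (fun x => Im (f x) + Im (g x))).
    exact: (integrableD measurableT i2 j2).
  by apply/funext => x; case: (f x) (g x) => [a b] [c e].
Qed.

End ComplexIntegral.

Section ComplexFubini.
Context {R : realType} d1 d2 (T1 : measurableType d1) (T2 : measurableType d2).
Context (m1 : {sigma_finite_measure set T1 -> \bar R}) (m2 : {sigma_finite_measure set T2 -> \bar R}).

Lemma integrable_tensor_dominated (F : T1 * T2 -> R) (a : T1 -> R) (b : T2 -> R) :
  measurable_fun setT F ->
  m1.-integrable setT (EFin \o a) -> m2.-integrable setT (EFin \o b) ->
  (forall x y, `|F (x, y)| <= a x * b y) -> (m1 \x m2)%E.-integrable setT (EFin \o F).
Proof.
move=> mF ia ib ab; apply/integrable12ltyP; first exact/measurable_EFinP.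
have [ma la] := integrableP _ _ _ ia; have [mb lb] := integrableP _ _ _ ib.
have mae : measurable_fun setT (fun x => (`|a x|)%:E).
  by apply/measurable_EFinP/measurableT_comp => //; exact/measurable_EFinP.
have mbe : measurable_fun setT (fun x => (`|b x|)%:E).
  by apply/measurable_EFinP/measurableT_comp => //; exact/measurable_EFinP.
have lb' : (\int[m2]_y (`|b y|)%:E)%E \is a fin_num.
  by rewrite ge0_fin_numE// integral_ge0.
apply: (@le_lt_trans _ _ (\int[m1]_x ((`|a x|)%:E * \int[m2]_y (`|b y|)%:E))%E).
  apply: ge0_le_integral => //.
  - by move=> x _; exact: integral_ge0.
  - have mf : measurable_fun setT (fun z => (`|(EFin \o F) z|)%E).
      by apply: measurableT_comp => //; exact/measurable_EFinP.
    by apply: (measurable_fun_fubini_tonelli_F _ mf) => x; exact: abse_ge0.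
  - apply: emeasurable_funM => //.
  - move=> x _; rewrite -ge0_integralZl//.
    apply: ge0_le_integral => //.
    + apply: measurableT_comp => //; apply/measurable_EFinP.
      exact: (measurableT_comp mF (pair1_measurable x)).
    + by apply: emeasurable_funM.
    + move=> y _; rewrite /= -EFinM lee_fin -normrM (le_trans (ab x y))//.
      exact: ler_norm.
rewrite -(fineK lb') ge0_integralZr//; last by rewrite lee_fin fine_ge0// integral_ge0.
by rewrite lte_mul_pinfty// ?integral_ge0// ?ge0_fin_numE ?integral_ge0// ?fineK.
Qed.

Lemma Rintegral_swap (F : T1 * T2 -> R) (a : T1 -> R) (b : T2 -> R) :
  measurable_fun setT F ->
  m1.-integrable setT (EFin \o a) -> m2.-integrable setT (EFin \o b) ->
  (forall x y, `|F (x, y)| <= a x * b y) ->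
  \int[m1]_x \int[m2]_y F (x, y) = \int[m2]_y \int[m1]_x F (x, y).
Proof.
move=> mF ia ib ab; have iF := integrable_tensor_dominated mF ia ib ab.
have i2 x : m2.-integrable setT (EFin \o (fun y => F (x, y))).
  apply: (@integrable_dominated _ _ _ _ _ (fun y => a x * b y)) => //.
    exact: (measurableT_comp mF (pair1_measurable x)).
  exact: integrable_scale.
have i1 y : m1.-integrable setT (EFin \o (fun x => F (x, y))).
  apply: (@integrable_dominated _ _ _ _ _ (fun x => a x * b y)) => //.
    exact: (measurableT_comp mF (pair2_measurable y)).
  by under [X in EFin \o X]eq_fun do rewrite mulrC; exact: integrable_scale.
have := Fubini iF.
rewrite /Rintegral => e; congr fine.
transitivity (\int[m1]_x \int[m2]_y (F (x, y))%:E)%E.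
  apply: eq_integral => x _; rewrite fineK//; exact: integral_fin_num (i2 x).
rewrite e; apply: eq_integral => y _; rewrite fineK//; exact: integral_fin_num (i1 y).
Qed.

(** The majorant is a product, so that integrability on the product space is
    immediate. *)
Lemma cint_swap (F : T1 * T2 -> R[i]) (a : T1 -> R) (b : T2 -> R) :
  cmeasurable F ->
  m1.-integrable setT (EFin \o a) -> m2.-integrable setT (EFin \o b) ->
  (forall x y, normc (F (x, y)) <= a x * b y) ->
  cint m1 (fun x => cint m2 (fun y => F (x, y))) = cint m2 (fun y => cint m1 (fun x => F (x, y))).
Proof.
move=> [mr mi] ia ib ab; rewrite /cint /=; congr (_ +i* _).
- apply: (Rintegral_swap mr ia ib) => x y; exact: le_trans (cnorm_ge_Re _) (ab x y).
- apply: (Rintegral_swap mi ia ib) => x y; exact: le_trans (cnorm_ge_Im _) (ab x y).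
Qed.

Lemma cint_finite_inner (F : T1 * T2 -> R[i]) (a : T1 -> R) (b : T2 -> R) :
  cmeasurable F ->
  m1.-integrable setT (EFin \o a) -> m2.-integrable setT (EFin \o b) ->
  (forall x y, normc (F (x, y)) <= a x * b y) ->
  cint_finite m1 (fun x => cint m2 (fun y => F (x, y))).
Proof.
move=> [mr mi] ia ib ab.
have main (f : T1 * T2 -> R) : measurable_fun setT f -> (forall x y, `|f (x, y)| <= a x * b y) ->
    m1.-integrable setT (EFin \o (fun x => \int[m2]_y f (x, y))).
  move=> mf fab; have := integrable_fubini_F (integrable_tensor_dominated mf ia ib fab).
  rewrite /fubini_F /=; apply: eq_integrable => // x _ /=; rewrite /Rintegral fineK//.
  suff h : m2.-integrable setT (EFin \o (fun y => f (x, y))) by exact: integral_fin_num h.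
  apply: (@integrable_dominated _ _ _ _ _ (fun y => a x * b y)) => //.
    exact: (measurableT_comp mf (pair1_measurable x)).
  exact: integrable_scale.
split.
- apply: (main _ mr) => x y; exact: le_trans (cnorm_ge_Re _) (ab x y).
- apply: (main _ mi) => x y; exact: le_trans (cnorm_ge_Im _) (ab x y).
Qed.

Lemma Rintegral_tensor (P : T1 -> R) (Q : T2 -> R) :
  m1.-integrable setT (EFin \o P) -> m2.-integrable setT (EFin \o Q) ->
  \int[(m1 \x m2)%E]_z (P z.1 * Q z.2) = (\int[m1]_x P x) * (\int[m2]_y Q y).
Proof.
move=> iP iQ.
have mP : measurable_fun setT P by apply/measurable_EFinP; exact: measurable_int iP.
have mQ : measurable_fun setT Q by apply/measurable_EFinP; exact: measurable_int iQ.
have iA : m1.-integrable setT (EFin \o (fun x => `|P x|)) by exact: integrable_abse iP.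
have iB : m2.-integrable setT (EFin \o (fun x => `|Q x|)) by exact: integrable_abse iQ.
have mF : measurable_fun setT (fun z : T1 * T2 => P z.1 * Q z.2).
  by apply: measurable_funM; [apply: (measurableT_comp mP); exact: measurable_fst|
    apply: (measurableT_comp mQ); exact: measurable_snd].
have iF : (m1 \x m2)%E.-integrable setT (EFin \o (fun z : T1 * T2 => P z.1 * Q z.2)).
  by apply: (integrable_tensor_dominated mF iA iB) => x y /=; rewrite normrM.
rewrite /Rintegral -(integral12_prod_meas1 iF) /fubini_F /=.
transitivity (fine (\int[m1]_x ((\int[m2]_y Q y)%:E * (P x)%:E)%E)).
  congr fine; apply: eq_integral => x _.
  under eq_integral do rewrite EFinM.
  rewrite integralZl// muleC /Rintegral fineK//; exact: integral_fin_num iQ.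
rewrite integralZl// fineM//; first by rewrite mulrC.
exact: integral_fin_num iP.
Qed.

Lemma integrable_tensor (P : T1 -> R) (Q : T2 -> R) :
  m1.-integrable setT (EFin \o P) -> m2.-integrable setT (EFin \o Q) ->
  (m1 \x m2)%E.-integrable setT (EFin \o (fun z : T1 * T2 => P z.1 * Q z.2)).
Proof.
move=> iP iQ.
have mP : measurable_fun setT P by apply/measurable_EFinP; exact: measurable_int iP.
have mQ : measurable_fun setT Q by apply/measurable_EFinP; exact: measurable_int iQ.
apply: (@integrable_tensor_dominated _ (fun x => `|P x|) (fun x => `|Q x|)).
- by apply: measurable_funM; [apply: (measurableT_comp mP); exact: measurable_fst|
    apply: (measurableT_comp mQ); exact: measurable_snd].
- exact: integrable_abse iP.
- exact: integrable_abse iQ.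
- by move=> x y /=; rewrite normrM.
Qed.

Lemma cint_finite_tensor (A : T1 -> R[i]) (B : T2 -> R[i]) : cint_finite m1 A -> cint_finite m2 B ->
  cint_finite (m1 \x m2)%E (fun z => A z.1 * B z.2).
Proof.
move=> [a1 a2] [b1 b2]; split.
- under [X in EFin \o X]eq_fun do rewrite cReM.
  exact: (integrableB measurableT (integrable_tensor a1 b1) (integrable_tensor a2 b2)).
- under [X in EFin \o X]eq_fun do rewrite cImM.
  exact: (integrableD measurableT (integrable_tensor a1 b2) (integrable_tensor a2 b1)).
Qed.

Lemma cint_tensor (A : T1 -> R[i]) (B : T2 -> R[i]) : cint_finite m1 A -> cint_finite m2 B ->
  cint (m1 \x m2)%E (fun z => A z.1 * B z.2) = cint m1 A * cint m2 B.
Proof.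
move=> [a1 a2] [b1 b2]; apply: complex_ext; rewrite ?cReM ?cImM /cint/=.
- under [LHS]eq_Rintegral do rewrite cReM.
  rewrite RintegralB//; [|exact: (integrable_tensor a1 b1)|exact: (integrable_tensor a2 b2)].
  by rewrite (Rintegral_tensor a1 b1) (Rintegral_tensor a2 b2).
- under [LHS]eq_Rintegral do rewrite cImM.
  rewrite RintegralD//; [|exact: (integrable_tensor a1 b2)|exact: (integrable_tensor a2 b1)].
  by rewrite (Rintegral_tensor a1 b2) (Rintegral_tensor a2 b1).
Qed.

End ComplexFubini.

(** * Schwartz functions *)

Section SchwartzFunctions.
Context {R : realType}.
Local Notation mu := (@lebesgue_measure R).
Local Notation plane := (@plane_measure R).
Implicit Types (psi : R * R -> R[i]).

(** The limit of the functions obtained by rounding the first variable down to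
    multiples of 1/(n+1). *)
Lemma measurable_caratheodory (f : R * R -> R) :
  (forall x, measurable_fun setT (fun y => f (x, y))) ->
  (forall y, continuous (fun x => f (x, y))) -> measurable_fun setT f.
Proof.
move=> fm fc.
pose g (n : nat) (x : R) : R := (Num.floor (n.+1%:R * x))%:~R / n.+1%:R.
have g_cvg x : g n x @[n --> \oo] --> x.
  apply: (@squeeze_cvgr _ _ _ _ (fun n : nat => x - n.+1%:R^-1) (fun=> x)); last 2 first.
  - by rewrite -[X in _ --> X]subr0; apply: cvgB; [exact: cvg_cst|exact: cvg_harmonic].
  - exact: cvg_cst.
  apply: nearW => n; have n0 : 0 < n.+1%:R :> R by rewrite ltr0n.
  rewrite /g ler_pdivlMr// ler_pdivrMr// [x * _]mulrC Num.Theory.ge_floor andbT.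
  rewrite mulrBl mulVf ?gt_eqF// lerBlDr mulrC.
  by rewrite -[1]/(1%:~R) -intrD ltW// Num.Theory.lt_succ_floor.
apply: (@measurable_fun_cvg _ _ _ _ (fun n z => f (g n z.1, z.2))).
  move=> n.
  have n0 : 0 < n.+1%:R :> R by rewrite ltr0n.
  pose strip (i : nat) : set (R * R) :=
    (if (@choice.unpickle int i) is Some z then `[z%:~R / n.+1%:R, (z + 1)%:~R / n.+1%:R[%classic else set0) `*` setT.
  have ms i : measurable (strip i).
    apply: measurableX => //; case: choice.unpickle => // z; exact: measurable_itv.
  have <- : \bigcup_i strip i = setT.
    apply/seteqP; split; first by move=> z _.
    move=> z _; exists (choice.pickle (Num.floor (n.+1%:R * z.1))); first exact: I.
    rewrite /strip choice.pickleK /=; split => //.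
    rewrite in_itv/= ler_pdivrMr// ltr_pdivlMr// [z.1 * _]mulrC.
    by rewrite Num.Theory.ge_floor Num.Theory.lt_succ_floor.
  apply/measurable_fun_bigcup => // i.
  rewrite /strip; case: (choice.unpickle i) => [k|]; last first.
    by rewrite set0X; exact: measurable_fun_set0.
  apply: (eq_measurable_fun (fun z : R * R => f (k%:~R / n.+1%:R, z.2))).
    move=> z; rewrite inE => -[/= + _]; rewrite in_itv/= ler_pdivrMr// ltr_pdivlMr// => /andP[lo hi].
    rewrite /g (_ : Num.floor _ = k)//; apply: Num.Theory.floor_def.
    by rewrite mulrC lo hi.
  apply: measurable_funTS; apply: (measurableT_comp (fm _)); exact: measurable_snd.
move=> [x y] _ /=.
exact: (continuous_cvg _ (fc y x) (g_cvg x)).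
Qed.

Lemma integrable_bump : mu.-integrable setT (EFin \o (fun x : R => (1 + x ^+ 2)^-1)).
Proof.
have p0 (x : R) : 0 <= (1 + x ^+ 2)^-1 by rewrite invr_ge0 ltW// gt0_1Dsqr.
apply/integrableP; split.
  apply/measurable_EFinP; apply: continuous_measurable_fun => x.
  apply: cvgV; first by rewrite gt_eqF// gt0_1Dsqr.
  by apply: cvgD; [exact: cvg_cst|apply: cvgM; exact: cvg_id].
have := @integral_bump R 1 0 ltr01.
under eq_integral do rewrite subr0 mul1r.
under eq_integral => x _ do rewrite -[X in X%:E](ger0_norm (p0 x)).
by move=> ->; rewrite ltry.
Qed.

(** An integrable majorant for Schwartz functions and for bounded functions on
    the square alike. *)
Definition plane_bump (y : R * R) : R := (1 + y.1 ^+ 2)^-1 * (1 + y.2 ^+ 2)^-1.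

Lemma integrable_plane_bump : plane.-integrable setT (EFin \o plane_bump).
Proof. exact: (integrable_tensor integrable_bump integrable_bump). Qed.

Lemma schwartz_measurable psi : schwartz psi -> cmeasurable psi.
Proof.
move=> [sm _].
have main (f : R * R -> R) : (forall x : R^o * R^o, differentiable (f : R^o * R^o -> R^o) x) -> measurable_fun setT f.
  move=> df.
  have cf (x : R * R) : {for x, continuous (f : R^o * R^o -> R^o)} := differentiable_continuous (df x).
  apply: measurable_caratheodory => [x|y].
  - apply: continuous_measurable_fun => y.
    apply: (@continuous_comp _ _ _ (fun y => (x, y)) f); last exact: cf.
    exact: (@cvg_pair _ _ _ (nbhs y) (nbhs x) (nbhs y) _ _ _ (fun=> x) id (cvg_cst x) cvg_id).
  - move=> x.
    apply: (@continuous_comp _ _ _ (fun x => (x, y)) f); last exact: cf.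
    exact: (@cvg_pair _ _ _ (nbhs x) (nbhs x) (nbhs y) _ _ _ id (fun=> y) cvg_id (cvg_cst y)).
by split; apply: main => x; have [] := sm 0%N 0%N x.
Qed.

(** Both 1 + y1^2 and 1 + y2^2 are at most (1 + |y|)^2, so that four powers of
    1 + |y| suffice. *)
Lemma schwartz_bound psi : schwartz psi ->
  exists2 M : R, 0 <= M & forall y, normc (psi y) <= M * plane_bump y.
Proof.
move=> [_ /(_ 4%N) fs].
have [M HM] : exists M : R, forall y : R^o * R^o, (1 + `|y|) ^+ 4 * normc (psi y) <= M.
  exists (fine (schwartz_seminorm 4 psi)) => y.
  have h : (((1 + `|y|) ^+ 4 * normc (psi y))%:E <= schwartz_seminorm 4 psi)%E.
    apply: le_trans (ereal_sup_ubound _); last by exists y.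
    rewrite lee_fin ler_wpM2l ?exprn_ge0 ?addr_ge0//.
    rewrite (bigD1 (ord0, ord0))//= lerDl; apply: sumr_ge0 => *; exact: cnorm_ge0.
  rewrite -lee_fin fineK// fin_numElt fs andbT.
  by apply: lt_le_trans h; exact: ltNyr.
have M0 : 0 <= M by apply: le_trans (HM 0); rewrite mulr_ge0 ?cnorm_ge0// exprn_ge0// addr_ge0.
exists M => // y.
have g0 (x : R) : 0 < 1 + x ^+ 2 by exact: gt0_1Dsqr.
rewrite /plane_bump -invfM ler_pdivlMr ?mulr_gt0// mulrC (le_trans _ (HM y))//.
rewrite ler_wpM2r ?cnorm_ge0//.
have hx (x : R) : `|x| <= `|(y : R^o * R^o)| -> 1 + x ^+ 2 <= (1 + `|(y : R^o * R^o)|) ^+ 2.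
  move=> hx; rewrite -(real_normK (num_real x)).
  apply: (@le_trans _ _ ((1 + `|x|) ^+ 2)); first by have := normr_ge0 x; nra.
  by rewrite ler_pXn2r ?nnegrE ?addr_ge0// lerD2l.
rewrite (_ : 4 = 2 + 2)%N// exprD ler_pM ?(ltW (g0 _)) ?hx//.
- by rewrite [leRHS]prod_normE le_max lexx.
- by rewrite [leRHS]prod_normE le_max lexx orbT.
Qed.

End SchwartzFunctions.

(** * Dyadic kernels as Fourier integrals *)

Section PlaneMeasure.
Context {R : realType}.
Local Notation mu := (@lebesgue_measure R).

(** Lebesgue measure on the plane under a name of its own, to which its
    sigma-finiteness is attached for the use of Fubini on pairs of points of
    the plane. *)
Definition lebesgue_plane : set (measurableTypeR R * measurableTypeR R) -> \bar R := (mu \x mu)%E.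

HB.instance Definition _ := Measure.on lebesgue_plane.

Lemma lebesgue_plane_sigma_finite : sigma_finite setT lebesgue_plane.
Proof.
pose A (n : nat) : set R := `[- n%:R, n%:R]%classic.
exists (fun n => A n `*` A n).
  apply/esym/seteqP; split => // -[x y] _.
  exists (Num.trunc (`|x| + `|y|)).+1 => //.
  have h := ltW (truncnS_gt (`|x| + `|y|)).
  split; rewrite /A/= in_itv/= -ler_norml; apply: le_trans h.
  - by rewrite lerDl.
  - by rewrite lerDr.
move=> n; split; first by apply: measurableX; exact: measurable_itv.
rewrite /lebesgue_plane product_measure1E; [|exact: measurable_itv..].
have fA : (mu (A n) < +oo)%E by rewrite lebesgue_measure_itv; case: ifP => _; rewrite ?ltry// -EFinB ltry.
by apply: lte_mul_pinfty => //; rewrite ge0_fin_numE.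
Qed.

HB.instance Definition _ := Measure_isSigmaFinite.Build _ _ _ lebesgue_plane lebesgue_plane_sigma_finite.

End PlaneMeasure.
Arguments lebesgue_plane {R}.

Section FourierKernels.
Context {R : realType}.
Local Notation mu := (@lebesgue_measure R).
Variable phi : R -> R[i].
Hypothesis gen_phi : resolution_generator phi.

Definition re_jet (m : nat) (x : R) : R := Re (cderive1n m phi x).
Definition im_jet (m : nat) (x : R) : R := Im (cderive1n m phi x).

Lemma deriv_vanish (f f' : R -> R) : has_deriv f f' ->
  (forall x, 3 / 2 < `|x| -> f x = 0) -> forall x, 3 / 2 < `|x| -> f' x = 0.
Proof.
move=> df f0 x hx.
have nx : \forall y \near x, cst 0 y = f y.
  have : \forall y \near x, 3 / 2 < `|y| :> R.
    have := @norm_continuous _ R x; move/cvgr_gt; apply; exact: hx.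
  by apply: filterS => y hy; rewrite f0.
have h := near_eq_is_derive nx (is_derive_cst (0 : R) x 1).
have [_ <-] := df x; by have [_ ->] := h.
Qed.

Lemma bump_chain_jets : bump_chain re_jet /\ bump_chain im_jet.
Proof.
have [[sm _] _ v] := gen_phi.
have dre m : has_deriv (re_jet m) (re_jet m.+1).
  move=> x; have [d _] := sm m x.
  by apply: DeriveDef => //; exact: diff_derivable.
have dim m : has_deriv (im_jet m) (im_jet m.+1).
  move=> x; have [_ d] := sm m x.
  by apply: DeriveDef => //; exact: diff_derivable.
split; split => //; elim=> [|m IH] x hx.
- by rewrite /re_jet /= v.
- exact: (deriv_vanish (dre m) IH).
- by rewrite /im_jet /= v.
- exact: (deriv_vanish (dim m) IH).
Qed.

(** With kernel_im: real and imaginary part of the inverse Fourier transform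
    of phi, with the factor 1/(2 pi). *)
Definition kernel_re (x : R) : R :=
  (2 * pi)^-1 * transform cos (re_jet 0) x + - (2 * pi)^-1 * transform sin (im_jet 0) x.

Definition kernel_im (x : R) : R :=
  (2 * pi)^-1 * transform cos (im_jet 0) x + (2 * pi)^-1 * transform sin (re_jet 0) x.

Lemma good_kernels : (exists C, good_kernel C kernel_re) /\ (exists C, good_kernel C kernel_im).
Proof.
have [br bi] := bump_chain_jets.
have [c1 h1] := good_kernel_transform (@oscillator_cos R) br.
have [c2 h2] := good_kernel_transform (@oscillator_sin R) bi.
have [c3 h3] := good_kernel_transform (@oscillator_cos R) bi.
have [c4 h4] := good_kernel_transform (@oscillator_sin R) br.
split; eexists.
- exact: (good_kernel_lin _ _ h1 h2).
- exact: (good_kernel_lin _ _ h3 h4).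
Qed.

Definition dyadic_ckernel (k : nat) (x : R) : R[i] :=
  dyadic_kernel kernel_re k x +i* dyadic_kernel kernel_im k x.

Section Compact.
Variables (G : R -> R) (s : R).
Hypotheses (cG : continuous G) (vG : forall x, 2 * s < `|x| -> G x = 0).

Let GE : G = G \_ `[- (2 * s), 2 * s].
Proof.
apply/funext => x; rewrite patchE; case: ifPn => // /negP h.
apply: vG; rewrite ltNge; apply/negP => hx; apply: h.
by rewrite inE/= in_itv/= -ler_norml.
Qed.

Lemma integrable_compact_support : mu.-integrable setT (EFin \o G).
Proof.
have -> : EFin \o G = (EFin \o G) \_ `[- (2 * s), 2 * s].
  by rewrite {1}GE restrict_EFin.
apply/(@integrable_mkcond _ _ _ mu _ (EFin \o G) (measurable_itv _)).
exact: (continuous_integrable_itv _ _ cG).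
Qed.

Lemma Rintegral_compact_support : \int[mu]_x G x = \int[mu]_(x in `[- (2 * s), 2 * s]) G x.
Proof. by rewrite [RHS]Rintegral_mkcond -GE. Qed.

End Compact.

Lemma Rintegral_scaled (w f : R -> R) (s x : R) : 0 < s -> continuous w -> continuous f ->
  (forall t, 3 / 2 < `|t| -> f t = 0) ->
  mu.-integrable setT (EFin \o (fun t => w (x * t) * f (t / s))) /\
  \int[mu]_t (w (x * t) * f (t / s)) = s * transform w f (s * x).
Proof.
move=> s0 cw cf f0.
have clin (h : R -> R) (c : R) : continuous h -> continuous (fun t => h (c * t)).
  move=> ch t; apply: (@continuous_comp _ _ _ (fun t => c * t) h); last exact: ch.
  by apply: cvgM; [exact: cvg_cst|exact: cvg_id].
have cG : continuous (fun t => w (x * t) * f (t / s)).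
  apply: continuous_mulfun; first exact: clin.
  by under eq_fun do rewrite mulrC; exact: clin.
have vG t : 2 * s < `|t| -> w (x * t) * f (t / s) = 0.
  move=> h; rewrite f0 ?mulr0// normrM normfV (gtr0_norm s0) ltr_pdivlMr//.
  by apply: le_lt_trans h; rewrite ler_wpM2r ?(ltW s0)//; lra.
split; first exact: (integrable_compact_support cG vG).
rewrite (Rintegral_compact_support vG).
have cH : continuous (fun t => w (s * x * t) * f t) by apply: continuous_mulfun => //; exact: clin.
have [P dP] := continuous_has_primitive cH.
have d2 := has_derivZ s (has_deriv_lin s^-1 0 dP).
have d3 : has_deriv (fun t => s * P (s^-1 * t + 0)) (fun t => w (x * t) * f (t / s)).
  apply: has_deriv_ext d2 => t /=; rewrite addr0 mulrA divff ?gt_eqF// mul1r.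
  by rewrite [s^-1 * t]mulrC; congr (w _ * _); field; rewrite gt_eqF.
have s2 : - (2 * s) <= 2 * s by have := s0; lra.
rewrite (Rintegral_deriv s2 d3 cG) /transform (Rintegral_deriv _ dP cH); last lra.
rewrite !addr0 mulrN mulrCA mulVf ?gt_eqF// mulr1; ring.
Qed.

Lemma cint_expi_scaled (s x : R) : 0 < s ->
  cint_finite mu (fun t => expi (x * t) * phi (t / s)) /\
  cint mu (fun t => expi (x * t) * phi (t / s)) =
    (2 * pi)%:C * ((s * kernel_re (s * x)) +i* (s * kernel_im (s * x))).
Proof.
move=> s0; have [br bi] := bump_chain_jets.
have cr := @bump_chain_cont _ _ 0%N br; have ci := @bump_chain_cont _ _ 0%N bi.
have [_ vr] := br; have [_ vi] := bi.
have [i1 e1] := Rintegral_scaled x s0 (@continuous_cos R) cr (vr 0%N).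
have [i2 e2] := Rintegral_scaled x s0 (@continuous_sin R) ci (vi 0%N).
have [i3 e3] := Rintegral_scaled x s0 (@continuous_cos R) ci (vi 0%N).
have [i4 e4] := Rintegral_scaled x s0 (@continuous_sin R) cr (vr 0%N).
have p0 : 2 * pi != 0 :> R by rewrite mulf_neq0// gt_eqF// pi_gt0.
have ReE t : Re (expi (x * t) * phi (t / s)) = cos (x * t) * re_jet 0 (t / s) - sin (x * t) * im_jet 0 (t / s).
  by rewrite cReM.
have ImE t : Im (expi (x * t) * phi (t / s)) = cos (x * t) * im_jet 0 (t / s) + sin (x * t) * re_jet 0 (t / s).
  by rewrite cImM.
split.
  split.
    under [X in EFin \o X]eq_fun do rewrite ReE.
    exact: (integrableB measurableT i1 i2).
  under [X in EFin \o X]eq_fun do rewrite ImE.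
  exact: (integrableD measurableT i3 i4).
rewrite /cint; apply: complex_ext; rewrite ?cReM ?cImM /= ?mul0r ?subr0 ?addr0.
- under eq_Rintegral do rewrite ReE.
  rewrite RintegralB// e1 e2 /kernel_re.
  by move: (2 * pi) p0 => c c0; field.
- under eq_Rintegral do rewrite ImE.
  rewrite RintegralD// e3 e4 /kernel_im.
  by move: (2 * pi) p0 => c c0; field.
Qed.

(** The substitution t = 2^k u in each of the two terms of the dyadic
    function. *)
Lemma cint_dyadic (k : nat) (x : R) :
  cint_finite mu (fun t => expi (x * t) * dyadic phi k t) /\
  cint mu (fun t => expi (x * t) * dyadic phi k t) = (2 * pi)%:C * dyadic_ckernel k x.
Proof.
have e2 i : 0 < 2 ^+ i :> R by rewrite exprn_gt0.
case: k => [|k].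
  have := cint_expi_scaled x ltr01.
  by under eq_fun do rewrite divr1; rewrite !mul1r.
have [f1 h1] := cint_expi_scaled x (e2 k.+1).
have [f2 h2] := cint_expi_scaled x (e2 k).
have E t : expi (x * t) * dyadic phi k.+1 t =
  expi (x * t) * phi (t / 2 ^+ k.+1) + (-1) * (expi (x * t) * phi (t / 2 ^+ k)).
  by rewrite /dyadic mulrBr mulN1r.
have f3 := cint_finiteZ (-1) f2.
under eq_fun do rewrite E; split; first exact: cint_finiteD.
rewrite cintD// cintZ// h1 h2 /dyadic_ckernel.
by apply: complex_ext; rewrite !(raddfD, cReM, cImM) /=; ring.
Qed.

End FourierKernels.

(** * Dyadic pieces as convolutions *)

Section DyadicKernelBounds.
Context {R : realType}.
Local Notation mu := (@lebesgue_measure R).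
Variable phi : R -> R[i].
Hypothesis gen_phi : resolution_generator phi.

Lemma dyadic_kernel_bounded (kap : R -> R) C k : good_kernel C kap ->
  continuous (dyadic_kernel kap k) /\ exists M : R, forall x, `|dyadic_kernel kap k x| <= M.
Proof.
move=> gk; have [C0 ck _ _] := gk.
have b1 x : `|kap x| <= C.
  apply: le_trans (good_kernel_le1 x gk) _; rewrite ler_pdivrMr ?gt0_1Dsqr//.
  by rewrite ler_peMr// ge1_1Dsqr.
have clin (c : R) : continuous (fun x => c * kap (c * x)).
  move=> x; apply: cvgM; first exact: cvg_cst.
  apply: (@continuous_comp _ _ _ (fun t => c * t) kap); last exact: ck.
  by apply: cvgM; [exact: cvg_cst|exact: cvg_id].
have blin (c x : R) : 0 <= c -> `|c * kap (c * x)| <= c * C.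
  by move=> c0; rewrite normrM ger0_norm// ler_wpM2l.
have e2 i : 0 <= 2 ^+ i :> R by rewrite exprn_ge0.
case: k => [|k]; first by split => //; exists C.
split; first by move=> x; apply: cvgB; exact: clin.
exists (2 ^+ k.+1 * C + 2 ^+ k * C) => x.
by rewrite (le_trans (ler_normB _ _))// lerD// blin.
Qed.

Lemma dyadic_ckernel_bounded k :
  cmeasurable (dyadic_ckernel phi k) /\ exists2 M : R, 0 <= M & forall x, normc (dyadic_ckernel phi k x) <= M.
Proof.
have [[C1 g1] [C2 g2]] := good_kernels gen_phi.
have [c1 [M1 b1]] := dyadic_kernel_bounded k g1.
have [c2 [M2 b2]] := dyadic_kernel_bounded k g2.
split; first by split; exact: continuous_measurable_fun.
exists (M1 + M2) => [|x].
  by rewrite addr_ge0// ?(le_trans (normr_ge0 _) (b1 0)) ?(le_trans (normr_ge0 _) (b2 0)).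
by apply: le_trans (cnorm_le _) _; exact: (lerD (b1 x) (b2 x)).
Qed.

Lemma dyadic_majorant k : cmeasurable (dyadic phi k) /\
  exists2 a : R -> R, mu.-integrable setT (EFin \o a) & forall x, normc (dyadic phi k x) <= a x.
Proof.
have [+ _] := cint_dyadic gen_phi k 0.
have e1 : expi 0 = 1 :> R[i] by rewrite /expi cos0 sin0.
under eq_fun do rewrite mul0r e1 mul1r.
move=> [i1 i2]; split.
  by split; apply/measurable_EFinP; [exact: measurable_int i1|exact: measurable_int i2].
exists (fun x => `|Re (dyadic phi k x)| + `|Im (dyadic phi k x)|); last by move=> x; exact: cnorm_le.
exact: (integrableD measurableT (integrable_abse i1) (integrable_abse i2)).
Qed.

End DyadicKernelBounds.

Section Representation.
Context {R : realType}.
Local Notation mu := (@lebesgue_measure R).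
Local Notation plane := (@lebesgue_plane R).
Variable phi : R -> R[i].
Hypothesis gen_phi : resolution_generator phi.
Variable k : nat * nat.

(** (2 pi)^-2 times the integral of exp(i z.t) against the product of the two
    dyadic functions. *)
Definition plane_kernel (z : R * R) : R[i] :=
  dyadic_ckernel phi k.1 z.1 * dyadic_ckernel phi k.2 z.2.

Lemma measurable_sub1 : measurable_fun setT (fun z : (R * R) * (R * R) => z.2.1 - z.1.1).
Proof.
apply: measurable_funB.
- by apply: (measurableT_comp (@measurable_fst _ _ R R)); exact: measurable_snd.
- by apply: (measurableT_comp (@measurable_fst _ _ R R)); exact: measurable_fst.
Qed.

Lemma measurable_sub2 : measurable_fun setT (fun z : (R * R) * (R * R) => z.2.2 - z.1.2).
Proof.
apply: measurable_funB.
- by apply: (measurableT_comp (@measurable_snd _ _ R R)); exact: measurable_snd.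
- by apply: (measurableT_comp (@measurable_snd _ _ R R)); exact: measurable_fst.
Qed.

Lemma plane_kernel_bounded :
  cmeasurable (fun z : (R * R) * (R * R) => plane_kernel (z.2.1 - z.1.1, z.2.2 - z.1.2)) /\
  exists2 M : R, 0 <= M & forall z, normc (plane_kernel z) <= M.
Proof.
have [m1 [M1 M10 b1]] := dyadic_ckernel_bounded gen_phi k.1.
have [m2 [M2 M20 b2]] := dyadic_ckernel_bounded gen_phi k.2.
split.
  apply: cmeasurableM.
  - exact: (cmeasurable_comp m1 measurable_sub1).
  - exact: (cmeasurable_comp m2 measurable_sub2).
exists (M1 * M2) => [|z]; first exact: mulr_ge0.
by rewrite /plane_kernel Normc.normcM ler_pM// cnorm_ge0.
Qed.

Lemma dotpC (x y : R * R) : dotp x y = dotp y x.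
Proof. by rewrite /dotp; congr (_ + _); exact: mulrC. Qed.

Lemma measurable_dotp : measurable_fun setT (fun z : (R * R) * (R * R) => dotp z.2 z.1).
Proof.
rewrite /dotp; apply: measurable_funD; apply: measurable_funM;
  by [apply: (measurableT_comp (@measurable_fst _ _ R R)); exact: measurable_snd|
      apply: (measurableT_comp (@measurable_fst _ _ R R)); exact: measurable_fst|
      apply: (measurableT_comp (@measurable_snd _ _ R R)); exact: measurable_snd|
      apply: (measurableT_comp (@measurable_snd _ _ R R)); exact: measurable_fst].
Qed.

Lemma measurable_dotpl (x : R * R) : measurable_fun setT (fun z : R * R => dotp x z).
Proof.
by rewrite /dotp; apply: measurable_funD; exact: measurable_funM.
Qed.

Lemma expi_dotpD (x y z : R * R) : expi (- dotp x z) * expi (dotp y z) =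
  expi ((y.1 - x.1) * z.1) * expi ((y.2 - x.2) * z.2).
Proof. by rewrite -!expiD; congr expi; rewrite /dotp; ring. Qed.

Lemma cint_dyadic2 (z : R * R) :
  cint_finite plane (fun t => (expi (z.1 * t.1) * expi (z.2 * t.2)) * dyadic2 phi k t) /\
  cint plane (fun t => (expi (z.1 * t.1) * expi (z.2 * t.2)) * dyadic2 phi k t) =
   (2 * pi)%:C ^+ 2 * plane_kernel z.
Proof.
have [f1 e1] := cint_dyadic gen_phi k.1 z.1.
have [f2 e2] := cint_dyadic gen_phi k.2 z.2.
have E (t : R * R) : (expi (z.1 * t.1) * expi (z.2 * t.2)) * dyadic2 phi k t =
  (expi (z.1 * t.1) * dyadic phi k.1 t.1) * (expi (z.2 * t.2) * dyadic phi k.2 t.2).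
  by rewrite /dyadic2 mulrACA.
under eq_fun do rewrite E; split.
  exact: cint_finite_tensor f1 f2.
rewrite [LHS](_ : _ = cint mu (fun t => expi (z.1 * t) * dyadic phi k.1 t) *
  cint mu (fun t => expi (z.2 * t) * dyadic phi k.2 t)); last exact: cint_tensor.
by rewrite e1 e2 /plane_kernel expr2 mulrACA.
Qed.

Lemma dyadic2_majorant : cmeasurable (dyadic2 phi k) /\
  exists2 a : R * R -> R, plane.-integrable setT (EFin \o a) & forall x, normc (dyadic2 phi k x) <= a x.
Proof.
have [m1 [a1 i1 b1]] := dyadic_majorant gen_phi k.1.
have [m2 [a2 i2 b2]] := dyadic_majorant gen_phi k.2.
split.
  by apply: cmeasurableM; [exact: (cmeasurable_comp m1 measurable_fst)|exact: (cmeasurable_comp m2 measurable_snd)].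
exists (fun z => a1 z.1 * a2 z.2); first exact: integrable_tensor.
by move=> x; rewrite /dyadic2 Normc.normcM ler_pM// cnorm_ge0.
Qed.

(** Fubini, with the product of the absolute values of the dyadic function at
    t and of psi at y as majorant. The integral over t is the kernel. *)
Lemma fourier_dyadic_ifourier psi x : schwartz psi ->
  fourier (fun t => dyadic2 phi k t * ifourier psi t) x =
  cint plane (fun y => psi y * plane_kernel (y.1 - x.1, y.2 - x.2)).
Proof.
move=> spsi; have mpsi := schwartz_measurable spsi.
have [M M0 bM] := schwartz_bound spsi.
have [mP [a ia ba]] := dyadic2_majorant.
have ibump : plane.-integrable setT (EFin \o plane_bump) by exact: integrable_plane_bump.
have iM : plane.-integrable setT (EFin \o (fun y => M * plane_bump y)) by exact: integrable_scale.
set c := ((2 * pi)^-1)%:C : R[i].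
have p0 : 2 * pi != 0 :> R by rewrite mulf_neq0// gt_eqF// pi_gt0.
have cE : c * (2 * pi)%:C = 1 by rewrite /c -rmorphM/= mulVf.
pose F (z : (R * R) * (R * R)) : R[i] :=
  expi (- dotp x z.1) * dyadic2 phi k z.1 * (expi (dotp z.2 z.1) * psi z.2).
have mF : cmeasurable F.
  apply: cmeasurableM; apply: cmeasurableM.
  - apply: cmeasurable_expi; apply: (measurableT_comp (@oppr_measurable R setT)); apply: (measurableT_comp (measurable_dotpl x)); exact: measurable_fst.
  - exact: (cmeasurable_comp mP measurable_fst).
  - by apply: cmeasurable_expi; exact: measurable_dotp.
  - exact: (cmeasurable_comp mpsi measurable_snd).
have bF t y : normc (F (t, y)) <= a t * (M * plane_bump y).
  rewrite /F/= Normc.normcM [X in X * _]Normc.normcM [X in _ * X]Normc.normcM !cnorm_expi !mul1r.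
  by apply: ler_pM; [exact: cnorm_ge0|exact: cnorm_ge0|exact: ba|exact: bM].
have i1 (t : R * R) : cint_finite plane (fun y => expi (dotp y t) * psi y).
  apply: (cint_finite_dominated _ iM).
    apply: cmeasurableM => //; apply: cmeasurable_expi.
    exact: (measurableT_comp measurable_dotp (pair1_measurable t)).
  by move=> y; rewrite Normc.normcM cnorm_expi mul1r.
rewrite /fourier -/c.
have -> : cintegral setT (fun t => expi (- dotp t x) * (dyadic2 phi k t * ifourier psi t)) =
   c * cint plane (fun y => cint plane (fun t => F (t, y))).
  rewrite -(cint_swap (m1 := plane) (m2 := plane) mF ia iM bF) -cintZ; last exact: (cint_finite_inner (m1 := plane) (m2 := plane) mF ia iM bF).
  congr (cint plane _); apply/funext => t.
  rewrite /F/= [in RHS]cintZ; last exact: i1.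
  rewrite dotpC /ifourier -/c.
  have -> : (fun xi => expi (dotp t xi) * psi xi) = (fun xi => expi (dotp xi t) * psi xi).
    by apply/funext => xi; rewrite dotpC.
  have assoc (u v w z : R[i]) : u * (v * (w * z)) = w * (u * v * z) by ring.
  exact: assoc.
have -> : (fun y => cint plane (fun t => F (t, y))) =
  (fun y => (2 * pi)%:C ^+ 2 * (psi y * plane_kernel (y.1 - x.1, y.2 - x.2))).
  apply/funext => y.
  have [f2 e2] := cint_dyadic2 (y.1 - x.1, y.2 - x.2).
  have -> : (fun t => F (t, y)) = (fun t => psi y * ((expi ((y.1 - x.1) * t.1) * expi ((y.2 - x.2) * t.2)) * dyadic2 phi k t)).
    by apply/funext => t; rewrite /F/= -expi_dotpD; ring.
  by rewrite cintZ// e2; ring.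
have [mK [MK MK0 bK]] := plane_kernel_bounded.
rewrite cintZ.
  have -> : forall w : R[i], c * (c * ((2 * pi)%:C ^+ 2 * w)) = (c * (2 * pi)%:C) ^+ 2 * w by move=> w; ring.
  by rewrite cE expr1n mul1r.
have iMK : plane.-integrable setT (EFin \o (fun y => MK * (M * plane_bump y))) by exact: integrable_scale.
apply: (cint_finite_dominated _ iMK).
- apply: cmeasurableM => //; exact: (cmeasurable_comp mK (pair1_measurable x)).
- by move=> y; rewrite Normc.normcM mulrC ler_pM// cnorm_ge0.
Qed.

Section Convolution.
Variables (f : R * R -> R) (B : R).
Hypotheses (mf : measurable_fun setT f) (B_ge0 : 0 <= B) (bf : forall x, `|f x| <= B * plane_bump x).

(** The function that represents the dyadic piece of the distribution f. *)
Definition convolution (y : R * R) : R[i] :=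
  cint plane (fun x => (f x)%:C * plane_kernel (y.1 - x.1, y.2 - x.2)).

(** Fubini once more: the kernel is bounded, and f and psi have integrable
    majorants. *)
Lemma convolution_represents psi : schwartz psi ->
  cint_finite plane (fun y => convolution y * psi y) /\
  cint plane (fun x => (f x)%:C * fourier (fun t => dyadic2 phi k t * ifourier psi t) x) =
  cint plane (fun y => convolution y * psi y).
Proof.
move=> spsi; have mpsi := schwartz_measurable spsi.
have [M M0 bM] := schwartz_bound spsi.
have [mK [MK MK0 bK]] := plane_kernel_bounded.
have ibump : plane.-integrable setT (EFin \o plane_bump) by exact: integrable_plane_bump.
have iM : plane.-integrable setT (EFin \o (fun y => M * plane_bump y)) by exact: integrable_scale.
have iB : plane.-integrable setT (EFin \o (fun y => MK * (B * plane_bump y))).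
  by do 2 apply: integrable_scale.
pose F (z : (R * R) * (R * R)) : R[i] :=
  (f z.1)%:C * (psi z.2 * plane_kernel (z.2.1 - z.1.1, z.2.2 - z.1.2)).
have mF : cmeasurable F.
  apply: cmeasurableM; first by apply: cmeasurable_real; exact: (measurableT_comp mf measurable_fst).
  apply: cmeasurableM => //; exact: (cmeasurable_comp mpsi measurable_snd).
have normR (x : R) : normc (x%:C) = `|x| by rewrite /= expr0n/= addr0 sqrtr_sqr.
have bF x y : normc (F (x, y)) <= MK * (B * plane_bump x) * (M * plane_bump y).
  rewrite /F/= Normc.normcM normR [X in _ * X]Normc.normcM.
  have -> : MK * (B * plane_bump x) * (M * plane_bump y) =
    (B * plane_bump x) * ((M * plane_bump y) * MK) by ring.
  apply: ler_pM => //; first by rewrite mulr_ge0 ?cnorm_ge0.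
  by apply: ler_pM; rewrite ?cnorm_ge0.
have convE : (fun y => convolution y * psi y) = (fun y => cint plane (fun x => F (x, y))).
  apply/funext => y; rewrite /convolution mulrC -cintZ.
    by congr (cint plane _); apply/funext => x; rewrite /F/= mulrCA.
  apply: (cint_finite_dominated _ iB).
  - apply: cmeasurableM; first exact: cmeasurable_real.
    exact: (cmeasurable_comp mK (pair2_measurable y)).
  - by move=> x; rewrite Normc.normcM normR mulrC ler_pM// cnorm_ge0.
rewrite convE; split.
  pose F' z := F (z.2, z.1).
  have mF' : cmeasurable F'.
    by apply: (cmeasurable_comp mF); exact: measurable_swap.
  by apply: (cint_finite_inner (m1 := plane) (m2 := plane) mF' iM iB) => y x; rewrite /F'/= mulrC.
rewrite -(cint_swap (m1 := plane) (m2 := plane) mF iB iM bF); congr (cint plane _); apply/funext => x.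
rewrite fourier_dyadic_ifourier// -cintZ//.
have iMK : plane.-integrable setT (EFin \o (fun y => MK * (M * plane_bump y))) by exact: integrable_scale.
apply: (cint_finite_dominated _ iMK).
- apply: cmeasurableM => //; exact: (cmeasurable_comp mK (pair1_measurable x)).
- by move=> y; rewrite Normc.normcM mulrC ler_pM// cnorm_ge0.
Qed.

End Convolution.
End Representation.

(** * The discrepancy of a net as a density on the plane *)

Section HammersleyNets.
Context {R : realType}.
Variables (b n : nat).
Hypothesis b_ge2 : (2 <= b)%N.
Variable s : 'I_n -> 'I_b -> 'I_b.
Implicit Types t : {ffun 'I_n -> 'I_b}.

Let b0 : (0 < b)%N. Proof. exact: leq_trans b_ge2. Qed.
Let bN0 k : b%:R ^+ k != 0 :> R. Proof. by rewrite gt_eqF// exprn_gt0// ltr0n. Qed.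

Lemma hammersley_pointE t :
  hammersley_point s t = (point_coord t, point_coord (mirror s t)) :> R * R.
Proof.
rewrite /hammersley_point /point_coord /digit_value !natr_sum !mulr_suml; congr (_, _).
  apply: eq_bigr => i _; rewrite natrM natrX -mulrA; congr (_ * _).
  have -> : b%:R ^+ n = b%:R ^+ i * b%:R ^+ (n - i) :> R by rewrite -exprD subnKC// ltnW.
  by rewrite invfM mulrA divff// mul1r.
rewrite (reindex_inj rev_ord_inj)/=; apply: eq_bigr => i _.
rewrite /mirror ffunE natrM natrX -mulrA; congr (_ * _).
have -> : b%:R ^+ n = b%:R ^+ i * b%:R ^+ (n - i) :> R by rewrite -exprD subnKC// ltnW.
by rewrite invfM mulrA divff// mul1r subnS prednK// subn_gt0.
Qed.

(** A net of b^n points is counted without multiplicity because different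
    digit strings give different points. *)
Lemma digit_value_inj : injective (fun t => digit_value t).
Proof.
move=> t u e; apply/ffunP => i; apply: val_inj => /=.
by rewrite -(high_value_mod t i) -(high_value_mod u i) -!(digit_value_div b_ge2) e.
Qed.

Lemma hammersley_point_inj : injective (hammersley_point s : {ffun 'I_n -> 'I_b} -> R * R).
Proof.
move=> t u; rewrite !hammersley_pointE => -[+ _]; rewrite /point_coord.
move/(divIf (bN0 n))/eqP; rewrite eqr_nat => /eqP; exact: digit_value_inj.
Qed.

Lemma discrepancy_hammersley (x : R * R) : discrepancy (hammersley s) x =
  (b%:R ^+ n)^-1 * (\sum_(t : {ffun 'I_n -> 'I_b})
     \1_(`]point_coord t, 1[%classic : set R) x.1 * \1_(`]point_coord (mirror s t), 1[%classic : set R) x.2)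
  - x.1 * x.2.
Proof.
rewrite /discrepancy /hammersley; congr (_^-1 * _ - _).
  rewrite card_imfset/=; last exact: hammersley_point_inj.
  by rewrite -cardE card_ffun !card_ord natrX.
rewrite big_imfset/=; last by move=> t u _ _; exact: hammersley_point_inj.
rewrite big_enum/=; apply: eq_bigr => t _.
have [e1 e2] := hammersley_pointE t; rewrite {}e1 {}e2 !indicE -natrM mulnb; congr (nat_of_bool _)%:R.
by apply/idP/andP; rewrite !inE.
Qed.

(** The discrepancy function, extended by zero to the plane. *)
Definition net_density (x : R * R) : R :=
  (b%:R ^+ n)^-1 * (\sum_(t : {ffun 'I_n -> 'I_b})
     \1_(`]point_coord t, 1[%classic : set R) x.1 * \1_(`]point_coord (mirror s t), 1[%classic : set R) x.2)
  - \1_(`[0, 1[%classic : set R) x.1 * x.1 * (\1_(`[0, 1[%classic : set R) x.2 * x.2).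

Lemma point_coord_ge0 t : 0 <= point_coord t :> R.
Proof. by rewrite divr_ge0// exprn_ge0. Qed.

Lemma point_coord_le1 t : point_coord t <= 1 :> R.
Proof.
by rewrite ler_pdivrMr ?exprn_gt0 ?ltr0n// mul1r -natrX ler_nat ltnW// digit_value_lt.
Qed.

Lemma square_distribution_net psi :
  square_distribution (discrepancy (hammersley s)) psi =
  cint lebesgue_plane (fun x => (net_density x)%:C * psi x).
Proof.
have E (x : R * R) : net_density x = (discrepancy (hammersley s) \_ unit_square) x.
  rewrite patchE; case: ifPn => hx.
    move: hx; rewrite inE => -[h1 h2].
    rewrite discrepancy_hammersley /net_density !indicE.
    by rewrite (mem_set h1) (mem_set h2) !mul1r.
  rewrite /net_density.
  have z0 (z w : R) : 0 <= z -> 0 <= w ->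
     \1_(`]z, 1[%classic : set R) x.1 * \1_(`]w, 1[%classic : set R) x.2 = 0 :> R.
    move=> z0 w0; rewrite !indicE -natrM mulnb; apply/eqP; rewrite pnatr_eq0 eqb0.
    apply/negP => /andP[]; rewrite !inE/= !in_itv/= => /andP[a1 a2] /andP[a3 a4].
    move/negP: hx; apply; rewrite inE; split; rewrite /= in_itv/=.
      by rewrite a2 (le_trans z0 (ltW a1)).
    by rewrite a4 (le_trans w0 (ltW a3)).
  rewrite big1 ?mulr0 ?sub0r; last by move=> t _; rewrite z0// point_coord_ge0.
  apply/eqP; rewrite oppr_eq0 !indicE mulrACA -natrM mulnb.
  rewrite [X in nat_of_bool X](_ : _ = false) ?mul0r//.
  apply/negP => /andP[]; rewrite !inE => h1 h2.
  by move/negP: hx; apply; rewrite inE.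
rewrite /square_distribution /cintegral /cint; congr (_ +i* _);
  rewrite Rintegral_mkcond; apply: eq_Rintegral => x _; rewrite E !patchE; case: ifPn => _;
  by rewrite ?cReM ?cImM /= ?mul0r ?subr0 ?addr0.
Qed.

End HammersleyNets.

Section NetIntegrals.
Context {R : realType}.
Local Notation mu := (@lebesgue_measure R).

Section Indicator.
Variable A : set R.
Hypotheses (mA : measurable A) (A01 : A `<=` `[0, 1]%classic).

Lemma indic_bump (x : R) : `|\1_A x| <= 2 * (1 + x ^+ 2)^-1.
Proof.
have g0 : 0 < 1 + x ^+ 2 by exact: gt0_1Dsqr.
rewrite indicE; case: (boolP (x \in A)) => [|_]; last by rewrite normr0 divr_ge0// ltW.
rewrite inE => /A01; rewrite /= in_itv/= normr1 => /andP[x0 x1].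
by rewrite ler_pdivlMr// mul1r; nra.
Qed.

Lemma integrable_indic_mul (g : R -> R) : continuous g ->
  mu.-integrable setT (EFin \o (fun x => \1_A x * g x)).
Proof.
move=> cg.
have -> : EFin \o (fun x => \1_A x * g x) = (EFin \o g) \_ A.
  apply/funext => x; rewrite patchE /= indicE.
  by case: (x \in A); rewrite ?mul1r ?mul0r.
apply/(@integrable_mkcond _ _ _ mu _ (EFin \o g) mA).
apply: integrableS (continuous_integrable_itv 0 1 cg) => //.
Qed.

Lemma Rintegral_indic_mul (g : R -> R) : \int[mu]_x (\1_A x * g x) = \int[mu]_(x in A) g x.
Proof.
rewrite [RHS]Rintegral_mkcond; apply: eq_Rintegral => x _; rewrite patchE indicE.
by case: (x \in A); rewrite ?mul1r ?mul0r.
Qed.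

End Indicator.

Lemma subset_oo01 (z : R) : 0 <= z -> `]z, 1[%classic `<=` `[0, 1]%classic.
Proof.
by move=> z0 x /=; rewrite !in_itv/= => /andP[zx x1]; rewrite (ltW x1) (le_trans z0 (ltW zx)).
Qed.

Lemma subset_co01 : `[0, 1[%classic `<=` (`[0, 1]%classic : set R).
Proof. by move=> x /=; rewrite !in_itv/= => /andP[-> /ltW ->]. Qed.

Variables (kap P Pi : R -> R) (k : nat).
Hypotheses (ck : continuous (dyadic_kernel kap k)) (dP : has_deriv P kap).
Hypothesis (dPi : has_deriv Pi (dyadic_primitive P k)).

Let ckr y : continuous (fun x => dyadic_kernel kap k (y - x)).
Proof.
move=> x; apply: (@continuous_comp _ _ _ (fun x => y - x)); last exact: ck.
by apply: cvgB; [exact: cvg_cst|exact: cvg_id].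
Qed.

Lemma Rintegral_step (z y : R) : 0 <= z <= 1 ->
  mu.-integrable setT (EFin \o (fun x => \1_(`]z, 1[%classic) x * dyadic_kernel kap k (y - x))) /\
  \int[mu]_x (\1_(`]z, 1[%classic) x * dyadic_kernel kap k (y - x)) =
    dyadic_primitive P k (y - z) - dyadic_primitive P k (y - 1).
Proof.
move=> /andP[z0 z1]; split.
  by apply: integrable_indic_mul => //; exact: subset_oo01.
have ic := continuous_integrable_itv z 1 (@ckr y).
rewrite Rintegral_indic_mul Rintegral_itv_obnd_cbnd; last first.
  by apply: integrableS ic => //; exact: subset_itv_oo_cc.
rewrite Rintegral_itv_bndo_bndc; last first.
  by apply: integrableS ic => //; exact: subset_itv_co_cc.
have d := has_derivN (has_deriv_lin (-1) y (dyadic_primitive_deriv k dP)).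
have {}d : has_deriv (fun x => - dyadic_primitive P k (- 1 * x + y)) (fun x => dyadic_kernel kap k (y - x)).
  by apply: has_deriv_ext d => x; rewrite !mulN1r opprK addrC.
rewrite (Rintegral_deriv z1 d (@ckr y)) opprK [LHS]addrC !mulN1r.
by congr (dyadic_primitive _ _ _ - dyadic_primitive _ _ _); exact: addrC.
Qed.

Lemma Rintegral_linear (y : R) :
  mu.-integrable setT (EFin \o (fun x => \1_(`[0, 1[%classic) x * (x * dyadic_kernel kap k (y - x)))) /\
  \int[mu]_x (\1_(`[0, 1[%classic) x * (x * dyadic_kernel kap k (y - x))) = linear_moment P Pi k y.
Proof.
have cx : continuous (fun x : R => x * dyadic_kernel kap k (y - x)).
  exact: continuous_mulfun (has_deriv_cont (@has_deriv_id R)) (@ckr y).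
split.
  by apply: integrable_indic_mul => //; exact: subset_co01.
rewrite Rintegral_indic_mul Rintegral_itv_bndo_bndc; last first.
  by apply: integrableS (continuous_integrable_itv 0 1 cx) => //; exact: subset_itv_co_cc.
rewrite (Rintegral_deriv ler01 (moment_primitive_deriv dP dPi y) cx).
by rewrite /moment_primitive /linear_moment subr0; ring.
Qed.

End NetIntegrals.

Lemma Rintegral_sum {R : realType} d (T : measurableType d) (mu : {measure set T -> \bar R})
    (I : Type) (r : seq I) (F : I -> T -> R) :
  (forall i, mu.-integrable setT (EFin \o F i)) ->
  mu.-integrable setT (EFin \o (fun x => \sum_(i <- r) F i x)) /\
  \int[mu]_x \sum_(i <- r) F i x = \sum_(i <- r) \int[mu]_x F i x.
Proof.
move=> iF; elim: r => [|i r [IH1 IH2]].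
  rewrite big_nil; under eq_Rintegral do rewrite big_nil.
  under [X in EFin \o X]eq_fun do rewrite big_nil.
  by split; [exact: integrable0|rewrite (_ : (fun=> 0) = cst 0)// Rintegral_cst// mul0r].
have E x : \sum_(j <- i :: r) F j x = F i x + \sum_(j <- r) F j x by rewrite big_cons.
under [X in EFin \o X]eq_fun do rewrite E; under eq_Rintegral do rewrite E.
split; first exact: (integrableD measurableT (iF i) IH1).
by rewrite RintegralD// IH2 big_cons.
Qed.

Section NetConvolution.
Context {R : realType}.
Local Notation plane := (@lebesgue_plane R).
Variables (b n : nat).
Hypothesis b_ge2 : (2 <= b)%N.
Variable s : 'I_n -> 'I_b -> 'I_b.

Let b0 : (0 < b)%N. Proof. exact: leq_trans b_ge2. Qed.

Lemma net_density_measurable : measurable_fun setT (net_density s : R * R -> R).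
Proof.
have mi (A : set R) : measurable A -> measurable_fun setT (\1_A : R -> R) by move=> mA; exact: measurable_indic.
apply: measurable_funB.
  apply: measurable_funM; first exact: measurable_cst.
  apply: measurable_sum => t; apply: measurable_tensor; apply: mi; exact: measurable_itv.
apply: (@measurable_tensor R (fun x => \1_`[0, 1[%classic x * x) (fun x => \1_`[0, 1[%classic x * x));
  apply: measurable_funM => //; apply: mi; exact: measurable_itv.
Qed.

Lemma net_density_bound (x : R * R) : `|net_density s x| <= 8 * plane_bump x.
Proof.
have bn0 : 0 < b%:R ^+ n :> R by rewrite exprn_gt0// ltr0n.
have g0 (u : R) : 0 <= (1 + u ^+ 2)^-1 by rewrite invr_ge0 ltW// gt0_1Dsqr.
have h z u : 0 <= z :> R -> `|\1_(`]z, 1[%classic : set R) u| <= 2 * (1 + u ^+ 2)^-1.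
  by move=> z0; apply: indic_bump; exact: subset_oo01.
have h0 (u : R) : `|\1_(`[0, 1[%classic : set R) u * u| <= 2 * (1 + u ^+ 2)^-1.
  rewrite normrM; apply: le_trans (indic_bump (@subset_co01 R) u).
  rewrite indicE; case: (boolP (u \in _)) => [|_]; last by rewrite normr0 mul0r.
  by rewrite inE /= in_itv/= normr1 mul1r => /andP[u0 u1]; rewrite ger0_norm// ltW.
rewrite /net_density (le_trans (ler_normB _ _))//.
have -> : 8 * plane_bump x = 4 * plane_bump x + 4 * plane_bump x by ring.
have e4 : 4 * plane_bump x = 2 * (1 + x.1 ^+ 2)^-1 * (2 * (1 + x.2 ^+ 2)^-1).
  by rewrite /plane_bump; ring.
apply: lerD; last by rewrite normrM e4 ler_pM.
rewrite normrM normfV (gtr0_norm bn0) mulrC ler_pdivrMr//.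
apply: le_trans (ler_norm_sum _ _ _) _.
apply: (@le_trans _ _ (\sum_(t : {ffun 'I_n -> 'I_b}) 4 * plane_bump x)).
  by apply: ler_sum => t _; rewrite normrM e4 ler_pM// h// point_coord_ge0.
by rewrite sumr_const card_ffun !card_ord -[leLHS]mulr_natr natrX.
Qed.

Section RealKernels.
Variables (k1 k2 : nat) (kap1 P1 Pi1 kap2 P2 Pi2 : R -> R).
Hypotheses (ck1 : continuous (dyadic_kernel kap1 k1)) (dP1 : has_deriv P1 kap1).
Hypotheses (ck2 : continuous (dyadic_kernel kap2 k2)) (dP2 : has_deriv P2 kap2).
Hypothesis (dPi1 : has_deriv Pi1 (dyadic_primitive P1 k1)).
Hypothesis (dPi2 : has_deriv Pi2 (dyadic_primitive P2 k2)).

(** Every term of the density is a product, so the integral splits into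
    one-dimensional ones: increments of the primitive for the points, linear
    moments for the area. *)
Lemma Rintegral_net_density (y : R * R) :
  let F (x : R * R) := net_density s x * (dyadic_kernel kap1 k1 (y.1 - x.1) * dyadic_kernel kap2 k2 (y.2 - x.2)) in
  plane.-integrable setT (EFin \o F) /\
  \int[plane]_x F x = smoothed_discrepancy k1 k2 P1 Pi1 P2 Pi2 s y.
Proof.
move=> F.
pose A1 (t : {ffun 'I_n -> 'I_b}) (x : R) := \1_(`]point_coord t, 1[%classic) x * dyadic_kernel kap1 k1 (y.1 - x).
pose A2 (t : {ffun 'I_n -> 'I_b}) (x : R) := \1_(`]point_coord (mirror s t), 1[%classic) x * dyadic_kernel kap2 k2 (y.2 - x).
pose B1 (x : R) := \1_(`[0, 1[%classic) x * (x * dyadic_kernel kap1 k1 (y.1 - x)).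
pose B2 (x : R) := \1_(`[0, 1[%classic) x * (x * dyadic_kernel kap2 k2 (y.2 - x)).
have pc (t : {ffun 'I_n -> 'I_b}) : 0 <= (point_coord t : R) <= 1 by rewrite point_coord_ge0// point_coord_le1.
have [iB1 eB1] := Rintegral_linear ck1 dP1 dPi1 y.1.
have [iB2 eB2] := Rintegral_linear ck2 dP2 dPi2 y.2.
have FE x : F x = (b%:R ^+ n)^-1 * (\sum_t A1 t x.1 * A2 t x.2) - B1 x.1 * B2 x.2.
  rewrite /F /net_density mulrBl; congr (_ - _); last by rewrite /B1 /B2; ring.
  rewrite -mulrA mulr_suml; congr (_ * _).
  by apply: eq_bigr => t _; rewrite /A1 /A2; ring.
have iA t : plane.-integrable setT (EFin \o (fun x => A1 t x.1 * A2 t x.2)).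
  have [i1 _] := Rintegral_step ck1 dP1 y.1 (pc t).
  have [i2 _] := Rintegral_step ck2 dP2 y.2 (pc (mirror s t)).
  exact: (integrable_tensor i1 i2).
have iB : plane.-integrable setT (EFin \o (fun x => B1 x.1 * B2 x.2)) by exact: (integrable_tensor iB1 iB2).
have [iS eS] := Rintegral_sum (index_enum {ffun 'I_n -> 'I_b}) iA.
have iS' := integrable_scale (b%:R ^+ n)^-1 iS.
have -> : F = (fun x => (b%:R ^+ n)^-1 * (\sum_t A1 t x.1 * A2 t x.2) - B1 x.1 * B2 x.2) by apply/funext.
split; first exact: (integrableB measurableT iS' iB).
rewrite (RintegralB measurableT iS' iB) RintegralZl// eS.
rewrite [X in _ - X](_ : _ = linear_moment P1 Pi1 k1 y.1 * linear_moment P2 Pi2 k2 y.2); last first.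
  by rewrite -eB1 -eB2; exact: (Rintegral_tensor iB1 iB2).
rewrite /smoothed_discrepancy; congr (_ * _ - _); apply: eq_bigr => t _.
have [i1 <-] := Rintegral_step ck1 dP1 y.1 (pc t).
have [i2 <-] := Rintegral_step ck2 dP2 y.2 (pc (mirror s t)).
exact: (Rintegral_tensor i1 i2).
Qed.

End RealKernels.
End NetConvolution.

(** * Distributions and sequence norms *)

Section SquareDistribution.
Context {R : realType}.
Local Notation plane := (@lebesgue_plane R).
Variables (b n : nat).
Hypothesis b_ge2 : (2 <= b)%N.
Variable s : 'I_n -> 'I_b -> 'I_b.

Let f : R * R -> R := net_density s.

Lemma net_density_integrable (psi : R * R -> R[i]) : schwartz psi ->
  cint_finite plane (fun x => (f x)%:C * psi x).
Proof.
move=> spsi; have mpsi := schwartz_measurable spsi.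
have [M M0 bM] := schwartz_bound spsi.
have i8 : plane.-integrable setT (EFin \o (fun x => (8 * M) * plane_bump x)).
  by apply: integrable_scale; exact: integrable_plane_bump.
have p01 (x : R * R) : 0 <= plane_bump x <= 1.
  have g1 (u : R) : 1 <= 1 + u ^+ 2 by exact: ge1_1Dsqr.
  have g0 (u : R) : 0 < 1 + u ^+ 2 by exact: gt0_1Dsqr.
  rewrite /plane_bump mulr_ge0 ?invr_ge0 ?(ltW (g0 _))//=.
  by rewrite -[leRHS]mulr1 ler_pM// ?invr_ge0 ?(ltW (g0 _))// invf_le1.
apply: (cint_finite_dominated _ i8).
  by apply: cmeasurableM => //; apply: cmeasurable_real; exact: net_density_measurable.
move=> x; have /andP[x0 x1] := p01 x.
rewrite Normc.normcM (_ : normc (f x)%:C = `|f x|); last by rewrite /= expr0n/= addr0 sqrtr_sqr.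
have h1 : `|f x| <= 8 := le_trans (net_density_bound b_ge2 s x) (ler_piMr _ x1).
by rewrite -mulrA; apply: ler_pM => //; [exact: cnorm_ge0|exact: h1].
Qed.

(** It integrates against a bounded function that vanishes outside the square,
    hence is controlled by the supremum of the test function, the seminorm of
    order 0. *)
Lemma square_distribution_tempered :
  tempered (square_distribution (discrepancy (hammersley s)) : (R * R -> R[i]) -> R[i]).
Proof.
split.
  move=> a psi chi spsi schi; rewrite !(square_distribution_net b_ge2).
  have i1 := net_density_integrable spsi; have i2 := net_density_integrable schi.
  rewrite -(cintZ a i1) -cintD//; last exact: cint_finiteZ.
  by congr (cint plane _); apply/funext => x; rewrite mulrDr mulrCA.
pose I := \int[plane]_x (8 * plane_bump x).
have i8 : plane.-integrable setT (EFin \o (fun x => 8 * plane_bump x)).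
  by apply: integrable_scale; exact: integrable_plane_bump.
exists 0%N, (2 * I) => psi spsi.
have [i1 i2] := net_density_integrable spsi.
have sn0 (y : R * R) : ((normc (psi y))%:E <= schwartz_seminorm 0 psi)%E.
  apply: le_trans (ereal_sup_ubound _); last by exists y.
  rewrite lee_fin expr0 mul1r (bigD1 (ord0, ord0))//= lerDl; apply: sumr_ge0 => *; exact: cnorm_ge0.
have fs : schwartz_seminorm 0 psi \is a fin_num.
  rewrite fin_numElt; have [_ /(_ 0%N) ->] := spsi; rewrite andbT.
  by apply: lt_le_trans (sn0 0); exact: ltNyr.
rewrite -(fineK fs) -EFinM lee_fin; set M := fine _.
have bM y : normc (psi y) <= M by rewrite -lee_fin fineK.
rewrite (square_distribution_net b_ge2); apply: le_trans (cnorm_le _) _; rewrite /cint /=.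
have main (g : R * R -> R) : plane.-integrable setT (EFin \o g) -> (forall x, `|g x| <= M * (8 * plane_bump x)) ->
    `|\int[plane]_x g x| <= I * M.
  move=> ig bg; apply: le_trans (le_normr_Rintegral _ ig) _ => //.
  rewrite mulrC -RintegralZl//; apply: le_Rintegral => //.
  - exact: integrable_abse ig.
  - exact: integrable_scale.
have bf x : normc ((f x)%:C * psi x) <= M * (8 * plane_bump x).
  rewrite Normc.normcM (_ : normc (f x)%:C = `|f x|); last by rewrite /= expr0n/= addr0 sqrtr_sqr.
  by rewrite mulrC ler_pM// ?cnorm_ge0// net_density_bound.
rewrite (_ : 2 * I * M = I * M + I * M); last by ring.
apply: lerD.
- apply: main i1 _ => x; exact: le_trans (cnorm_ge_Re _) (bf x).
- apply: main i2 _ => x; exact: le_trans (cnorm_ge_Im _) (bf x).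
Qed.

End SquareDistribution.

Section NormDomination.
Context {R : realType}.
Local Notation plane := (@plane_measure R).

Lemma Lnorm_le_sum (I : Type) (r : seq I) (g : R * R -> R) (f : I -> R * R -> R) (p : R) : 1 <= p ->
  measurable_fun setT g -> (forall i, measurable_fun setT (f i)) ->
  (forall y, `|g y| <= \sum_(i <- r) `|f i y|) ->
  ('N[plane]_p%:E [EFin \o g] <= \sum_(i <- r) 'N[plane]_p%:E [EFin \o f i])%E.
Proof.
move=> p1 mg mf gf; have p0 : 0 < p by exact: lt_le_trans p1.
have ma i : measurable_fun setT (fun y => `|f i y|) by exact: measurableT_comp.
apply: (@le_trans _ _ ('N[plane]_p%:E [EFin \o (fun y => (\sum_(i <- r) `|f i y|)%R)])%E).
  rewrite unlock /Lnorm; apply: gt0_ler_poweR.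
  - by rewrite invr_ge0 ltW.
  - by rewrite in_itv/= leey andbT integral_ge0// => y _; exact: poweR_ge0.
  - by rewrite in_itv/= leey andbT integral_ge0// => y _; exact: poweR_ge0.
  have mp (h : R * R -> R) : measurable_fun setT h -> measurable_fun setT (fun y => (`|(EFin \o h) y| `^ p)%E).
    move=> mh; under eq_fun do rewrite abse_EFin poweR_EFin.
    apply/measurable_EFinP; apply: (measurableT_comp (measurable_powR p)); exact: measurableT_comp.
  apply: ge0_le_integral => //.
  - by move=> y _; exact: poweR_ge0.
  - exact: mp.
  - by apply: mp; exact: measurable_sum.
  - move=> y _; rewrite !abse_EFin !poweR_EFin lee_fin ge0_ler_powR ?nnegrE// ?(ltW p0)//.
    by rewrite [leRHS]ger0_norm// sumr_ge0.
apply: le_trans (Lnorm_sum_le r p1 ma) _.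
apply: lee_sum => i _; rewrite -[leRHS]Lnorm_abse.
by rewrite le_eqVlt; apply/orP; left; apply/eqP.
Qed.

End NormDomination.

(** Every finite set of pairs lies in a square. *)
Lemma esum_le_square {R : realType} (A : nat * nat -> \bar R) (L : \bar R) :
  (forall k, (0 <= A k)%E) ->
  (forall N, (\sum_(0 <= k1 < N) \sum_(0 <= k2 < N) A (k1, k2) <= L)%E) ->
  (\esum_(k in [set: nat * nat]) A k <= L)%E.
Proof.
move=> A_ge0 A_sum; rewrite /esum; apply: ge_ereal_sup => _ [F [fF _] <-].
rewrite fsbig_finite//=; set s := fset_set F.
pose N := (\max_(k <- s) maxn k.1 k.2).+1.
pose square := [seq (i, j) | i <- index_iota 0 N, j <- index_iota 0 N].
apply: le_trans (A_sum N).
have -> : (\sum_(0 <= k1 < N) \sum_(0 <= k2 < N) A (k1, k2) = \sum_(k <- square) A k)%E.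
  by rewrite /square big_allpairs.
have inN k : k \in s -> (k.1 < N)%N /\ (k.2 < N)%N.
  move=> ks; have : (maxn k.1 k.2 <= \max_(k <- s) maxn k.1 k.2)%N by exact: (leq_bigmax_seq k).
  by rewrite geq_max => /andP[h1 h2]; rewrite !ltnS.
have us : uniq square.
  by apply: allpairs_uniq; rewrite ?iota_uniq// => -[a c] [a' c'].
have ps : perm_eq s [seq k <- square | k \in s].
  apply: uniq_perm; [exact: fset_uniq|exact: filter_uniq|].
  move=> [k1 k2]; rewrite mem_filter; case: (boolP (_ \in s)) => //= ks.
  have [h1 h2] := inN _ ks; apply/esym/allpairsP; exists (k1, k2).
  by rewrite /= !mem_index_iota.
have -> : (\sum_(k <- s) A k = \sum_(k <- square | k \in s) A k)%E.
  by rewrite (perm_big _ ps) big_filter.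
by apply: (@lee_sum_nneg _ _ square xpredT (fun k => k \in s)) => k _ _.
Qed.

Section SequenceNorm.
Context {R : realType}.
Variables (A : nat * nat -> \bar R) (M L : R).
Hypotheses (A_ge0 : forall k, (0 <= A k)%E) (A_le : forall k, (A k <= M%:E)%E).
Hypotheses (M_ge0 : 0 <= M) (L_ge0 : 0 <= L).
Hypothesis A_sum : forall N, (\sum_(0 <= k1 < N) \sum_(0 <= k2 < N) A (k1, k2) <= L%:E)%E.

(** From A^q <= M^(q-1) A. *)
Lemma esum_power_le (q : R) : 1 <= q ->
  ((\esum_(k in [set: nat * nat]) A k `^ q) `^ q^-1 <= ((M `^ (q - 1) * L) `^ q^-1)%:E)%E.
Proof.
move=> q1; have q0 : 0 < q by exact: lt_le_trans q1.
have Aq k : (A k `^ q <= (M `^ (q - 1))%:E * A k)%E.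
  have Afin : A k \is a fin_num by rewrite ge0_fin_numE// (le_lt_trans (A_le k))// ltry.
  rewrite -(fineK Afin) poweR_EFin -EFinM lee_fin.
  have a0 : 0 <= fine (A k) by exact: fine_ge0.
  rewrite -mulr_powRB1// mulrC ler_wpM2r// ge0_ler_powR ?nnegrE ?subr_ge0//.
  by rewrite -lee_fin fineK.
have h : (\esum_(k in [set: nat * nat]) A k `^ q <= (M `^ (q - 1) * L)%:E)%E.
  apply: esum_le_square => [k|N]; first exact: poweR_ge0.
  apply: (@le_trans _ _ ((M `^ (q - 1))%:E * \sum_(0 <= k1 < N) \sum_(0 <= k2 < N) A (k1, k2))%E).
    rewrite ge0_sume_distrr; last by move=> *; exact: sume_ge0.
    apply: lee_sum => k1 _; rewrite ge0_sume_distrr//.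
    by apply: lee_sum => k2 _; exact: Aq.
  by rewrite EFinM lee_wpmul2l// lee_fin powR_ge0.
rewrite -poweR_EFin; apply: gt0_ler_poweR => //.
- by rewrite invr_ge0 ltW.
- by rewrite in_itv/= leey andbT esum_ge0// => k _; exact: poweR_ge0.
- by rewrite in_itv/= leey andbT lee_fin mulr_ge0 ?powR_ge0.
Qed.
End SequenceNorm.

(** * Conclusion *)

Section BesovTerms.
Context {R : realType}.
Variable phi : R -> R[i].
Hypothesis gen_phi : resolution_generator phi.
Variables (b : nat) (p r c0 : R).
Hypotheses (b_ge2 : (2 <= b)%N) (p_ge1 : 1 <= p) (r_ge0 : 0 <= r) (r_ltVp : r < p^-1).
Hypothesis c0_gt0 : 0 < c0.

Definition base_kernel (a : bool) : R -> R := if a then kernel_re phi else kernel_im phi.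

Lemma kernel_primitives : exists (C : bool -> R) (P : bool -> R -> R) (Pi : bool -> nat -> R -> R),
  forall a, [/\ good_kernel (C a) (base_kernel a), has_deriv (P a) (base_kernel a) &
    forall k, has_deriv (Pi a k) (dyadic_primitive (P a) k)].
Proof.
have : forall a, exists X : R * (R -> R) * (nat -> R -> R),
    [/\ good_kernel X.1.1 (base_kernel a), has_deriv X.1.2 (base_kernel a) &
    forall k, has_deriv (X.2 k) (dyadic_primitive X.1.2 k)].
  move=> a.
  have [C gk] : exists C, good_kernel C (base_kernel a).
    by have [h1 h2] := good_kernels gen_phi; case: a.
  have ck : continuous (base_kernel a) by case: gk.
  have [P dP] := continuous_has_primitive ck.
  have [Pi dPi] := choice (fun k => continuous_has_primitive (@dyadic_primitive_cont _ _ _ k dP)).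
  by exists (C, P, Pi).
by move=> /choice[X HX]; exists (fun a => (X a).1.1), (fun a => (X a).1.2), (fun a => (X a).2).
Qed.

Section Net.
Variables (P : bool -> R -> R) (Pi : bool -> nat -> R -> R).
Hypothesis dP : forall a, has_deriv (P a) (base_kernel a).
Hypothesis dPi : forall a k, has_deriv (Pi a k) (dyadic_primitive (P a) k).
Variables (n : nat) (s : 'I_n -> 'I_b -> 'I_b).

Let S (k : nat * nat) (a : bool * bool) : R * R -> R :=
  smoothed (P a.1) (P a.2) (Pi a.1) (Pi a.2) s k.1 k.2.

(** Real and imaginary part of a product of two complex kernels, each with
    real and imaginary part. *)
Lemma convolution_netE k y : convolution phi k (net_density s) y =
   (S k (true, true) y - S k (false, false) y) +i* (S k (true, false) y + S k (false, true) y).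
Proof.
have cd a j : continuous (dyadic_kernel (base_kernel a) j).
  have [C gk] : exists C, good_kernel C (base_kernel a).
    by have [h1 h2] := good_kernels gen_phi; case: a.
  by have [] := dyadic_kernel_bounded j gk.
have H a c := Rintegral_net_density b_ge2 s (cd a k.1) (dP a) (cd c k.2) (dP c) (dPi a k.1) (dPi c k.2) y.
have [i1 e1] := H true true; have [i2 e2] := H false false.
have [i3 e3] := H true false; have [i4 e4] := H false true.
have ER (u a1 a2 c1 c2 : R) : Re (u%:C * ((a1 +i* a2) * (c1 +i* c2))) = u * (a1 * c1) - u * (a2 * c2).
  by rewrite /=; ring.
have EI (u a1 a2 c1 c2 : R) : Im (u%:C * ((a1 +i* a2) * (c1 +i* c2))) = u * (a1 * c2) + u * (a2 * c1).
  by rewrite /=; ring.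
rewrite /convolution /cint /S /smoothed -e1 -e2 -e3 -e4; congr (_ +i* _).
  by rewrite -RintegralB//; apply: eq_Rintegral => x _; exact: ER.
by rewrite -RintegralD//; apply: eq_Rintegral => x _; exact: EI.
Qed.

Lemma normc_convolution k y :
  normc (convolution phi k (net_density s) y) <= \sum_(a : bool * bool) `|S k a y|.
Proof.
rewrite convolution_netE; apply: le_trans (cnorm_le _) _ => /=.
rewrite -(pair_bigA _ (fun a c => `|S k (a, c) y|)) !big_bool/=.
have h1 := ler_normB (S k (true, true) y) (S k (false, false) y).
have h2 := ler_normD (S k (true, false) y) (S k (false, true) y).
by lra.
Qed.

Lemma convolution_measurable k : measurable_fun setT (fun y => normc (convolution phi k (net_density s) y)).
Proof.
have mS a : measurable_fun setT (S k a).
  exact: (measurable_smoothed b_ge2 (dP a.1) (dP a.2) (dPi a.1) (dPi a.2)).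
under eq_fun do rewrite convolution_netE /=.
apply: measurableT_comp; first by apply: continuous_measurable_fun; exact: sqrt_continuous.
by apply: measurable_funD; apply: measurable_funX; [apply: measurable_funB|apply: measurable_funD].
Qed.

(** The convolution is one of the functions over which the infimum is taken. *)
Lemma besov_term_le k :
  (besov_term phi p%:E r (square_distribution (discrepancy (hammersley s))) k <=
    \sum_(a : bool * bool) ((2 `^ (r * (k.1 + k.2)%:R))%:E * 'N[plane_measure]_p%:E [EFin \o S k a]))%E.
Proof.
rewrite /besov_term -ge0_sume_distrr; last by move=> *; exact: Lnorm_ge0.
apply: lee_wpmul2l; first by rewrite lee_fin powR_ge0.
apply: (@le_trans _ _ ('N[plane_measure]_p%:E [EFin \o (normc \o convolution phi k (net_density s))])%E).
  apply: ereal_inf_lbound; exists (convolution phi k (net_density s)) => // psi spsi.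
  have [i e] := convolution_represents gen_phi k (net_density_measurable s)
    (net_density_bound b_ge2 s) spsi.
  split; first exact: i.
  by rewrite -[RHS]e; exact: square_distribution_net.
apply: Lnorm_le_sum => //.
- exact: convolution_measurable.
- by move=> a; exact: (measurable_smoothed b_ge2 (dP a.1) (dP a.2) (dPi a.1) (dPi a.2)).
- by move=> y; rewrite ger0_norm ?cnorm_ge0//; exact: normc_convolution.
Qed.

End Net.

Lemma besov_term_ge0 u k : (0 <= besov_term phi p%:E r u k)%E.
Proof.
apply: mule_ge0; first by rewrite lee_fin powR_ge0.
apply: le_ereal_inf_tmp => _ [h _ <-]; exact: Lnorm_ge0.
Qed.

(** The constants of the four combinations of kernels are added. *)
Lemma besov_term_sums : exists2 K : R, 0 < K & forall n (s : 'I_n -> 'I_b -> 'I_b),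
  (0 < n)%N -> digit_maps s -> `|2 * (num_id s)%:R - n%:R| <= c0 ->
  let A := besov_term phi p%:E r (square_distribution (discrepancy (hammersley s))) in
  (forall k, (A k <= (K * net_scale b r n)%:E)%E) /\
  (forall N, (\sum_(0 <= k1 < N) \sum_(0 <= k2 < N) A (k1, k2) <= (K * net_scale b r n * n%:R)%:E)%E).
Proof.
have [C [P [Pi H]]] := kernel_primitives.
have gk a : good_kernel (C a) (base_kernel a) by have [] := H a.
have dP a : has_deriv (P a) (base_kernel a) by have [] := H a.
have dPi a : forall k, has_deriv (Pi a k) (dyadic_primitive (P a) k) by have [] := H a.
have : forall a : bool * bool, exists K : R, 0 < K /\ forall n (s : 'I_n -> 'I_b -> 'I_b),
  (0 < n)%N -> digit_maps s -> `|2 * (num_id s)%:R - n%:R| <= c0 ->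
  let A k1 k2 := ((2 `^ (r * (k1 + k2)%:R))%:E * 'N[plane_measure]_p%:E
     [EFin \o smoothed (P a.1) (P a.2) (Pi a.1) (Pi a.2) s k1 k2])%E in
  (forall k1 k2, (A k1 k2 <= (K * net_scale b r n)%:E)%E) /\
  (forall N, (\sum_(0 <= k1 < N) \sum_(0 <= k2 < N) A k1 k2 <= (K * net_scale b r n * n%:R)%:E)%E).
  move=> a.
  have [K K0 HK] := smoothed_besov_sums b_ge2 p_ge1 r_ge0 r_ltVp c0_gt0 (gk a.1) (dP a.1) (gk a.2) (dP a.2) (dPi a.1) (dPi a.2).
  by exists K.
move=> /choice[K HK]; exists (\sum_a K a).
  have h (a : bool * bool) := (HK a).1.
  by rewrite (bigD1 (true, true))//= ltr_pwDl// sumr_ge0// => a _; exact: ltW.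
move=> n s n0 ds bal A.
have bt k := besov_term_le dP dPi s k.
split => [k|N].
  apply: le_trans (bt k) _; rewrite mulr_suml -sumEFin; apply: lee_sum => a _.
  by have [_ /(_ n s n0 ds bal)[h _]] := HK a; exact: h.
apply: (@le_trans _ _ (\sum_(0 <= k1 < N) \sum_(0 <= k2 < N) \sum_(a : bool * bool)
   ((2 `^ (r * (k1 + k2)%:R))%:E * 'N[plane_measure]_p%:E
     [EFin \o smoothed (P a.1) (P a.2) (Pi a.1) (Pi a.2) s k1 k2]))%E).
  by apply: lee_sum => k1 _; apply: lee_sum => k2 _; exact: bt.
under eq_bigr do rewrite exchange_big/=.
rewrite exchange_big/= !mulr_suml -sumEFin; apply: lee_sum => a _.
by have [_ /(_ n s n0 ds bal)[_ h]] := HK a; exact: h.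
Qed.

End BesovTerms.

Theorem theorem1p1 (R : realType) (phi0 : R -> R[i])
    (hphi0 : resolution_generator phi0)
    (p q : \bar R) (hp : (1%:E <= p)%E) (hq : (1%:E <= q)%E)
    (r : R) (hr0 : 0 <= r) (hrp : (r%:E < p^-1)%E)
    (c0 : R) (hc0 : 0 < c0)
    (b : nat) (hb : (2 <= b)%N) :
  exists2 c : R, 0 < c &
    forall (n : nat) (s : 'I_n -> 'I_b -> 'I_b),
      (0 < n)%N -> digit_maps s ->
      `|2 * (num_id s)%:R - n%:R| <= c0 ->
      (besov_norm_square phi0 p q r
         (square_distribution (discrepancy (hammersley s)))
       <= (c * (b%:R `^ (n%:R * (r - 1))) * (n%:R `^ (fine (q^-1)%E)))%:E)%E.
Proof.
case: p hp hrp => [p| |] hp hrp; last 2 first.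
(* For p = +oo the condition on r reads r < 0. *)
- by move: hrp; rewrite invey lte_fin ltNge hr0.
- by move: hp; rewrite leeNy_eq.
have p1 : 1 <= p by rewrite -lee_fin.
have p0 : 0 < p by exact: lt_le_trans p1.
have rp : r < p^-1 by move: hrp; rewrite inver gt_eqF// lte_fin.
have [K K0 HK] := besov_term_sums hphi0 hb p1 hr0 rp hc0.
exists K => // n s n0 ds bal.
have [Ale Asum] := HK n s n0 ds bal.
set g := square_distribution _ in Ale Asum *.
have X0 := net_scale_gt0 r hb n.
have KX0 : 0 <= K * net_scale b r n by rewrite mulr_ge0 ?ltW.
suff main : (besov_norm phi0 p%:E q r g <= (K * net_scale b r n * (n%:R `^ (fine (q^-1)%E)))%:E)%E.
  apply: (le_trans _ main); apply: ereal_inf_lbound; exists g => //; split => //; split.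
    exact: square_distribution_tempered.
  by rewrite (le_lt_trans main)// ltry.
case: q hq => [q| |] hq; last first.
- by move: hq; rewrite leeNy_eq.
- rewrite invey/= powRr0 mulr1; apply: ge_ereal_sup => _ [k _ <-]; exact: Ale.
have q1 : 1 <= q by rewrite -lee_fin.
have q0 : 0 < q by exact: lt_le_trans q1.
rewrite inver gt_eqF//=.
apply: le_trans (esum_power_le _ Ale KX0 _ Asum q1) _.
- by move=> k; exact: besov_term_ge0.
- by rewrite mulr_ge0.
rewrite lee_fin mulrA [X in X * _](_ : _ = (K * net_scale b r n) `^ q); last first.
  by rewrite mulrC mulr_powRB1.
by rewrite powRM ?powR_ge0// -powRrM divff ?gt_eqF// powRr1.
Qed.
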